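(* Let $n\ge 1$ be an integer and let $0<s,s'<1$ with $s+s'\le 1$. Then for any $u\in\mathscr S(\mathbb R^n)$ we have $$(-\Delta)^{s+s'}u=(-\Delta)^s(-\Delta)^{s'}u=(-\Delta)^{s'}(-\Delta)^s u .$$
   Context: $\mathscr S(\mathbb R^n)$ is the Schwartz space. For $0<\sigma<1$ and $v\in C^2(\mathbb R^n)\cap L^\infty(\mathbb R^n)$ (in particular for $v\in\mathscr S(\mathbb R^n)$, and for $v=(-\Delta)^{\sigma'}u$ with $u\in\mathscr S(\mathbb R^n)$, $0<\sigma'<1$), $$(-\Delta)^\sigma v(x)=\frac{\gamma(n,\sigma)}{2}\int_{\mathbb R^n}\frac{2v(x)-v(x+y)-v(x-y)}{|y|^{n+2\sigma}}\,dy,\qquad \gamma(n,\sigma)=\frac{\sigma\,2^{2\sigma}\,\Gamma\left(\frac{n+2\sigma}{2}\right)}{\pi^{n/2}\,\Gamma(1-\sigma)}.$$ For $\sigma=1$, $(-\Delta)^1=-\Delta=-\sum_{k=1}^n\partial^2/\partial x_k^2$. *)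

(* Defs.v *)
From HB Require Import structures.
From mathcomp Require Import all_boot all_order all_algebra.
From mathcomp Require Import all_classical all_reals all_analysis.
From mathcomp Require Export complex.

Set Implicit Arguments.
Unset Strict Implicit.
Unset Printing Implicit Defensive.

Import Order.TTheory GRing.Theory Num.Theory.
Import numFieldNormedType.Exports.

Local Open Scope classical_set_scope.
Local Open Scope ring_scope.
Local Open Scope complex_scope.

Section LebesgueMeasure.
Context (R : realType).

Definition cons_pair (n : nat)
    (p : measurableTypeR R * n.-tuple (measurableTypeR R)) :
    n.+1.-tuple (measurableTypeR R) :=
  [the n.+1.-tuple (measurableTypeR R) of p.1 :: p.2].

Lemma measurable_cons_pair (n : nat) : measurable_fun setT (@cons_pair n).
Proof. by apply: measurable_cons; [exact: measurable_fst | exact: measurable_snd]. Qed.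

(* Lebesgue measure on R^n is built on n.-tuple R, which the library equips with
   the product sigma-algebra (unlike 'rV[R]_n), through R^(n+1) = R x R^n. The
   product [\x^] (integrate the R-sections over R^n) needs sigma-finiteness of the
   R-factor only, [\x] would need that of the R^n-factor. *)
Section LebesgueCons.
Context (n : nat) (mu : {measure set (n.-tuple (measurableTypeR R)) -> \bar R}).
Local Open Scope ereal_scope.

Definition lebesgue_cons : set (n.+1.-tuple (measurableTypeR R)) -> \bar R :=
  pushforward (lebesgue_measure \x^ mu) (@cons_pair n).

Let mf := @measurable_cons_pair n.

Let lebesgue_cons0 : lebesgue_cons set0 = 0.
Proof. exact: measure0. Qed.

Let lebesgue_cons_ge0 A : 0 <= lebesgue_cons A.
Proof. exact: measure_ge0. Qed.

Let lebesgue_cons_sigma_additive : semi_sigma_additive lebesgue_cons.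
Proof. exact: measure_semi_sigma_additive. Qed.

HB.instance Definition _ := isMeasure.Build _ _ _ lebesgue_cons
  lebesgue_cons0 lebesgue_cons_ge0 lebesgue_cons_sigma_additive.

End LebesgueCons.

Fixpoint lebesgue_tuple (n : nat) :
    {measure set (n.-tuple (measurableTypeR R)) -> \bar R} :=
  match n with
  | 0 => [the {measure set _ -> \bar R} of
           dirac ([tuple] : 0.-tuple (measurableTypeR R))]
  | m.+1 => [the {measure set _ -> \bar R} of lebesgue_cons (lebesgue_tuple m)]
  end.

Definition row_of_tuple (n : nat) (t : n.-tuple R) : 'rV[R]_n :=
  \row_(i < n) tnth t i.

Definition Cintegral (n : nat) (F : 'rV[R]_n -> R[i]) : R[i] :=
  (\int[lebesgue_tuple n]_t complex.Re (F (row_of_tuple t))) +i*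
  (\int[lebesgue_tuple n]_t complex.Im (F (row_of_tuple t))).

End LebesgueMeasure.

Section FractionalLaplacian.
Context (R : realType).

(* The library norm on 'rV[R]_n is the sup norm. *)
Definition enorm (n : nat) (y : 'rV[R]_n) : R :=
  Num.sqrt (\sum_(i < n) y 0 i ^+ 2).

Definition Gamma (z : R) : R :=
  \int[lebesgue_measure]_(t in `]0, +oo[) (t `^ (z - 1) * expR (- t)).

Definition pderiv (n : nat) (k : 'I_n) (v : 'rV[R]_n -> R[i]) (x : 'rV[R]_n) :
    R[i] :=
  'D_(delta_mx 0 k) (fun y => complex.Re (v y)) x +i*
  'D_(delta_mx 0 k) (fun y => complex.Im (v y)) x.

Definition pderivs (n : nat) (l : seq 'I_n) (v : 'rV[R]_n -> R[i]) :
    'rV[R]_n -> R[i] :=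
  foldr (@pderiv n) v l.

(* [pderivs] is total, so existence of the partial derivatives is part of the
   definition. *)
Definition smooth (n : nat) (u : 'rV[R]_n -> R[i]) : Prop :=
  forall l : seq 'I_n,
    [/\ continuous (fun y => complex.Re (pderivs l u y)),
        continuous (fun y => complex.Im (pderivs l u y)),
        forall x k, derivable (fun y => complex.Re (pderivs l u y)) x (delta_mx 0 k) &
        forall x k, derivable (fun y => complex.Im (pderivs l u y)) x (delta_mx 0 k)].

(* [l] lists the directions of differentiation, so it ranges over all
   multi-indices (several lists may give the same one). *)
Definition schwartz (n : nat) (u : 'rV[R]_n -> R[i]) : Prop :=
  smooth u /\
  forall (a : 'I_n -> nat) (l : seq 'I_n), exists M : R, forall x : 'rV[R]_n,
    `|(\prod_(k < n) x 0 k ^+ a k)%:C * pderivs l u x| <= M%:C.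

Definition neg_laplacian (n : nat) (v : 'rV[R]_n -> R[i]) (x : 'rV[R]_n) :
    R[i] :=
  - \sum_(k < n) pderiv k (pderiv k v) x.

Definition gamma_cst (n : nat) (sigma : R) : R :=
  sigma * 2 `^ (2 * sigma) * Gamma ((n%:R + 2 * sigma) / 2) /
  (pi `^ (n%:R / 2) * Gamma (1 - sigma)).

Definition frac_laplacian (n : nat) (sigma : R) (v : 'rV[R]_n -> R[i])
    (x : 'rV[R]_n) : R[i] :=
  if sigma == 1 then neg_laplacian v x
  else (gamma_cst n sigma / 2)%:C *
       Cintegral (fun y : 'rV[R]_n =>
         (2 * v x - v (x + y) - v (x - y)) /
         (enorm y `^ (n%:R + 2 * sigma))%:C).

End FractionalLaplacian.

(* Main.v *)
(** Let [P_t] be the heat semigroup on R^n.  Integrating the heat kernel against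
    [t^(-1-s)] gives the kernel of the fractional Laplacian, so that
    [(-Delta)^s v (x) = s / Gamma(1-s) * int_0^oo t^(-1-s) (v(x) - P_t v(x)) dt].
    For fixed [x] put [phi t = P_t u (x)].  By the semigroup law,
    [(-Delta)^s (-Delta)^s' u (x)] is the value at [0] of the Marchaud derivative
    of order [s] of the Marchaud derivative of order [s'] of [phi].  So the
    theorem reduces to the composition rule for Marchaud derivatives of a bounded
    C^2 function on the half line.  For exponentially decaying functions that rule
    is Fubini together with the Beta integral; the general case follows by
    dominated convergence applied to [exp (- eps t) * phi t].  When [s + s' = 1]
    one gets [- phi'(0) = - Delta u (x)]. *)

(* On the Fourier side the claim is a product of powers of |xi|, but the inner function (-Delta)^s'
   u need not be rapidly decreasing, and the outer operator meets it only as a singular integral.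
   What survives the inner operator is a bound of order min(1, |y|^2) on second differences, uniform
   in the base point; the record [tame] isolates it.

   Differentiability of t -> P_t f(x) is obtained without differentiating the heat kernel in time. A
   fourth order Taylor expansion gives |P_h f - f - h Delta f| <= C h^2 uniformly in x, and the
   semigroup law carries this from time 0 to every time.

   The damping has the following origin. Integration by parts turns Marchaud derivatives into
   integrals of phi' and phi'' against powers of t, and these may diverge when phi' and phi'' are
   merely bounded. The difference integrals themselves converge absolutely for bounded phi, with
   bounds independent of the damping, so the limit is taken in them.

   The second equality of the theorem follows from the first because s + s' is symmetric. *)
Require Import Defs.
From HB Require Import structures.
From mathcomp Require Import all_boot all_order all_algebra.
From mathcomp Require Import all_classical all_reals all_analysis.
From mathcomp Require Import measurable_realfun.
From mathcomp Require Import ring lra.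

Set Implicit Arguments.
Unset Strict Implicit.
Unset Printing Implicit Defensive.

Import Order.TTheory GRing.Theory Num.Theory.
Import numFieldNormedType.Exports.

Local Open Scope classical_set_scope.
Local Open Scope ring_scope.

(** * Integration on R^n *)

Section RFubini.
Context d1 d2 (T1 : measurableType d1) (T2 : measurableType d2) (R : realType).
Variable m1 : {sigma_finite_measure set T1 -> \bar R}.
Variable m2 : {sigma_finite_measure set T2 -> \bar R}.

(** The real inner integral is [fine] of the extended one. They agree off the null set of sections
    that are not integrable, where [fine] may return a default value. The first conjunct lets
    constants be pulled out of iterated integrals later. *)
Lemma Rfubini_1 (f : T1 * T2 -> R) :
  (m1 \x m2)%E.-integrable setT (EFin \o f) ->
  m1.-integrable setT (EFin \o (fun x => \int[m2]_y f (x, y))) /\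
  \int[m1]_x \int[m2]_y f (x, y) = \int[(m1 \x m2)%E]_z f z.
Proof.
move=> fi.
have Fi := integrable_fubini_F fi.
have mF := measurable_fubini_F fi.
have FE : ae_eq m1 setT (fubini_F m2 (EFin \o f))
     (EFin \o (fun x => \int[m2]_y f (x, y))).
  have := integrable_ae measurableT Fi.
  apply: filterS => x /(_ Logic.I) + _.
  by rewrite /fubini_F /= /Rintegral => /fineK ->.
have mF1 : measurable_fun setT (fun x => \int[m2]_y f (x, y)).
  rewrite /Rintegral.
  have -> : (fun x => fine (\int[m2]_y (f (x, y))%:E)) = fine \o fubini_F m2 (EFin \o f) by [].
  exact: measurableT_comp (fine_measurable measurableT) mF.
have /measurable_EFinP mF' := mF1.
split.
  apply/integrableP; split => //.
  move/integrableP: Fi => [_]; congr (_ < _)%E.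
  apply: ae_eq_integral => //; [exact: measurableT_comp..|].
  by apply: filterS FE => x h /h /= ->.
rewrite /Rintegral; congr fine.
rewrite -(integral12_prod_meas1 fi); apply: ae_eq_integral => //.
by apply: filterS FE => x h /h /= ->.
Qed.

Lemma Rfubini_2 (f : T1 * T2 -> R) :
  (m1 \x m2)%E.-integrable setT (EFin \o f) ->
  \int[m2]_y \int[m1]_x f (x, y) = \int[(m1 \x m2)%E]_z f z.
Proof.
move=> fi.
have mF := measurable_fubini_G fi.
have FE : ae_eq m2 setT (fubini_G m1 (EFin \o f))
     (EFin \o (fun y => \int[m1]_x f (x, y))).
  have := ae_integrable2 fi.
  apply: filterS => y /(integrable_fin_num measurableT) + _.
  by rewrite /fubini_G /= /Rintegral => /fineK ->.
have mF1 : measurable_fun setT (fun y => \int[m1]_x f (x, y)).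
  rewrite /Rintegral.
  have -> : (fun y => fine (\int[m1]_x (f (x, y))%:E)) = fine \o fubini_G m1 (EFin \o f) by [].
  exact: measurableT_comp (fine_measurable measurableT) mF.
have /measurable_EFinP mF' := mF1.
rewrite /Rintegral; congr fine.
rewrite -(integral21_prod_meas1 fi); apply: ae_eq_integral => //.
by apply: filterS FE => x h /h /= ->.
Qed.

Lemma Rfubini (f : T1 * T2 -> R) :
  (m1 \x m2)%E.-integrable setT (EFin \o f) ->
  \int[m1]_x \int[m2]_y f (x, y) = \int[m2]_y \int[m1]_x f (x, y).
Proof. by move=> fi; rewrite (Rfubini_1 fi).2 (Rfubini_2 fi). Qed.

Lemma tonelli_EFin (f : T1 * T2 -> R) :
  measurable_fun setT f -> (forall z, 0 <= f z) ->
  (\int[m1]_x \int[m2]_y (f (x, y))%:E = \int[m2]_y \int[m1]_x (f (x, y))%:E)%E.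
Proof.
move=> /measurable_EFinP mf f0.
by apply: (fubini_tonelli (EFin \o f)) => // z; rewrite lee_fin.
Qed.

Lemma integrable_swap (f : T1 * T2 -> R) :
  (m1 \x m2)%E.-integrable setT (EFin \o f) ->
  (m2 \x m1)%E.-integrable setT (EFin \o (fun z => f (z.2, z.1))).
Proof.
move=> fi; have mf := measurable_int _ fi.
have msw : measurable_fun setT (fun z : T2 * T1 => (z.2, z.1)).
  exact: (@measurable_swap _ _ T2 T1).
apply/integrable12ltyP; first exact: measurableT_comp mf msw.
exact: (integrable21ltyP m1 m2 mf).1 fi.
Qed.

(** Domination in two stages: [g] pointwise, then [G] for the inner integral of [g]. Exchanges of
    integrals of signed functions are justified in this form throughout. *)
Lemma integrable_prod_dominated (f g : T1 * T2 -> R) (G : T1 -> R) :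
  measurable_fun setT f -> measurable_fun setT g ->
  (forall z, `|f z| <= g z) ->
  (forall x, (\int[m2]_y (g (x, y))%:E <= (G x)%:E)%E) ->
  m1.-integrable setT (EFin \o G) ->
  (m1 \x m2)%E.-integrable setT (EFin \o f).
Proof.
move=> mf mg fg gG Gi.
have mef : measurable_fun setT (EFin \o f) by exact/measurable_EFinP.
apply/(integrable12ltyP _ _ mef) => /=.
have mF : measurable_fun setT (fun x => \int[m2]_y (`|f (x, y)|%:E))%E.
  apply: (@measurable_fun_fubini_tonelli_F _ _ _ _ _ m2 (fun z => `|f z|%:E)) => //.
  by apply/measurable_EFinP; exact: measurableT_comp.
have h1 x : (\int[m2]_y `|(f (x, y))%:E| <= (G x)%:E)%E.
  apply: le_trans (gG x).
  apply: ge0_le_integral => //=.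
  - apply/measurable_EFinP; apply: measurableT_comp => //.
    exact: measurableT_comp mf (pair1_measurable x).
  - apply/measurable_EFinP; exact: measurableT_comp mg (pair1_measurable x).
  - by move=> y _; rewrite lee_fin.
apply: (@le_lt_trans _ _ (\int[m1]_x (`|G x|%:E))%E); last first.
  by case/integrableP: Gi.
apply: ge0_le_integral => //=.
- by move=> x _; exact: integral_ge0.
- apply/measurable_EFinP; apply: measurableT_comp => //.
  by case/integrableP: Gi => /measurable_EFinP.
- move=> x _; apply: le_trans (h1 x) _; by rewrite lee_fin ler_norm.
Qed.

End RFubini.

Section Image.
Context d1 d2 (X : measurableType d1) (Y : measurableType d2) (R : realType).
Variables (phi : X -> Y) (m : {measure set X -> \bar R})
  (nu : {measure set Y -> \bar R}).
Hypothesis mphi : measurable_fun setT phi.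
Hypothesis nuE : forall A, measurable A -> nu A = m (phi @^-1` A).
Variable f : Y -> \bar R.
Hypothesis mf : measurable_fun setT f.

(** Change of variables for any [nu] that agrees with the image measure on measurable sets. In the
    uses [nu] is again Lebesgue measure or a multiple of it. *)
Lemma ge0_integral_image :
  (forall y, 0 <= f y)%E -> (\int[nu]_y f y = \int[m]_x f (phi x))%E.
Proof.
move=> f0; transitivity (\int[m]_(x in phi @^-1` setT) (f \o phi) x)%E => //.
rewrite -(ge0_integral_pushforward mphi) //.
by apply: eq_measure_integral => A mA _; exact: nuE.
Qed.

Lemma integrable_image :
  m.-integrable setT (f \o phi) <-> nu.-integrable setT f.
Proof.
have mc : measurable_fun setT (fun y => `|f y|)%E by exact: measurableT_comp.
have mfp : measurable_fun setT (f \o phi) by exact: measurableT_comp mf mphi.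
have e : (\int[nu]_y `|f y| = \int[m]_x `|f (phi x)|)%E.
  transitivity (\int[m]_(x in phi @^-1` setT) ((fun y => `|f y|) \o phi) x)%E => //.
  rewrite -(ge0_integral_pushforward mphi) //.
  by apply: eq_measure_integral => A mA _; exact: nuE.
by split => /integrableP [_ h]; apply/integrableP; split => //; move: h; rewrite /= e.
Qed.

Lemma integral_image : nu.-integrable setT f ->
  (\int[nu]_y f y = \int[m]_x f (phi x))%E.
Proof.
move/integrable_image => fi.
transitivity (\int[m]_(x in phi @^-1` setT) (f \o phi) x)%E => //.
rewrite -(integral_pushforward mphi) //.
by apply: eq_measure_integral => A mA _; exact: nuE.
Qed.

End Image.

(** * Lebesgue measure on tuples *)

Section Lebn.
Context (R : realType).
Notation mu := (@lebesgue_measure R).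
Notation tup n := (n.-tuple (measurableTypeR R)).

(** A constant of its own, to which the structures of measure and of sigma-finite measure are
    attached; Fubini asks for the latter. *)
Definition lebn (n : nat) : set (tup n) -> \bar R := lebesgue_tuple R n.

Arguments lebn : clear implicits.

HB.instance Definition _ n := Measure.copy (lebn n) (lebesgue_tuple R n).

Lemma measurable_norm1_tuple (n : nat) :
  measurable_fun setT (fun t : tup n => \sum_(i < n) `|tnth t i|).
Proof.
apply: measurable_sum => i; apply: measurableT_comp => //.
exact: measurable_tnth.
Qed.

Lemma measurable_norm1_ball (n : nat) (k : R) :
  measurable [set t : tup n | \sum_(i < n) `|tnth t i| <= k].
Proof.
rewrite -[X in measurable X]setTI.
have -> : [set t : tup n | \sum_(i < n) `|tnth t i| <= k] =
    (fun t : tup n => \sum_(i < n) `|tnth t i|) @^-1` `]-oo, k].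
  by apply/seteqP; split => t; rewrite /= in_itv.
exact: measurable_norm1_tuple.
Qed.

(** Balls of the l1 norm suit the induction: the ball of radius k in dimension n + 1 lies in [-k, k]
    times the ball of the same radius in dimension n. *)
Lemma lebn_ball_fin (n : nat) (k : R) :
  (lebn n [set t : tup n | (\sum_(i < n) `|tnth t i| <= k)%R] < +oo)%E.
Proof.
elim: n => [|n IH].
  rewrite /lebn /= diracE; exact: ltry.
rewrite /lebn /= /lebesgue_cons /pushforward.
set B := [set t : tup n | _] in IH.
have mB : measurable B by exact: measurable_norm1_ball.
apply: (@le_lt_trans _ _ ((mu \x^ lebn n)%E (`[-k, k]%classic `*` B))).
  apply: le_measure; rewrite ?inE.
  - rewrite -[X in measurable X]setTI; apply: measurable_cons_pair => //.
    exact: measurable_norm1_ball.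
  - exact: measurableX.
  - move=> [x t] /=; rewrite big_ord_recl /= /cons_pair /=.
    under eq_bigr do rewrite tnthS.
    move=> h; split => /=.
      rewrite in_itv /= -ler_norml; apply: le_trans h.
      by rewrite lerDl sumr_ge0.
    by apply: le_trans h; rewrite lerDr.
rewrite product_measure2E //; have muI : mu `[-k, k]%classic = (if (-k < k)%R then (k - - k)%:E else 0%E).
  by rewrite lebesgue_measure_itv /= lte_fin.
rewrite [X in (X * _)%E]muI; apply: lte_mul_pinfty => //; case: ifP => //.
by move=> kk; rewrite lee_fin subr_ge0 ltW.
Qed.

Lemma lebn_sigma_finite (n : nat) : sigma_finite setT (lebn n).
Proof.
exists (fun k : nat => [set t : tup n | (\sum_(i < n) `|tnth t i| <= k%:R)%R]).
  apply/seteqP; split => // t _.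
  exists (Num.truncn (\sum_(i < n) `|tnth t i|)).+1 => //=.
  by apply/ltW; rewrite truncnS_gt.
move=> k; split; last exact: lebn_ball_fin.
exact: measurable_norm1_ball.
Qed.

HB.instance Definition _ n :=
  Measure_isSigmaFinite.Build _ _ _ (lebn n) (lebn_sigma_finite n).

(** [lebesgue_cons] is built on [\x^] and Tonelli is applied to [\x]. The two products agree on
    rectangles, hence everywhere, now that [lebn n] is known to be sigma-finite. *)
Lemma ge0_integral_lebnS (n : nat) (f : tup n.+1 -> \bar R) :
  measurable_fun setT f -> (forall t, 0 <= f t)%E ->
  (\int[lebn n.+1]_t f t = \int[mu]_x \int[lebn n]_t f (cons_pair (x, t)))%E.
Proof.
move=> mf f0.
have mfc : measurable_fun setT (f \o @cons_pair R n).
  exact: measurableT_comp (@measurable_cons_pair R n).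
rewrite -(fubini_tonelli1 (f \o @cons_pair R n))//=.
rewrite (@ge0_integral_image _ _ _ _ _ (@cons_pair R n) (mu \x^ lebn n)%E) //; last first.
  exact: measurable_cons_pair.
apply: eq_measure_integral => //= A mA _.
by apply/esym/product_measure_unique => // B C mB mC/=; rewrite product_measure2E.
Qed.

End Lebn.

Arguments lebn : clear implicits.

Section Affine1.
Context (R : realType).
Notation mu := (@lebesgue_measure R).

(** The scaled image measure has the right value on intervals ]p, q], which determine Lebesgue
    measure. For negative c the preimage is closed at the left end instead, with the same length. *)
Lemma lebesgue_measure_affine (c b : R) (A : set (measurableTypeR R)) :
  c != 0 -> measurable A ->
  mu A = (`|c|%:E * mu ((fun x : R => (c * x + b)%R) @^-1` A))%E.
Proof.
move=> c0 mA.
have mphi : measurable_fun setT (fun x : measurableTypeR R => (c * x + b : measurableTypeR R)).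
  apply: measurable_funD => //; exact: measurable_funM.
pose nn : {nonneg R} := NngNum (normr_ge0 c).
pose pf : {measure set (measurableTypeR R) -> \bar R} :=
  measure_function_pushforward__canonical__measure_function_Measure mu mphi.
have := @lebesgue_measure_unique R (mscale nn pf); apply => // X [[p q] _ <-] /=.
rewrite /mscale /= /pushforward lebesgue_measure_itv /= lte_fin.
move: c0; rewrite neq_lt => /orP[c0|c0].
- have -> : (fun x : R => c * x + b) @^-1` `]p, q]%classic = `[(q - b) / c, (p - b) / c[%classic.
    apply/seteqP; split => x /=; rewrite !in_itv /= ler_ndivrMr // ltr_ndivlMr // ![x * c]mulrC;
    move=> /andP[h1 h2]; apply/andP; split; lra.
  rewrite lebesgue_measure_itv /= lte_fin ltr_nM2r ?invr_lt0 // ltrD2r.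
  case: ifP => // pq; last by rewrite mule0.
  rewrite -!EFinB -EFinM ltr0_norm //; congr EFin.
  by field; rewrite lt_eqF.
- have -> : (fun x : R => c * x + b) @^-1` `]p, q]%classic = `](p - b) / c, (q - b) / c]%classic.
    apply/seteqP; split => x /=; rewrite !in_itv /= ler_pdivlMr // ltr_pdivrMr // ![x * c]mulrC;
    move=> /andP[h1 h2]; apply/andP; split; lra.
  rewrite lebesgue_measure_itv /= lte_fin ltr_pM2r ?invr_gt0 // ltrD2r.
  case: ifP => // pq; last by rewrite mule0.
  rewrite -!EFinB -EFinM gtr0_norm //; congr EFin.
  by field; rewrite gt_eqF.
Qed.

Lemma ge0_integral_affine (c b : R) (f : R -> \bar R) : c != 0 ->
  measurable_fun setT f -> (forall x, 0 <= f x)%E ->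
  (\int[mu]_x f (c * x + b)%R = `|c|^-1%:E * \int[mu]_x f x)%E.
Proof.
move=> c0 mf f0.
have mphi : measurable_fun setT (fun x : measurableTypeR R => (c * x + b : measurableTypeR R)).
  apply: measurable_funD => //; exact: measurable_funM.
pose nn : {nonneg R} := NngNum (normr_ge0 c^-1).
rewrite -normfV.
rewrite -[X in (X%:E * _)%E]/(nn%:num) -ge0_integral_mscale //.
rewrite [RHS](@ge0_integral_image _ _ _ _ _ (fun x : measurableTypeR R => (c * x + b : measurableTypeR R)) mu) //.
move=> A mA; rewrite /= /mscale /= [X in (_ * X)%E](@lebesgue_measure_affine c b) //.
by rewrite muleA -EFinM -normrM mulVf // normr1 mul1e.
Qed.

End Affine1.

Section TupleIntegrals.
Context (R : realType).
Notation mu := (@lebesgue_measure R).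
Notation tup n := (n.-tuple (measurableTypeR R)).

Lemma measurable_cons_fun d (T : measurableType d) n (h : T -> measurableTypeR R) (k : T -> tup n) :
  measurable_fun setT h -> measurable_fun setT k ->
  measurable_fun setT (fun x => cons_pair (h x, k x)).
Proof. by move=> mh mk; apply: measurable_cons. Qed.

Lemma measurable_prod_tnth n (f : 'I_n -> R -> R) :
  (forall i, measurable_fun setT (f i)) ->
  measurable_fun setT (fun t : tup n => \prod_(i < n) f i (tnth t i)).
Proof.
move=> mf; apply: measurable_prod => i _.
exact: measurableT_comp (mf i) (measurable_tnth i).
Qed.

Lemma ge0_integral_prod n (f : 'I_n -> R -> R) (c : 'I_n -> R) :
  (forall i, measurable_fun setT (f i)) ->
  (forall i x, 0 <= f i x) ->
  (forall i, (\int[mu]_x (f i x)%:E = (c i)%:E)%E) ->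
  (\int[lebn R n]_t (\prod_(i < n) f i (tnth t i))%:E = (\prod_(i < n) c i)%:E)%E.
Proof.
elim: n f c => [|n IH] f c mf f0 fc.
  rewrite big_ord0 (eq_integral (cst 1%E)); last first.
    by move=> t _; rewrite big_ord0.
  by rewrite integral_cst // mul1e; exact: (@diracT _ (tup 0) R [tuple]).
rewrite ge0_integral_lebnS; last 2 first.
- by apply/measurable_EFinP; exact: measurable_prod_tnth.
- by move=> t; rewrite lee_fin prodr_ge0.
rewrite big_ord_recl /= EFinM -fc.
transitivity (\int[mu]_x ((f ord0 x)%:E * (\prod_(i < n) c (lift ord0 i))%:E))%E.
  apply: eq_integral => x _.
  rewrite -(IH (fun i => f (lift ord0 i))) //.
  rewrite -ge0_integralZl_EFin //.
  - apply: eq_integral => t _; rewrite -EFinM big_ord_recl /=; congr (_ * _)%:E.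
    by apply: eq_bigr => i _; rewrite tnthS.
  - by move=> t _; rewrite lee_fin prodr_ge0.
  - by apply/measurable_EFinP; exact: (measurable_prod_tnth (fun i => mf (lift ord0 i))).
rewrite ge0_integralZr //.
- by apply/measurable_EFinP; exact: (mf ord0).
- by move=> x _; rewrite lee_fin.
- rewrite lee_fin prodr_ge0 // => i _.
  by rewrite -lee_fin -fc integral_ge0 // => x _; rewrite lee_fin.
Qed.

(** With [|e i| = 1] this covers translations, the reflection y -> - y and the reflection of a
    single coordinate, all of which preserve the measure. *)
Definition affine_tuple n (e a : 'I_n -> R) (t : tup n) : tup n :=
  [tuple e i * tnth t i + a i | i < n].

Lemma measurable_affine_tuple n (e a : 'I_n -> R) :
  measurable_fun setT (affine_tuple e a).
Proof.
apply/measurable_fun_tnthP => i.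
rewrite (_ : _ \o _ = fun t : tup n => e i * tnth t i + a i); last first.
  by apply/funext => t; rewrite /= tnth_mktuple.
apply: measurable_funD => //; apply: measurable_funM => //.
exact: measurable_tnth.
Qed.

Lemma affine_tuple_cons n (e a : 'I_n.+1 -> R) (x : R) (t : tup n) :
  affine_tuple e a (cons_pair (x, t)) =
  cons_pair (e ord0 * x + a ord0,
    affine_tuple (fun i => e (lift ord0 i)) (fun i => a (lift ord0 i)) t).
Proof.
apply: eq_from_tnth => i; rewrite tnth_mktuple.
by case: (unliftP ord0 i) => [j|] ->; rewrite /cons_pair /= ?tnthS ?tnth_mktuple ?tnth0.
Qed.

Lemma ge0_integral_affine_tuple n (e a : 'I_n -> R) (f : tup n -> \bar R) :
  (forall i, `|e i| = 1) ->
  measurable_fun setT f -> (forall x, 0 <= f x)%E ->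
  (\int[lebn R n]_t f (affine_tuple e a t) = \int[lebn R n]_t f t)%E.
Proof.
elim: n e a f => [|n IH] e a f e1 mf f0.
  by apply: eq_integral => t _; rewrite (tuple0 (affine_tuple e a t)) (tuple0 t).
rewrite [RHS]ge0_integral_lebnS // ge0_integral_lebnS //; last first.
  exact: measurableT_comp mf (measurable_affine_tuple e a).
pose F (x : R) : \bar R := (\int[lebn R n]_t f (cons_pair (x, t)))%E.
have mF : measurable_fun setT F.
  apply: (@measurable_fun_fubini_tonelli_F _ _ _ _ _ (lebn R n) (f \o @cons_pair R n)).
    exact: measurableT_comp mf (@measurable_cons_pair R n).
  by move=> z; exact: f0.
transitivity (\int[mu]_x F (e ord0 * x + a ord0)%R)%E; last first.
  rewrite (@ge0_integral_affine _ _ _ F) //; last by move=> x; exact: integral_ge0.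
    by rewrite e1 invr1 mul1e.
  by rewrite -normr_gt0 e1.
apply: eq_integral => x _; rewrite /F.
rewrite -[RHS](IH (fun i => e (lift ord0 i)) (fun i => a (lift ord0 i))) //.
  by apply: eq_integral => t _; rewrite affine_tuple_cons.
exact: measurableT_comp mf (measurable_cons_fun _ _).
Qed.

Lemma lebn_affine_tuple n (e a : 'I_n -> R) (A : set (tup n)) :
  (forall i, `|e i| = 1) -> measurable A ->
  lebn R n A = lebn R n (affine_tuple e a @^-1` A).
Proof.
move=> e1 mA.
have mA' : measurable (affine_tuple e a @^-1` A).
  rewrite -[X in measurable X]setTI.
  exact: (measurable_affine_tuple e a).
transitivity (\int[lebn R n]_t (\1_A t)%:E)%E.
  by rewrite integral_indic // setIT.
rewrite -(@ge0_integral_affine_tuple n e a (fun t => (\1_A t)%:E) e1).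
- transitivity (\int[lebn R n]_t (\1_(affine_tuple e a @^-1` A) t)%:E)%E.
    by apply: eq_integral => t _; rewrite !indicE.
  by rewrite integral_indic // setIT.
- by apply/measurable_EFinP; exact: measurable_indic.
- by move=> x; rewrite lee_fin.
Qed.

Lemma Rintegral_affine_tuple n (e a : 'I_n -> R) (f : tup n -> R) :
  (forall i, `|e i| = 1) -> measurable_fun setT f ->
  (lebn R n).-integrable setT (EFin \o f) ->
  \int[lebn R n]_t f (affine_tuple e a t) = \int[lebn R n]_t f t.
Proof.
move=> e1 /measurable_EFinP mf fi; congr fine.
rewrite [RHS](@integral_image _ _ _ _ _ (affine_tuple e a) (lebn R n)) //.
- exact: measurable_affine_tuple.
- by move=> A mA; exact: lebn_affine_tuple.
Qed.

End TupleIntegrals.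

Section Indicators.
Context d (T : measurableType d) (R : realType).

Lemma measurable_boolr (P : T -> bool) :
  measurable_fun setT P -> measurable_fun setT (fun x => (P x)%:R : R).
Proof.
move=> mP.
have -> : (fun x => (P x)%:R : R) = (fun x => if P x then 1 else 0).
  by apply/funext => x; case: (P x).
exact: measurable_fun_if.
Qed.

Lemma measurable_fun_ltb (f g : T -> R) :
  measurable_fun setT f -> measurable_fun setT g ->
  measurable_fun setT (fun x => (f x < g x)%R%:R : R).
Proof. by move=> mf mg; apply: measurable_boolr; exact: measurable_fun_ltr. Qed.

Lemma integral_indicb (m : {measure set T -> \bar R}) (P : T -> bool) (f : T -> R) :
  (\int[m]_x (f x * (P x)%:R)%:E = \int[m]_(x in [set x | P x]) (f x)%:E)%E.
Proof.
rewrite [RHS]integral_mkcond; apply: eq_integral => x _.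
rewrite /patch (_ : (x \in _) = P x); last by apply/idP/idP; rewrite inE.
by case: (P x); rewrite ?mulr1 ?mulr0.
Qed.

End Indicators.
Arguments measurable_boolr {d T R P}.

(** * Integrals of powers and exponentials *)

Section PowerIntegrals.
Context (R : realType).
Notation mu := (@lebesgue_measure R).
Implicit Types a c x t : R.

(** Extension by zero turns integrals over the half line into integrals over the whole line, the
    form in which products and Fubini are used here. *)
Definition ppow a t : R := t `^ a * (0 < t)%R%:R.

Lemma ppow_ge0 a t : 0 <= ppow a t.
Proof. by rewrite mulr_ge0 // powR_ge0. Qed.

Lemma ppowE a t : 0 < t -> ppow a t = t `^ a.
Proof. by move=> t0; rewrite /ppow t0 mulr1. Qed.

Lemma ppow_le0 a t : t <= 0 -> ppow a t = 0.
Proof. by move=> t0; rewrite /ppow ltNge t0 mulr0. Qed.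

Lemma measurable_ppow a : measurable_fun setT (ppow a).
Proof.
apply: measurable_funM; first exact: measurable_powR.
exact: measurable_fun_ltb.
Qed.

(** Inversion is the odd extension of [ppow (-1)]; the default value of the inverse at 0 is 0, as is
    that of the extension. *)
Lemma measurable_invr : measurable_fun setT (@GRing.inv R).
Proof.
have -> : @GRing.inv R = fun t => ppow (-1) t - ppow (-1) (- t).
  apply/funext => t; have [t0|t0|->] := ltgtP t 0.
  - by rewrite ppow_le0 ?ltW // ppowE ?oppr_gt0 // powR_inv1 ?oppr_ge0 ?ltW // sub0r invrN opprK.
  - by rewrite ppowE // ppow_le0 ?oppr_le0 ?ltW // powR_inv1 ?ltW // subr0.
  - by rewrite oppr0 subrr invr0.
apply: measurable_funB; first exact: measurable_ppow.
by apply: measurableT_comp => //; exact: measurable_ppow.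
Qed.

Lemma integral_FTC2 (F f : R -> R) a b : a <= b ->
  (forall x, a <= x <= b -> is_derive x 1 F (f x)) ->
  (forall x, a <= x <= b -> {for x, continuous f}) ->
  (\int[mu]_(x in `[a, b]) (f x)%:E = (F b - F a)%:E)%E.
Proof.
rewrite le_eqVlt => /predU1P[->|ab] dF cf.
  by rewrite set_itv1 integral_set1 subrr.
have cF x : a <= x <= b -> {for x, continuous F}.
  move=> xab; apply: differentiable_continuous; apply/derivable1_diffP.
  by have [] := dF x xab.
rewrite EFinB; apply: continuous_FTC2 => //.
- apply: continuous_in_subspaceT => x; rewrite inE /= in_itv /=; exact: cf.
- split.
  + by move=> x; rewrite in_itv /= => /andP[/ltW ax /ltW xb]; have [] := dF x; rewrite ?ax ?xb.
  + by apply: cvg_at_right_filter; apply: cF; rewrite lexx ltW.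
  + by apply: cvg_at_left_filter; apply: cF; rewrite lexx ltW.
- move=> x; rewrite in_itv /= => /andP[/ltW ax /ltW xb].
  by rewrite derive1E; have [|_ ->//] := dF x; rewrite ax xb.
Qed.

Lemma continuous_powR_gt0 a x : 0 < x -> {for x, continuous (fun t : R => t `^ a)}.
Proof.
move=> x0; apply: differentiable_continuous; apply/derivable1_diffP.
by apply: derivable_powR; rewrite in_itv /= x0.
Qed.

Lemma is_derive_powR_scaled a x : a != 0 -> 0 < x ->
  is_derive x 1 (fun t => t `^ a / a) (x `^ (a - 1)).
Proof.
move=> a0 x0.
have -> : (fun t => t `^ a / a) = (fun t => a^-1 *: (t `^ a : R^o)).
  by apply/funext => t; rewrite mulrC.
have := is_derive1_powR a x0 => d.
have := @is_deriveZ _ _ _ _ (a^-1) _ _ _ d.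
rewrite /GRing.scale /= mulrA mulVf // mul1r; exact.
Qed.

Lemma integral_powR a b c : a != 0 -> 0 < b -> b <= c ->
  (\int[mu]_(t in `[b, c]) (t `^ (a - 1))%:E = ((c `^ a - b `^ a) / a)%:E)%E.
Proof.
move=> a0 b0 bc; rewrite mulrBl.
apply: (@integral_FTC2 (fun t => t `^ a / a)) => // x /andP[bx _].
- by apply: is_derive_powR_scaled => //; exact: lt_le_trans bx.
- by apply: continuous_powR_gt0; exact: lt_le_trans bx.
Qed.

Lemma cvg_powR_divn a x : 0 < a -> 0 < x ->
  (x / n.+1%:R) `^ a @[n --> \oo] --> (0 : R).
Proof.
move=> a0 x0; have /cvg_at_rightP := powR_cvg0 a0.
apply; split; first by move=> n; rewrite divr_gt0.
rewrite -[X in _ --> X](mulr0 x); apply: cvgMl_tmp.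
exact: cvg_harmonic.
Qed.

(** The integrand may be singular at 0, so the integral is a monotone limit over the intervals
    [x / (n + 1), x]. *)
Lemma integral_ppow_lt a x : 0 < a ->
  (\int[mu]_t (ppow (a - 1) t * (t < x)%R%:R)%:E = (ppow a x / a)%:E)%E.
Proof.
move=> a0; have [x0|x0] := leP x 0.
  rewrite ppow_le0 // mul0r; apply: integral0_eq => t _.
  have [t0|t0] := leP t 0; first by rewrite ppow_le0 // mul0r.
  by rewrite (lt_gtF (le_lt_trans x0 t0)) mulr0.
rewrite ppowE //.
transitivity (\int[mu]_(t in `]0%R, x[) (t `^ (a - 1))%:E)%E.
  rewrite -[RHS]integral_indicb; apply: eq_integral => t _.
  by rewrite in_itv /= /ppow -mulrA; case: (0 < t); case: (t < x); rewrite /= ?mulr1 ?mulr0.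
rewrite integral_itv_bndo_bndc; last first.
  by apply/measurable_EFinP/measurable_funTS; exact: measurable_powR.
pose I (n : nat) := `[x / n.+1%:R, x]%classic.
have -> : `]0, x]%classic = \bigcup_n I n.
  apply/seteqP; split => [t|t [n _]]; rewrite /I /= !in_itv /=.
    move=> /andP[t0 tx].
    exists (Num.truncn (x / t)) => //=; rewrite in_itv /= tx andbT.
    by rewrite ler_pdivrMr // mulrC -ler_pdivrMr // ltW // truncnS_gt.
  by move=> /andP[nt ->]; rewrite andbT; apply: lt_le_trans nt; rewrite divr_gt0.
have h1 : (\int[mu]_(t in I n) (t `^ (a - 1))%:E @[n --> \oo] -->
    \int[mu]_(t in \bigcup_n I n) (t `^ (a - 1))%:E)%E.
  apply: ge0_nondecreasing_set_cvg_integral.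
  - move=> m n mn; apply/subsetPset => t; rewrite /I /= !in_itv /= => /andP[h ->].
    rewrite andbT; apply: le_trans h; rewrite ler_pM2l // lef_pV2 ?posrE //.
    by rewrite ler_nat.
  - by move=> i; exact: measurable_itv.
  - by move=> i; apply/measurable_EFinP/measurable_funTS; exact: measurable_powR.
  - by move=> i t _; rewrite lee_fin powR_ge0.
apply: (cvg_unique _ h1) => //.
have -> : (fun n => \int[mu]_(t in I n) (t `^ (a - 1))%:E)%E =
    (fun n => (((x `^ a - (x / n.+1%:R) `^ a) / a)%:E))%E.
  apply/funext => n; apply: integral_powR; rewrite ?gt_eqF ?divr_gt0 //.
  by rewrite ler_pdivrMr // ler_peMr ?ler1n // ltW.
apply: cvg_EFin; first by near=> n.
rewrite -[X in _ --> X / a]subr0.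
apply: cvgMr_tmp; apply: cvgB; first exact: cvg_cst.
exact: cvg_powR_divn.
Unshelve. all: by end_near. Qed.

Lemma integral_ppow_gt a x : 0 < a -> 0 < x ->
  (\int[mu]_t (ppow (- a - 1) t * (x < t)%R%:R)%:E = (x `^ (- a) / a)%:E)%E.
Proof.
move=> a0 x0.
transitivity (\int[mu]_(t in `]x, +oo[) (t `^ (- a - 1))%:E)%E.
  rewrite -[RHS]integral_indicb; apply: eq_integral => t _.
  rewrite in_itv /= andbT; have [xt|] := ltP x t; last by rewrite !mulr0.
  by rewrite ppowE // (lt_trans x0).
rewrite integral_itv_obnd_cbnd; last first.
  by apply/measurable_EFinP/measurable_funTS; exact: measurable_powR.
pose I (n : nat) := `[x, x * n.+1%:R]%classic.
have -> : `[x, +oo[%classic = \bigcup_n I n.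
  apply/seteqP; split => [t|t [n _]]; rewrite /I /= !in_itv /=.
    rewrite andbT => xt.
    exists (Num.truncn (t / x)) => //=; rewrite in_itv /= xt /=.
    by rewrite mulrC -ler_pdivrMr // ltW // truncnS_gt.
  by move=> /andP[->].
have h1 : (\int[mu]_(t in I n) (t `^ (- a - 1))%:E @[n --> \oo] -->
    \int[mu]_(t in \bigcup_n I n) (t `^ (- a - 1))%:E)%E.
  apply: ge0_nondecreasing_set_cvg_integral.
  - move=> m n mn; apply/subsetPset => t; rewrite /I /= !in_itv /= => /andP[-> h] /=.
    by apply: le_trans h _; rewrite ler_pM2l // ler_nat.
  - by move=> i; exact: measurable_itv.
  - by move=> i; apply/measurable_EFinP/measurable_funTS; exact: measurable_powR.
  - by move=> i t _; rewrite lee_fin powR_ge0.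
apply: (cvg_unique _ h1) => //.
have -> : (fun n => \int[mu]_(t in I n) (t `^ (- a - 1))%:E)%E =
    (fun n => (((x `^ (- a) - (x^-1 / n.+1%:R) `^ a) / a)%:E))%E.
  apply/funext => n; rewrite integral_powR ?oppr_eq0 ?gt_eqF //; last first.
    by rewrite ler_peMr ?ler1n // ltW.
  (* The value at the far end is written with a positive exponent so that it tends to 0 by
     [cvg_powR_divn]. *)
  have -> : (x^-1 / n.+1%:R) `^ a = (x * n.+1%:R) `^ (- a).
    rewrite -invfM -powR_inv1 ?mulr_ge0 ?(ltW x0) // -powRrM mulN1r; congr (_ `^ _).
  by congr EFin; field; rewrite gt_eqF.
apply: cvg_EFin; first by near=> n.
rewrite -[X in _ --> X / a]subr0.
apply: cvgMr_tmp; apply: cvgB; first exact: cvg_cst.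
by apply: cvg_powR_divn; rewrite // invr_gt0.
Unshelve. all: by end_near. Qed.

Lemma integral_exp_gt c x : 0 < c -> 
  (\int[mu]_t (c * expR (- (c * t)) * (x < t)%R%:R)%:E = (expR (- (c * x)))%:E)%E.
Proof.
move=> c0.
transitivity (\int[mu]_(t in `]x, +oo[) (c * expR (- (c * t)))%:E)%E.
  rewrite -[RHS]integral_indicb; apply: eq_integral => t _.
  by rewrite in_itv /= andbT.
have cf : continuous (fun t : R => c * expR (- (c * t))).
  move=> t; apply: cvgMl_tmp; apply: continuous_comp; last exact: continuous_expR.
  by apply: cvgN; apply: cvgMl_tmp; exact: cvg_id.
rewrite integral_itv_obnd_cbnd; last first.
  by apply/measurable_EFinP/measurable_funTS; exact: continuous_measurable_fun.
have dF (t : R) : is_derive t 1 (fun t => - expR (- (c * t))) (c * expR (- (c * t))).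
  apply: is_derive_eq; rewrite /GRing.scale /=; ring.
rewrite (@ge0_continuous_FTC2y _ _ (fun t => - expR (- (c * t))) x 0) //.
- by rewrite EFinN oppeK add0e.
- by move=> t _; rewrite mulr_ge0 ?expR_ge0 // ltW.
- exact: continuous_subspaceT.
- rewrite -oppr0; apply: cvgN.
  apply: (cvg_comp (fun t => c * t) (fun t => expR (- t))); last exact: cvgr_expR.
  exact: gt0_cvgMry.
- apply: cvg_at_right_filter; apply: cvgN.
  apply: (@continuous_comp _ _ _ (fun t : R => - (c * t)) expR); last exact: continuous_expR.
  by apply: cvgN; apply: cvgMl_tmp; exact: cvg_id.
- by move=> t _; rewrite derive1E; have [_ ->] := dF t.
Qed.

End PowerIntegrals.

(** * The Gamma function and the heat kernel *)

Section GammaIntegrals.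
Context (R : realType).
Notation mu := (@lebesgue_measure R).
Implicit Types a c x t : R.

(** Layer cake formula: x^a / a is the integral of t^(a-1) over 0 < t < x, and Tonelli leaves the
    tail integral [H] of [h]. It stands in for integration by parts. *)
Lemma layer_cake_ppow a (h H : R -> R) : 0 < a ->
  measurable_fun setT h -> (forall x, 0 <= h x) ->
  (forall t, 0 < t -> (\int[mu]_x (h x * (t < x)%R%:R)%:E = (H t)%:E)%E) ->
  (\int[mu]_t (ppow (a - 1) t * H t)%:E = \int[mu]_x (h x * (ppow a x / a))%:E)%E.
Proof.
move=> a0 mh h0 hH.
pose f (z : R * R) : R := ppow (a - 1) z.1 * (h z.2 * (z.1 < z.2)%R%:R).
have mf : measurable_fun setT f.
  apply: measurable_funM.
    exact: measurableT_comp (measurable_ppow _) measurable_fst.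
  apply: measurable_funM; first exact: measurableT_comp mh measurable_snd.
  exact: measurable_fun_ltb.
have f0 z : 0 <= f z by rewrite /f !mulr_ge0 ?ppow_ge0 ?powR_ge0.
transitivity (\int[mu]_t \int[mu]_x (f (t, x))%:E)%E.
  apply: eq_integral => t _; have [t0|t0] := leP t 0.
    rewrite /f /= ppow_le0 // mul0r integral0_eq // => x _; by rewrite mul0r.
  rewrite EFinM -hH // -ge0_integralZl_EFin ?ppow_ge0 ?powR_ge0 //.
  - by move=> x _; rewrite lee_fin mulr_ge0.
  - apply/measurable_EFinP; apply: measurable_funM => //.
    exact: measurable_fun_ltb.
rewrite (@tonelli_EFin _ _ _ _ R mu mu f mf f0).
apply: eq_integral => x _.
rewrite EFinM -integral_ppow_lt // -ge0_integralZl_EFin //.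
- by apply: eq_integral => t _; rewrite /f /= -EFinM mulrCA.
- by move=> t _; rewrite lee_fin mulr_ge0 // ppow_ge0.
- apply/measurable_EFinP; apply: measurable_funM; first exact: measurable_ppow.
  exact: measurable_fun_ltb.
Qed.

Lemma measurable_ppow_exp a c : measurable_fun setT (fun t => ppow a t * expR (- (c * t))).
Proof.
apply: measurable_funM; first exact: measurable_ppow.
apply: measurableT_comp => //; apply: measurable_funN => //.
Qed.

Lemma measurable_expM c : measurable_fun setT (fun t : R => c * expR (- (c * t))).
Proof.
apply: measurable_funM => //; apply: measurableT_comp => //.
by apply: measurable_funN => //; exact: measurable_funM.
Qed.

Let Ge a : \bar R := (\int[mu]_t (ppow (a - 1) t * expR (- (1 * t)))%:E)%E.

(** Layer cake for the exponential, which is its own tail integral. The equation holds in the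
    extended reals, so that it can serve to prove finiteness. *)
Let GeS a : 0 < a -> (Ge (a + 1) = a%:E * Ge a)%E.
Proof.
move=> a0; rewrite /Ge.
rewrite (@layer_cake_ppow a (fun x => 1 * expR (- (1 * x)))) //; last 2 first.
- exact: (measurable_expM 1).
- by move=> t _; rewrite integral_exp_gt.
rewrite -ge0_integralZl_EFin //.
- apply: eq_integral => t _; rewrite -EFinM addrK; congr EFin; field; by rewrite gt_eqF.
- by move=> t _; rewrite lee_fin !mulr_ge0 ?expR_ge0 ?ppow_ge0 ?powR_ge0 ?invr_ge0 // ltW.
- apply/measurable_EFinP; apply: measurable_funM => //; last by apply: measurable_funM => //; exact: measurable_ppow.
  exact: (measurable_expM 1).
- exact: ltW.
Qed.

Let Ge_le1 a : 0 < a -> a <= 1 -> (Ge a < +oo)%E.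
Proof.
move=> a0 a1.
apply: (@le_lt_trans _ _ (\int[mu]_t ((ppow (a - 1) t * (t < 1)%R%:R)%:E +
   (1 * expR (- (1 * t)) * (0 < t)%R%:R)%:E))%E).
  apply: ge0_le_integral => //.
  - by move=> t _; rewrite lee_fin mulr_ge0 ?ppow_ge0 ?powR_ge0 ?expR_ge0.
  - by apply/measurable_EFinP; exact: measurable_ppow_exp.
  - apply: emeasurable_funD; apply/measurable_EFinP; apply: measurable_funM.
    + exact: measurable_ppow.
    + exact: measurable_fun_ltb.
    + exact: (measurable_expM 1).
    + exact: measurable_fun_ltb.
  - move=> t _; rewrite -EFinD lee_fin; have [t0|t0] := leP t 0.
      by rewrite !ppow_le0 // !mul0r mulr0 addr0.
    rewrite !mul1r mulr1; have [t1|t1] := ltP t 1.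
      rewrite mulr1 -[leLHS]addr0 lerD ?expR_ge0 // ler_piMr ?ppow_ge0 ?powR_ge0 //.
      by rewrite -expR0 ler_expR oppr_le0 ltW.
    rewrite mulr0 add0r ler_piMl ?expR_ge0 // ppowE //.
    by rewrite -[leRHS](powRr0 t) ler_powR // subr_le0.
rewrite ge0_integralD //.
- by rewrite integral_ppow_lt // integral_exp_gt // -EFinD ltry.
- by move=> t _; rewrite lee_fin mulr_ge0 ?ppow_ge0 ?powR_ge0.
- apply/measurable_EFinP; apply: measurable_funM; first exact: measurable_ppow.
  exact: measurable_fun_ltb.
- apply/measurable_EFinP; apply: measurable_funM; last exact: measurable_fun_ltb.
  exact: (measurable_expM 1).
Qed.

Let Ge_fin a : 0 < a -> (Ge a < +oo)%E.
Proof.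
(* Induction on an integer above a; the functional equation lowers a by one until [Ge_le1]
   applies. *)
suff h n : 0 < a -> a < n%:R -> (Ge a < +oo)%E.
  by move=> a0; exact: h (truncnS_gt a).
elim: n a => [|n IH] a a0 an; first by rewrite ltNge ltW in an.
have [a1|a1] := leP a 1; first exact: Ge_le1.
have a1' : 0 < a - 1 by rewrite subr_gt0.
rewrite -(subrK 1 a) GeS // lte_mul_pinfty // ?lee_fin ?ltW //; apply: IH => //.
by rewrite ltrBlDr natr1.
Qed.

(** The factor 1 in the exponent keeps the shape [expR (- (c * t))] of the scaled integrals. *)
Lemma integral_Gamma a : 0 < a ->
  (\int[mu]_t (ppow (a - 1) t * expR (- (1 * t)))%:E = (Gamma a)%:E)%E.
Proof.
move=> a0; have /= := Ge_fin a0; rewrite /Ge => h.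
rewrite /Gamma /Rintegral -integral_indicb.
under [in RHS]eq_integral do rewrite in_itv /= andbT mulrAC -[X in (_ * expR (- X))]mul1r.
by rewrite fineK // ge0_fin_numE // integral_ge0 // => t _; rewrite lee_fin mulr_ge0 ?ppow_ge0 ?powR_ge0 ?expR_ge0.
Qed.

Lemma GammaS a : 0 < a -> Gamma (a + 1) = a * Gamma a.
Proof.
move=> a0; apply: EFin_inj; rewrite EFinM -!integral_Gamma //; last exact: addr_gt0.
exact: GeS.
Qed.

Lemma Gamma_gt0 a : 0 < a -> 0 < Gamma a.
Proof.
move=> a0; rewrite -lte_fin -integral_Gamma //.
apply: (@lt_le_trans _ _ (\int[mu]_t ((expR (-1))%:E * (ppow (a - 1) t * (t < 1)%R%:R)%:E))%E).
  rewrite ge0_integralZl_EFin ?expR_ge0 //.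
  - rewrite integral_ppow_lt // -EFinM lte_fin mulr_gt0 ?expR_gt0 // divr_gt0 //.
    by rewrite ppowE // powR1.
  - by move=> t _; rewrite lee_fin mulr_ge0 ?ppow_ge0 ?powR_ge0.
  - apply/measurable_EFinP; apply: measurable_funM; first exact: measurable_ppow.
    exact: measurable_fun_ltb.
apply: ge0_le_integral => //.
- by move=> t _; rewrite -EFinM lee_fin !mulr_ge0 ?ppow_ge0 ?powR_ge0 ?expR_ge0.
- apply/measurable_EFinP; apply: measurable_funM => //; apply: measurable_funM; first exact: measurable_ppow.
  exact: measurable_fun_ltb.
- by apply/measurable_EFinP; exact: measurable_ppow_exp.
- move=> t _; rewrite -EFinM lee_fin; have [t0|t0] := leP t 0.
    by rewrite !ppow_le0 // !mul0r mulr0.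
  have [t1|t1] := ltP t 1; last by rewrite !mulr0 mulr_ge0 ?ppow_ge0 ?powR_ge0 ?expR_ge0.
  by rewrite mulr1 mulrC ler_wpM2l ?ppow_ge0 ?powR_ge0 // ler_expR lerN2 mul1r ltW.
Qed.

Lemma integral_ppow_exp a c : 0 < a -> 0 < c ->
  (\int[mu]_t (ppow (a - 1) t * expR (- (c * t)))%:E = (c `^ (- a) * Gamma a)%:E)%E.
Proof.
move=> a0 c0.
have := @ge0_integral_affine R c 0 (fun t => (ppow (a - 1) t * expR (- (1 * t)))%:E) _ _ _.
rewrite integral_Gamma // gtr0_norm // => h.
have {h} := h (lt0r_neq0 c0) _ _.
have -> : (\int[mu]_t (ppow (a - 1) (c * t + 0) * expR (- (1 * (c * t + 0))))%:E =
   (c `^ (a - 1))%:E * \int[mu]_t (ppow (a - 1) t * expR (- (c * t)))%:E)%E.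
  rewrite -ge0_integralZl_EFin ?powR_ge0 //.
  - apply: eq_integral => t _; rewrite addr0 mul1r -EFinM mulrA; congr (_ * _)%:E.
    have [t0|t0] := leP t 0.
      by rewrite !ppow_le0 ?mulr0 // pmulr_rle0.
    by rewrite !ppowE ?mulr_gt0 // powRM // ltW.
  - by move=> t _; rewrite lee_fin mulr_ge0 ?ppow_ge0 ?powR_ge0 ?expR_ge0.
  - by apply/measurable_EFinP; exact: measurable_ppow_exp.
move=> h; have {h} := h _ _.
set I := (\int[mu]_t _)%E => h.
have {}h : ((c `^ (a - 1))%:E * I = (c^-1)%:E * (Gamma a)%:E)%E.
  apply: h; first by apply/measurable_EFinP; exact: measurable_ppow_exp.
  by move=> t; rewrite lee_fin mulr_ge0 ?ppow_ge0 ?powR_ge0 ?expR_ge0.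
rewrite -[I]mul1e -(@mulVf _ (c `^ (a - 1))) ?gt_eqF ?powR_gt0 //.
rewrite EFinM -muleA h -!EFinM mulrA; congr (_ * _)%:E.
rewrite -powRN opprB -[X in _ * X]powR_inv1 ?ltW // -powRD; first by congr (_ `^ _); ring.
by rewrite (gt_eqF c0) implybT.
Qed.

(** In place of the substitution t -> 1 / t, the factor exp(- c / t) is written as the integral of c
    exp(- c x) over x > 1 / t. After the exchange the region reads t > 1 / x, where the power of t
    integrates explicitly. *)
Lemma integral_ppow_expV a c : 0 < a -> 0 < c ->
  (\int[mu]_t (ppow (- a - 1) t * expR (- (c / t)))%:E = (c `^ (- a) * Gamma a)%:E)%E.
Proof.
move=> a0 c0.
pose f (z : R * R) : R := ppow (- a - 1) z.1 * (c * expR (- (c * z.2)) * (z.1^-1 < z.2)%R%:R).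
have mf : measurable_fun setT f.
  apply: measurable_funM.
    exact: measurableT_comp (measurable_ppow _) measurable_fst.
  apply: measurable_funM.
    exact: measurableT_comp (measurable_expM c) measurable_snd.
  apply: measurable_fun_ltb => //.
  exact: measurableT_comp (@measurable_invr R) measurable_fst.
have f0 z : 0 <= f z.
  by rewrite /f !mulr_ge0 ?ppow_ge0 ?powR_ge0 ?expR_ge0 // ltW.
transitivity (\int[mu]_t \int[mu]_x (f (t, x))%:E)%E.
  apply: eq_integral => t _.
  rewrite EFinM -integral_exp_gt // -ge0_integralZl_EFin ?ppow_ge0 ?powR_ge0 //.
  - by move=> x _; rewrite lee_fin !mulr_ge0 ?expR_ge0 // ltW.
  - apply/measurable_EFinP; apply: measurable_funM; first exact: measurable_expM.
    exact: measurable_fun_ltb.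
rewrite (@tonelli_EFin _ _ _ _ R mu mu f mf f0).
transitivity (\int[mu]_x ((c / a)%:E * (ppow (a + 1 - 1) x * expR (- (c * x)))%:E))%E.
  apply: eq_integral => x _; have [x0|x0] := leP x 0.
    rewrite [X in (_ * (X * _)%:E)%E]ppow_le0 // mul0r mule0; apply: integral0_eq => t _; rewrite /f /=.
    have [t0|t0] := leP t 0; first by rewrite ppow_le0 ?mul0r.
    have t'0 : 0 < t^-1 by rewrite invr_gt0.
    by rewrite (lt_gtF (le_lt_trans x0 t'0)) !mulr0.
  transitivity (\int[mu]_t ((c * expR (- (c * x)))%:E * (ppow (- a - 1) t * (x^-1 < t)%R%:R)%:E))%E.
    apply: eq_integral => t _; rewrite /f /= -EFinM.
    have [t0|t0] := leP t 0; first by rewrite ppow_le0 // !mul0r mulr0.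
    by rewrite (invf_plt t0 x0) mulrCA.
  rewrite ge0_integralZl_EFin.
  - rewrite integral_ppow_gt ?invr_gt0 // -!EFinM; congr EFin.
    rewrite addrK ppowE // -[x^-1]powR_inv1 ?ltW // -powRrM mulN1r opprK; ring.
  - exact: measurableT.
  - by move=> t _; rewrite lee_fin mulr_ge0 ?ppow_ge0 ?powR_ge0.
  - apply/measurable_EFinP; apply: measurable_funM; first exact: measurable_ppow.
    exact: measurable_fun_ltb.
  - by rewrite mulr_ge0 ?expR_ge0 // ltW.
rewrite ge0_integralZl_EFin.
- rewrite integral_ppow_exp ?addr_gt0 // GammaS // -EFinM; congr EFin.
  have -> : c `^ (- (a + 1)) = c `^ (- a) / c.
    rewrite opprD powRD; last by rewrite (gt_eqF c0) implybT.
    by rewrite powR_inv1 // ltW.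
  by field; rewrite !gt_eqF.
- exact: measurableT.
- by move=> t _; rewrite lee_fin mulr_ge0 ?ppow_ge0 ?powR_ge0 ?expR_ge0.
- by apply/measurable_EFinP; exact: measurable_ppow_exp.
- by rewrite divr_ge0 ?ltW.
Qed.

End GammaIntegrals.

(** * Gaussian integrals in one dimension *)

Section Gauss1.
Context (R : realType).
Notation mu := (@lebesgue_measure R).
Implicit Types t r x y w : R.

Definition heat1 t x : R := (4 * pi * t) `^ (- 2^-1) * expR (- (x ^+ 2 / (4 * t))).

Lemma heat1_ge0 t x : 0 <= heat1 t x.
Proof. by rewrite mulr_ge0 ?powR_ge0 ?expR_ge0. Qed.

Lemma heat1N t x : heat1 t (- x) = heat1 t x.
Proof. by rewrite /heat1 sqrrN. Qed.

Lemma measurable_heat1 d (T : measurableType d) (f g : T -> R) :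
  measurable_fun setT f -> measurable_fun setT g ->
  measurable_fun setT (fun z => heat1 (f z) (g z)).
Proof.
move=> mf mg; apply: measurable_funM.
  apply: (measurableT_comp (measurable_powR _)) => //.
  exact: measurable_funM.
apply: (measurableT_comp (@measurable_expR R)) => //.
apply: (measurableT_comp (@oppr_measurable R setT)) => //.
apply: measurable_funM; first exact: measurable_funX.
apply: (measurableT_comp (@measurable_invr R)) => //.
exact: measurable_funM.
Qed.

(** The heat kernel at time t is the normal density of variance 2 t, which yields its total mass. *)
Lemma heat1_normal_pdf m t x : 0 < t ->
  normal_pdf m (Num.sqrt (2 * t)) x = heat1 t (x - m).
Proof.
move=> t0.
have t2 : 0 < 2 * t by rewrite mulr_gt0.
rewrite /normal_pdf gt_eqF ?sqrtr_gt0 //= /normal_peak /normal_fun /heat1.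
rewrite sqr_sqrtr ?ltW //; congr (_ * _).
  rewrite -powR12_sqrt; last by rewrite mulrn_wge0 // mulr_ge0 ?pi_ge0 // ltW.
  rewrite -powRN; congr (_ `^ _); rewrite -mulr_natr; ring.
by congr expR; rewrite mulNr; congr (- (_ / _)); rewrite -mulr_natr; ring.
Qed.

Lemma integral_heat1 m t : 0 < t -> (\int[mu]_x (heat1 t (x - m))%:E = 1)%E.
Proof.
move=> t0; rewrite -(integral_normal_pdf m (Num.sqrt (2 * t))).
by apply: eq_integral => x _; rewrite heat1_normal_pdf.
Qed.

(** Completing the square in y separates a Gaussian in w from a translated Gaussian in y, so the
    convolution only involves a total mass. *)
Lemma heat1_conv_factor t r w y : 0 < t -> 0 < r ->
  heat1 t y * heat1 r (w - y) =
  heat1 (t + r) w * heat1 (t * r / (t + r)) (y - w * t / (t + r)).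
Proof.
move=> t0 r0; have tr0 : 0 < t + r by rewrite addr_gt0.
have p4 u : 0 < u -> 0 <= 4 * pi * u by move=> u0; rewrite !mulr_ge0 ?pi_ge0 // ltW.
rewrite /heat1 mulrACA [RHS]mulrACA; congr (_ * _).
  rewrite -!powRM ?p4 // ?divr_gt0 ?mulr_gt0 //; congr (_ `^ _).
  by field; rewrite gt_eqF.
rewrite -!expRD; congr expR; field.
by rewrite !gt_eqF ?mulr_gt0.
Qed.

Lemma heat1_conv t r w : 0 < t -> 0 < r ->
  (\int[mu]_y (heat1 t y * heat1 r (w - y))%:E = (heat1 (t + r) w)%:E)%E.
Proof.
move=> t0 r0; have tr0 : 0 < t + r by rewrite addr_gt0.
under eq_integral do rewrite heat1_conv_factor // EFinM.
rewrite ge0_integralZl_EFin ?heat1_ge0 //.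
- by rewrite integral_heat1 ?mule1 // divr_gt0 ?mulr_gt0.
- by move=> x _; rewrite lee_fin heat1_ge0.
- by apply/measurable_EFinP; apply: measurable_heat1 => //; exact: measurable_funB.
Qed.

Lemma continuous_heat1 t : continuous (heat1 t).
Proof.
move=> x; apply: cvgMl_tmp.
apply: (@continuous_comp _ _ _ (fun x : R => - (x ^+ 2 / (4 * t))) expR); last exact: continuous_expR.
by apply: cvgN; apply: cvgMr_tmp; exact: exprn_continuous.
Qed.

Lemma is_derive_heat1 t x : 0 < t ->
  is_derive x 1 (fun y => - heat1 t y) (x / (2 * t) * heat1 t x).
Proof.
move=> t0; rewrite /heat1; apply: is_derive_eq.
by rewrite /GRing.scale /=; field; rewrite gt_eqF.
Qed.

Lemma heat1_cvgy t : 0 < t -> heat1 t x @[x --> +oo] --> (0 : R).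
Proof.
move=> t0; rewrite -[X in _ --> X](mulr0 ((4 * pi * t) `^ (- 2^-1))).
apply: cvgMl_tmp.
apply: (cvg_comp (fun x => x ^+ 2 / (4 * t)) (fun t => expR (- t))); last exact: cvgr_expR.
apply: gt0_cvgMly; first by rewrite invr_gt0 mulr_gt0.
apply: (@ger_cvgy _ _ _ _ id); last exact: cvg_id.
near=> x; have x1 : 1 <= x by near: x; exact: nbhs_pinfty_ge.
by rewrite /= expr2 ler_peMl // (le_trans _ x1).
Unshelve. all: by end_near. Qed.

Lemma integral_heat1_tail t x : 0 < t -> 0 <= x ->
  (\int[mu]_y (y / (2 * t) * heat1 t y * (x < y)%R%:R)%:E = (heat1 t x)%:E)%E.
Proof.
move=> t0 x0.
transitivity (\int[mu]_(y in `]x, +oo[) (y / (2 * t) * heat1 t y)%:E)%E.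
  rewrite -[RHS]integral_indicb; apply: eq_integral => y _.
  by rewrite in_itv /= andbT.
have cf : continuous (fun y : R => y / (2 * t) * heat1 t y).
  move=> y; apply: cvgM; last exact: continuous_heat1.
  by apply: cvgMr_tmp; exact: cvg_id.
rewrite integral_itv_obnd_cbnd; last first.
  by apply/measurable_EFinP/measurable_funTS; exact: continuous_measurable_fun.
rewrite (@ge0_continuous_FTC2y _ _ (fun y => - heat1 t y) x 0) //.
- by rewrite EFinN oppeK add0e.
- move=> y xy; have y0 : 0 <= y by exact: le_trans xy.
  by rewrite mulr_ge0 ?heat1_ge0 // divr_ge0 // mulr_ge0 // ltW.
- exact: continuous_subspaceT.
- by rewrite -oppr0; apply: cvgN; exact: heat1_cvgy.
- by apply: cvg_at_right_filter; apply: cvgN; exact: continuous_heat1.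
- by move=> y _; rewrite derive1E; have [_ ->] := is_derive_heat1 y t0.
Qed.

Lemma integral_even_pow k y : 0 <= y ->
  (\int[mu]_x (x ^+ k.*2 * (`|x| < y)%R%:R)%:E = (2 * y ^+ k.*2.+1 / k.*2.+1%:R)%:E)%E.
Proof.
move=> y0.
transitivity (\int[mu]_(x in `](- y)%R, y[) (x ^+ k.*2)%:E)%E.
  rewrite -[RHS]integral_indicb; apply: eq_integral => x _.
  by rewrite in_itv /= ltr_norml.
have cf : continuous (fun x : R => x ^+ k.*2) by exact: exprn_continuous.
have mf D : measurable_fun D (fun x : R => (x ^+ k.*2)%:E).
  by apply/measurable_EFinP/measurable_funTS; exact: continuous_measurable_fun.
rewrite integral_itv_bndo_bndc // integral_itv_obnd_cbnd //.
pose F x : R := k.*2.+1%:R^-1 * x ^+ k.*2.+1.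
transitivity ((F y - F (- y))%:E); last first.
  by rewrite /F exprNn -signr_odd /= odd_double /= expr1; congr EFin; ring.
apply: integral_FTC2 => [|x _|x _]; last exact: cf.
- by rewrite ge0_cp.
- have := @is_deriveZ _ _ _ _ (k.*2.+1%:R^-1) _ _ _ (is_deriveX k.*2.+1 (is_derive_id x 1)).
  rewrite exprfctE /GRing.scale /= mulr1 mulrA mulVf // mul1r; exact.
Qed.

(** Integration by parts done with Tonelli: the kernel at x is the integral of y / (2 t) times the
    kernel at y over y > |x|. Integrating x^(2k) over |x| < y raises the power by two, and evenness
    turns the half line into the line. *)
Lemma heat1_moment_step t k : 0 < t ->
  (\int[mu]_x (heat1 t x * x ^+ k.+1.*2)%:E =
   (2 * t * k.*2.+1%:R)%:E * \int[mu]_x (heat1 t x * x ^+ k.*2)%:E)%E.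
Proof.
move=> t0.
pose f (z : R * R) : R := z.1 ^+ k.*2 * (z.2 / (2 * t) * heat1 t z.2 * (`|z.1| < z.2)%R%:R).
have f0 z : 0 <= f z.
  rewrite /f; have [h|h] := ltP `|z.1| z.2; last by rewrite !mulr0.
  have z0 : 0 <= z.2 by apply/ltW; apply: le_lt_trans h.
  rewrite mulr_ge0 ?exprn_even_ge0 ?odd_double // mulr_ge0 // mulr_ge0 ?heat1_ge0 //.
  by rewrite divr_ge0 // mulr_ge0 // ltW.
have mf : measurable_fun setT f.
  apply: measurable_funM; first exact: measurable_funX.
  apply: measurable_funM.
    by apply: measurable_funM; [exact: measurable_funM|exact: measurable_heat1].
  by apply: measurable_fun_ltb => //; exact: measurableT_comp.
(* The kernel is even, so the tail formula is used at |x|. *)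
have e1 : (\int[mu]_x (heat1 t x * x ^+ k.*2)%:E = \int[mu]_x \int[mu]_y (f (x, y))%:E)%E.
  apply: eq_integral => x _.
  have -> : heat1 t x = heat1 t `|x| by rewrite /heat1 real_normK ?num_real.
  rewrite mulrC EFinM -integral_heat1_tail //.
  rewrite -ge0_integralZl_EFin //.
  - move=> y _; have := f0 (1, y); rewrite /f /= lee_fin expr1n mul1r normr1.
    have [h _|h _] := ltP `|x| y; last by rewrite !mulr0.
    have y0 : 0 <= y by apply/ltW; apply: le_lt_trans h.
    by rewrite mulr1 mulr_ge0 ?heat1_ge0 // divr_ge0 // mulr_ge0 // ltW.
  - apply/measurable_EFinP; apply: measurable_funM; last exact: measurable_fun_ltb.
    by apply: measurable_funM; [exact: measurable_funM|exact: measurable_heat1].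
  - by rewrite exprn_even_ge0 // odd_double.
pose h y : R := y ^+ k.+1.*2 * heat1 t y.
have h0 y : 0 <= h y by rewrite /h mulr_ge0 ?heat1_ge0 ?exprn_even_ge0 ?odd_double.
have ch : continuous h.
  by move=> y; apply: cvgM; [exact: exprn_continuous|exact: continuous_heat1].
have mh : measurable_fun setT h by exact: continuous_measurable_fun.
have e2 : (\int[mu]_x (heat1 t x * x ^+ k.*2)%:E =
    (t * k.*2.+1%:R)^-1%:E * \int[mu]_(y in [set y | (0 <= y)%R]) (h y)%:E)%E.
  rewrite e1 (@tonelli_EFin _ _ _ _ R mu mu f mf f0) -integral_indicb.
  rewrite -ge0_integralZl_EFin //.
  - apply: eq_integral => y _; have [y0|y0] := ltP y 0.
      rewrite mulr0 mule0; apply: integral0_eq => x _; rewrite /f /=.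
      by rewrite (lt_gtF (lt_le_trans y0 (normr_ge0 x))) !mulr0.
    transitivity (\int[mu]_x ((y / (2 * t) * heat1 t y)%:E * (x ^+ k.*2 * (`|x| < y)%R%:R)%:E))%E.
      by apply: eq_integral => x _; rewrite -EFinM /f /= mulrCA.
    rewrite ge0_integralZl_EFin //.
    - rewrite integral_even_pow // -!EFinM mulr1 /h doubleS !exprS; congr EFin; field.
      by rewrite !gt_eqF ?ltr0n.
    - by move=> x _; rewrite lee_fin mulr_ge0 // exprn_even_ge0 // odd_double.
    - apply/measurable_EFinP; apply: measurable_funM; first exact: measurable_funX.
      by apply: measurable_fun_ltb => //; exact: measurableT_comp.
    - by rewrite mulr_ge0 ?heat1_ge0 // divr_ge0 // mulr_ge0 // ltW.
  - by move=> y _; rewrite lee_fin mulr_ge0.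
  - apply/measurable_EFinP; apply: measurable_funM => //.
    by apply: measurable_boolr; exact: measurable_fun_ler.
  - by rewrite invr_ge0 mulr_ge0 // ltW.
rewrite e2 muleA -EFinM (_ : _ / _ = 2); last first.
  by field; rewrite nat1r pnatr_eq0 (gt_eqF t0).
transitivity (\int[mu]_x (h x)%:E)%E; first by apply: eq_integral => y _; rewrite /h mulrC.
apply: ge0_symfun_integralT => //.
by move=> y; rewrite /h /= heat1N exprNn -signr_odd odd_double expr0 mul1r.
Qed.

Lemma heat1_moment2 t : 0 < t -> (\int[mu]_x (heat1 t x * x ^+ 2)%:E = (2 * t)%:E)%E.
Proof.
move=> t0; rewrite (heat1_moment_step 0) //= mulr1.
under eq_integral do rewrite mulr1 -[X in heat1 t X]subr0.
by rewrite integral_heat1 // mule1.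
Qed.

Lemma heat1_moment4 t : 0 < t -> (\int[mu]_x (heat1 t x * x ^+ 4)%:E = (12 * t ^+ 2)%:E)%E.
Proof.
move=> t0; rewrite (heat1_moment_step 1) // heat1_moment2 // -EFinM; congr EFin.
by rewrite (_ : 1.*2.+1 = 3)%N //; ring.
Qed.

End Gauss1.

Section Dominated.
Context d (T : measurableType d) (R : realType) (m : {measure set T -> \bar R}).

Lemma Rintegral_dominated (f g : T -> R) (c : R) :
  measurable_fun setT f -> measurable_fun setT g ->
  (forall x, `|f x| <= g x) -> (\int[m]_x (g x)%:E <= c%:E)%E ->
  m.-integrable setT (EFin \o f) /\ `|\int[m]_x f x| <= c.
Proof.
move=> mf mg fg gc.
have mef : measurable_fun setT (EFin \o f) by exact/measurable_EFinP.
have h : (\int[m]_x `|(EFin \o f) x| <= c%:E)%E.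
  apply: le_trans gc; apply: ge0_le_integral => //=.
  - by apply/measurable_EFinP; exact: measurableT_comp mf.
  - by apply/measurable_EFinP.
  - by move=> x _; rewrite lee_fin.
have fi : m.-integrable setT (EFin \o f).
  by apply/integrableP; split => //; apply: le_lt_trans h _; rewrite ltry.
split => //; rewrite -lee_fin EFin_normr_Rintegral //.
by apply: le_trans h; exact: le_abse_integral.
Qed.

Lemma integrable_EFinZl (c : R) (f : T -> R) :
  m.-integrable setT (EFin \o f) -> m.-integrable setT (EFin \o (fun x => c * f x)).
Proof.
move=> fi; rewrite (_ : _ \o _ = (fun x => c%:E * (f x)%:E)%E) //.
exact: integrableZl.
Qed.

Lemma integrable_EFin_ge0 (f : T -> R) (c : R) :
  measurable_fun setT f -> (forall x, 0 <= f x) ->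
  (\int[m]_x (f x)%:E = c%:E)%E -> m.-integrable setT (EFin \o f).
Proof.
move=> mf f0 fc; apply/integrableP; split; first exact/measurable_EFinP.
under eq_integral do rewrite /= ger0_norm //.
by rewrite fc ltry.
Qed.

Lemma Rintegral_EFin (f : T -> R) (c : R) :
  (\int[m]_x (f x)%:E = c%:E)%E -> \int[m]_x f x = c.
Proof. by rewrite /Rintegral => ->. Qed.

End Dominated.

(** * The heat kernel in n dimensions *)

Section HeatN.
Context (R : realType) (n : nat).
Notation mu := (@lebesgue_measure R).
Notation tup := (n.-tuple (measurableTypeR R)).
Notation mun := (lebn R n).
Implicit Types (t r : R) (y w : tup).

Definition heatn t y : R := \prod_(i < n) heat1 t (tnth y i).

Definition sqnorm y : R := \sum_(i < n) tnth y i ^+ 2.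

Definition subt (w y : tup) : tup := affine_tuple (fun=> -1) (fun i => tnth w i) y.

Lemma tnth_subt w y i : tnth (subt w y) i = tnth w i - tnth y i.
Proof. by rewrite tnth_mktuple mulN1r addrC. Qed.

Lemma heatn_ge0 t y : 0 <= heatn t y.
Proof. by apply: prodr_ge0 => i _; exact: heat1_ge0. Qed.

Lemma sqnorm_ge0 y : 0 <= sqnorm y.
Proof. by apply: sumr_ge0 => i _; exact: sqr_ge0. Qed.

Lemma measurable_tnth_comp d (T : measurableType d) (g : T -> tup) i :
  measurable_fun setT g -> measurable_fun setT (fun z => tnth (g z) i).
Proof. by move=> mg; exact: measurableT_comp (measurable_tnth i) mg. Qed.

Lemma measurable_heatn d (T : measurableType d) (f : T -> R) (g : T -> tup) :
  measurable_fun setT f -> measurable_fun setT g ->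
  measurable_fun setT (fun z => heatn (f z) (g z)).
Proof.
move=> mf mg; apply: measurable_prod => i _; apply: measurable_heat1 => //.
exact: measurable_tnth_comp.
Qed.

Lemma measurable_sqnorm : measurable_fun setT sqnorm.
Proof.
apply: measurable_sum => i; apply: measurable_funX.
exact: measurable_tnth_comp.
Qed.

Lemma measurable_subt d (T : measurableType d) (f g : T -> tup) :
  measurable_fun setT f -> measurable_fun setT g ->
  measurable_fun setT (fun z => subt (f z) (g z)).
Proof.
move=> mf mg; apply/measurable_fun_tnthP => i.
rewrite (_ : _ \o _ = fun z => tnth (f z) i - tnth (g z) i); last first.
  by apply/funext => z; rewrite /= tnth_subt.
by apply: measurable_funB; exact: measurable_tnth_comp.
Qed.

Lemma integral_heatn t : 0 < t -> (\int[mun]_y (heatn t y)%:E = 1)%E.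
Proof.
move=> t0; rewrite (@ge0_integral_prod R n (fun=> heat1 t) (fun=> 1)).
- by rewrite big1.
- by move=> i; exact: measurable_heat1.
- by move=> i x; exact: heat1_ge0.
- move=> i; rewrite -(integral_heat1 0 t0).
  by apply: eq_integral => x _; rewrite subr0.
Qed.

Lemma heatn_conv t r w : 0 < t -> 0 < r ->
  (\int[mun]_y (heatn t y * heatn r (subt w y))%:E = (heatn (t + r) w)%:E)%E.
Proof.
move=> t0 r0.
rewrite -(@ge0_integral_prod R n (fun i v => heat1 t v * heat1 r (tnth w i - v))).
- apply: eq_integral => y _; rewrite /heatn -big_split /=; congr EFin.
  by apply: eq_bigr => i _; rewrite tnth_subt.
- move=> i; apply: measurable_funM; apply: measurable_heat1 => //.
  exact: measurable_funB.
- by move=> i x; rewrite mulr_ge0 ?heat1_ge0.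
- by move=> i; exact: heat1_conv.
Qed.

(** The other coordinates contribute total mass one, so the moment is one-dimensional. *)
Lemma heatn_moment k t c (i : 'I_n) : 0 < t ->
  (\int[mu]_x (heat1 t x * x ^+ k.*2)%:E = c%:E)%E ->
  (\int[mun]_y (heatn t y * tnth y i ^+ k.*2)%:E = c%:E)%E.
Proof.
move=> t0 hc.
have hi : \prod_(j < n) (if j == i then c else 1) = c.
  by rewrite (bigD1 i) //= eqxx big1 ?mulr1 // => j /negPf ->.
rewrite -hi -(@ge0_integral_prod R n (fun j x => if j == i then heat1 t x * x ^+ k.*2 else heat1 t x)).
- apply: eq_integral => y _; congr EFin.
  rewrite /heatn (bigD1 i) //= [RHS](bigD1 i) //= eqxx mulrAC; congr (_ * _).
  by apply: eq_bigr => j /negPf ->.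
- move=> j; case: (j == i); last exact: measurable_heat1.
  by apply: measurable_funM; [exact: measurable_heat1|exact: measurable_funX].
- move=> j x; case: (j == i); last exact: heat1_ge0.
  by rewrite mulr_ge0 ?heat1_ge0 // exprn_even_ge0 // odd_double.
- move=> j; case: (j == i) => //; rewrite -(integral_heat1 0 t0).
  by apply: eq_integral => x _; rewrite subr0.
Qed.

Lemma integral_heatn_sqnorm t : 0 < t ->
  (\int[mun]_y (heatn t y * sqnorm y)%:E = (2 * n%:R * t)%:E)%E.
Proof.
move=> t0.
under eq_integral do rewrite /sqnorm mulr_sumr -sumEFin.
rewrite ge0_integral_sum //.
- under eq_bigr do rewrite (@heatn_moment 1 t (2 * t)) ?heat1_moment2 //.
  by rewrite sumEFin sumr_const card_ord -mulr_natr; congr EFin; ring.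
- move=> i; apply/measurable_EFinP; apply: measurable_funM; first exact: measurable_heatn.
  by apply: measurable_funX; exact: measurable_tnth.
- by move=> i y _; rewrite lee_fin mulr_ge0 ?heatn_ge0 ?sqr_ge0.
Qed.

(** Cauchy-Schwarz, by 2 a^2 b^2 <= a^4 + b^4 on each product. It bounds |y|^4 by fourth powers of
    single coordinates, whose moments are known. *)
Lemma sqnorm_sqr_le y : sqnorm y ^+ 2 <= n%:R * \sum_(i < n) tnth y i ^+ 4.
Proof.
have h (a b : R) : a ^+ 2 * b ^+ 2 <= (a ^+ 4 + b ^+ 4) / 2.
  have := sqr_ge0 (a ^+ 2 - b ^+ 2); nra.
rewrite expr2 /sqnorm mulr_suml.
apply: (@le_trans _ _ (\sum_(i < n) \sum_(j < n) ((tnth y i) ^+ 4 + (tnth y j) ^+ 4) / 2)).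
  by apply: ler_sum => i _; rewrite mulr_sumr; apply: ler_sum => j _; exact: h.
rewrite le_eqVlt; apply/orP; left; apply/eqP.
transitivity (\sum_(i < n) (tnth y i ^+ 4 / 2 * n%:R + (\sum_(j < n) tnth y j ^+ 4) / 2)).
  apply: eq_bigr => i _; rewrite -mulr_suml big_split /= sumr_const card_ord -mulr_natr; ring.
rewrite big_split /= -mulr_suml -mulr_suml sumr_const card_ord -mulr_natr; by field.
Qed.

Lemma integral_heatn_sqnorm2 t : 0 < t ->
  (\int[mun]_y (heatn t y * sqnorm y ^+ 2)%:E <= (12 * n%:R ^+ 2 * t ^+ 2)%:E)%E.
Proof.
move=> t0.
apply: (@le_trans _ _ (\int[mun]_y (n%:R * \sum_(i < n) (heatn t y * tnth y i ^+ 4))%:E)%E).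
  apply: ge0_le_integral => //.
  - by move=> y _; rewrite lee_fin mulr_ge0 ?heatn_ge0 ?sqr_ge0.
  - apply/measurable_EFinP; apply: measurable_funM; first exact: measurable_heatn.
    by apply: measurable_funX; exact: measurable_sqnorm.
  - apply/measurable_EFinP; apply: measurable_funM => //; apply: measurable_sum => i.
    apply: measurable_funM; first exact: measurable_heatn.
    by apply: measurable_funX; exact: measurable_tnth.
  - move=> y _; rewrite lee_fin -mulr_sumr [leRHS]mulrCA ler_wpM2l ?heatn_ge0 //.
    exact: sqnorm_sqr_le.
under eq_integral do rewrite EFinM -sumEFin.
have m4 i : measurable_fun setT (fun y => (heatn t y * tnth y i ^+ 4)%:E).
  apply/measurable_EFinP; apply: measurable_funM; first exact: measurable_heatn.
  by apply: measurable_funX; exact: measurable_tnth.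
have p4 (i : 'I_n) y : (0 <= (heatn t y * tnth y i ^+ 4)%:E)%E.
  by rewrite lee_fin mulr_ge0 ?heatn_ge0 // exprn_even_ge0.
rewrite ge0_integralZl_EFin //; last 2 first.
- by move=> y _; apply: sume_ge0 => i _.
- exact: emeasurable_sum.
rewrite ge0_integral_sum //.
under eq_bigr do rewrite (@heatn_moment 2 t (12 * t ^+ 2)) ?heat1_moment4 //.
rewrite sumEFin sumr_const card_ord -mulr_natr -EFinM lee_fin le_eqVlt.
by apply/orP; left; apply/eqP; ring.
Qed.

(* Substituting [q / (4 t)] for time makes this a Gamma integral; the right-hand
   side is the kernel of the fractional Laplacian, up to the constant. *)
Lemma integral_time_heatn (s : R) y : 0 < s -> 0 < sqnorm y ->
  (\int[mu]_t (ppow (- s - 1) t * heatn t y)%:E =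
   (2 `^ (2 * s) * Gamma ((n%:R + 2 * s) / 2) / pi `^ (n%:R / 2) /
      (Num.sqrt (sqnorm y)) `^ (n%:R + 2 * s))%:E)%E.
Proof.
move=> s0 q0; set q := sqnorm y.
have p4 : 0 < 4 * pi :> R by rewrite mulr_gt0 ?pi_gt0.
pose a : R := s + n%:R / 2.
have a0 : 0 < a by rewrite ltr_wpDr // divr_ge0.
transitivity (\int[mu]_t (((4 * pi) `^ (- (n%:R / 2)))%:E *
    (ppow (- a - 1) t * expR (- ((q / 4) / t)))%:E))%E.
  apply: eq_integral => t _; rewrite -EFinM; congr EFin.
  have [t0|t0] := leP t 0; first by rewrite !ppow_le0 // !mul0r mulr0.
  rewrite !ppowE // /heatn /heat1 big_split /= prodr_const card_ord -expR_sum.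
  rewrite -powR_mulrn ?powR_ge0 // -powRrM powRM ?(ltW t0) ?(ltW p4) //.
  have -> : - 2^-1 * n%:R = - (n%:R / 2) :> R by ring.
  have -> : \sum_(i < n) - (tnth y i ^+ 2 / (4 * t)) = - (q / 4 / t).
    rewrite sumrN -mulr_suml -/(sqnorm y) -/q; congr (- _); field; by rewrite gt_eqF.
  have -> : t `^ (- a - 1) = t `^ (- s - 1) * t `^ (- (n%:R / 2)).
    rewrite -powRD; last by rewrite (gt_eqF t0) implybT.
    by congr (_ `^ _); rewrite /a; ring.
  ring.
rewrite ge0_integralZl_EFin ?powR_ge0 //; last 2 first.
- by move=> t _; rewrite lee_fin mulr_ge0 ?ppow_ge0 ?expR_ge0.
- apply/measurable_EFinP; apply: measurable_funM; first exact: measurable_ppow.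
  apply: (measurableT_comp (@measurable_expR R)) => //.
  apply: (measurableT_comp (@oppr_measurable R setT)) => //.
  by apply: measurable_funM => //; exact: measurable_invr.
rewrite integral_ppow_expV ?divr_gt0 // -EFinM; congr EFin.
have -> : (n%:R + 2 * s) / 2 = a by rewrite /a; by field.
have -> : n%:R + 2 * s = 2 * a by rewrite /a; by field.
rewrite -powR12_sqrt ?(ltW q0) // -powRrM mulrA mulVf // mul1r.
rewrite powRM ?pi_ge0 // powRM ?(ltW q0) // ?invr_ge0 //.
rewrite -[4^-1]powR_inv1 // -powRrM mulN1r opprK.
have -> : (4 : R) = 2 `^ 2 by rewrite powR_mulrn // expr2 -natrM.
rewrite -!powRrM [RHS]mulrAC -[X in _ = X / _]mulrA [X in _ = _ * X / _]mulrC.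
rewrite -!powRN.
have -> : 2 * s = 2 * - (n%:R / 2) + 2 * a by rewrite /a; by field.
rewrite powRD; last by rewrite pnatr_eq0 implybT.
ring.
Qed.

End HeatN.

(** * The heat semigroup and the fractional Laplacian *)

Section MeasurableRow.
Context (R : realType) (n : nat).
Notation tup := (n.-tuple (measurableTypeR R)).
Notation rt := (@row_of_tuple R n).

(* ['rV[R]_n] carries no sigma-algebra, hence the detour through tuples. *)
Definition mrow (f : 'rV[R]_n -> R) := measurable_fun setT (fun y : tup => f (rt y)).

Lemma mrow_comp (f : 'rV[R]_n -> R) d (T : measurableType d) (h : T -> 'rV[R]_n) :
  mrow f -> (forall i, measurable_fun setT (fun z => h z 0 i)) ->
  measurable_fun setT (fun z => f (h z)).
Proof.
move=> mf mh.
pose k (z : T) : tup := [tuple h z 0 i | i < n].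
have mk : measurable_fun setT k.
  apply/measurable_fun_tnthP => i.
  rewrite (_ : _ \o _ = fun z => h z 0 i); last first.
    by apply/funext => z; rewrite /= tnth_mktuple.
  exact: mh.
rewrite (_ : (fun z => f (h z)) = (fun y => f (rt y)) \o k).
  exact: measurableT_comp mf mk.
apply/funext => z /=; congr f; apply/rowP => i.
by rewrite mxE tnth_mktuple.
Qed.

Definition grid (k : nat) (y : tup) : 'rV[R]_n :=
  \row_i ((Num.floor (k.+1%:R * tnth y i))%:~R / k.+1%:R).

Lemma cvg_grid (y : tup) : grid k y @[k --> \oo] --> rt y.
Proof.
apply/cvg_ballP => e e0.
have := @cvg_harmonic R; move/cvgr0Pnorm_lt => /(_ e e0).
apply: filterS => k ke; rewrite /harmonic /= gtr0_norm // in ke.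
split => // i j; rewrite !mxE /ball /=.
apply: le_lt_trans ke.
have k0 : 0 < k.+1%:R :> R by [].
set z := tnth y j.
have /andP[h1 h2] := floor_itv (k.+1%:R * z).
rewrite intrD in h2.
have -> : z - (Num.floor (k.+1%:R * z))%:~R / k.+1%:R =
   (k.+1%:R * z - (Num.floor (k.+1%:R * z))%:~R) / k.+1%:R.
  by field; rewrite gt_eqF.
rewrite normrM normfV (gtr0_norm k0) ler_piMl ?invr_ge0 // ger0_norm ?subr_ge0 //.
by rewrite lerBlDl ltW.
Qed.

(** [f] is the pointwise limit of its values at the points [grid k y]. Each approximation takes
    countably many values, on cells cut out by measurable conditions on the coordinates. *)
Lemma mrow_continuous (f : 'rV[R]_n -> R) : continuous f -> mrow f.
Proof.
move=> cf; apply: (@measurable_fun_cvg _ _ R setT (fun k y => f (grid k y))); last first.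
  by move=> y _; have := cf (rt y); apply: (cvg_comp _ _ (@cvg_grid y)).
move=> k _ B mB; rewrite setTI.
pose F (c : {ffun 'I_n -> int}) : set tup :=
  [set y | (f (\row_i ((c i)%:~R / k.+1%:R)) \in B) /\
     forall i, Num.floor (k.+1%:R * tnth y i) = c i].
have -> : (fun y => f (grid k y)) @^-1` B = \bigcup_c F c.
  apply/seteqP; split => y /=.
    move=> By; exists [ffun i => Num.floor (k.+1%:R * tnth y i)] => //; split.
      rewrite inE; move: By; congr (B (f _)); apply/rowP => i.
      by rewrite !mxE ffunE.
    by move=> i; rewrite ffunE.
  move=> [c _ [+ h]]; rewrite inE; congr (B (f _)); apply/rowP => i.
  by rewrite !mxE h.
apply: countable_bigcupT_measurable; first exact: countableP.
move=> c; rewrite /F; have [Bc|_] := boolP (_ \in B); last first.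
  by rewrite (_ : [set _ | _] = set0) //; apply/seteqP; split => y [].
rewrite (_ : [set _ | _] = \bigcap_(i in setT)
   [set y : tup | Num.floor (k.+1%:R * tnth y i) = c i]); last first.
  by apply/seteqP; split => y /=; [move=> [_ h] i _; exact: h | move=> h; split => // i; exact: h].
apply: fin_bigcap_measurable => [|i _]; first exact: finite_finset.
have -> : [set y : tup | Num.floor (k.+1%:R * tnth y i) = c i] =
   (fun y : tup => k.+1%:R * tnth y i) @^-1` `[(c i)%:~R, (c i + 1)%:~R[%classic.
  apply/seteqP; split => y /=; rewrite in_itv /=.
    by move=> <-; exact: floor_itv.
  by move/floor_def.
rewrite -[X in measurable X]setTI.
have mk : measurable_fun setT (fun y : tup => k.+1%:R * tnth y i).
  by apply: measurable_funM => //; exact: measurable_tnth.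
exact: mk.
Qed.

End MeasurableRow.

Section MeasurableParam.
Context d1 d2 (T1 : measurableType d1) (T2 : measurableType d2) (R : realType).
Variable m2 : {sigma_finite_measure set T2 -> \bar R}.

(** Positive and negative parts are integrated apart, so that Tonelli gives measurability, and
    [fine] settles the parameters at which the integral is infinite. *)
Lemma measurable_Rintegral (f : T1 * T2 -> R) : measurable_fun setT f ->
  measurable_fun setT (fun x => \int[m2]_y f (x, y)).
Proof.
move=> /measurable_EFinP mf; rewrite /Rintegral.
apply: (measurableT_comp (fine_measurable measurableT)).
under eq_fun do rewrite integralE.
apply: emeasurable_funB.
  have -> : (fun x => \int[m2]_y ((fun y => (f (x, y))%:E)^\+ y)%E)%E =
      (fun x => \int[m2]_y ((EFin \o f)^\+ (x, y))%E)%E.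
    by apply/funext => x; apply: eq_integral => y _; rewrite !funeposE.
  by apply: measurable_fun_fubini_tonelli_F => //; exact: measurable_funepos.
have -> : (fun x => \int[m2]_y ((fun y => (f (x, y))%:E)^\- y)%E)%E =
    (fun x => \int[m2]_y ((EFin \o f)^\- (x, y))%E)%E.
  by apply/funext => x; apply: eq_integral => y _; rewrite !funenegE.
by apply: measurable_fun_fubini_tonelli_F => //; exact: measurable_funeneg.
Qed.

End MeasurableParam.

Section MinLe.
Context (R : realDomainType).
Lemma ge_min_l (x y : R) : Num.min x y <= x. Proof. by rewrite ge_min lexx. Qed.
Lemma ge_min_r (x y : R) : Num.min x y <= y. Proof. by rewrite ge_min lexx orbT. Qed.
End MinLe.

(** * The heat operator on bounded functions *)

Section HeatOperator.
Context (R : realType) (n : nat).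
Notation mu := (@lebesgue_measure R).
Notation tup := (n.-tuple (measurableTypeR R)).
Notation mun := (lebn R n).
Notation rt := (@row_of_tuple R n).
Implicit Types (t r : R) (y w : tup) (f : 'rV[R]_n -> R) (x : 'rV[R]_n).

Definition heat t f x : R := \int[mun]_y (heatn t y * f (x + rt y)).

Definition sdiff f (y x : 'rV[R]_n) : R := 2 * f x - f (x + y) - f (x - y).

Definition sqn (z : 'rV[R]_n) : R := \sum_(i < n) z 0 i ^+ 2.

Lemma sqnormE y : sqnorm y = sqn (rt y).
Proof. by apply: eq_bigr => i _; rewrite mxE. Qed.

Lemma measurable_row_of_tuple d (T : measurableType d) (g : T -> tup) i :
  measurable_fun setT g -> measurable_fun setT (fun z => rt (g z) 0 i).
Proof.
move=> mg; under eq_fun do rewrite mxE.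
exact: measurable_tnth_comp.
Qed.

Lemma mrow_shift f x d (T : measurableType d) (g : T -> tup) :
  mrow f -> measurable_fun setT g -> measurable_fun setT (fun z => f (x + rt (g z))).
Proof.
move=> mf mg; apply: mrow_comp => // i.
under eq_fun do rewrite mxE; apply: measurable_funD => //.
exact: measurable_row_of_tuple.
Qed.

Lemma mrow_shiftB f x d (T : measurableType d) (g : T -> tup) :
  mrow f -> measurable_fun setT g -> measurable_fun setT (fun z => f (x - rt (g z))).
Proof.
move=> mf mg; apply: mrow_comp => // i.
under eq_fun do rewrite mxE; apply: measurable_funD => //.
under eq_fun do rewrite mxE; apply: (measurableT_comp (@oppr_measurable R setT)) => //.
exact: measurable_row_of_tuple.
Qed.

Lemma mrow_sdiff f x d (T : measurableType d) (g : T -> tup) :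
  mrow f -> measurable_fun setT g -> measurable_fun setT (fun z => sdiff f (rt (g z)) x).
Proof.
move=> mf mg; apply: measurable_funB; last exact: mrow_shiftB.
by apply: measurable_funB => //; exact: mrow_shift.
Qed.

Lemma measurable_heatn1 t : measurable_fun setT (heatn t : tup -> R).
Proof. exact: measurable_heatn. Qed.

(** With [heatn_Rintegral_sq] and [heatn_Rintegral_sq2] this covers functions of size 1, |y|^2 and
    |y|^4; their heat averages are of order 1, t and t^2. *)
Lemma heatn_Rintegral_le (F : tup -> R) t M : 0 < t -> 0 <= M ->
  measurable_fun setT F -> (forall y, `|F y| <= M) ->
  mun.-integrable setT (EFin \o (fun y => heatn t y * F y)) /\
  `|\int[mun]_y (heatn t y * F y)| <= M.
Proof.
move=> t0 M0 mF FM; apply: (@Rintegral_dominated _ _ _ _ _ (fun y => M * heatn t y)).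
- by apply: measurable_funM => //; exact: measurable_heatn1.
- by apply: measurable_funM => //; exact: measurable_heatn1.
- by move=> y; rewrite normrM ger0_norm ?heatn_ge0 // mulrC ler_wpM2r ?heatn_ge0.
- under eq_integral do rewrite EFinM.
  rewrite ge0_integralZl_EFin ?integral_heatn ?mule1 //.
  + by move=> y _; rewrite lee_fin heatn_ge0.
  + by apply/measurable_EFinP; exact: measurable_heatn1.
Qed.

Lemma heatn_Rintegral_sq (F : tup -> R) t A : 0 < t -> 0 <= A ->
  measurable_fun setT F -> (forall y, `|F y| <= A * sqnorm y) ->
  mun.-integrable setT (EFin \o (fun y => heatn t y * F y)) /\
  `|\int[mun]_y (heatn t y * F y)| <= A * (2 * n%:R * t).
Proof.
move=> t0 A0 mF FM; apply: (@Rintegral_dominated _ _ _ _ _ (fun y => A * (heatn t y * sqnorm y))).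
- by apply: measurable_funM => //; exact: measurable_heatn1.
- apply: measurable_funM => //; apply: measurable_funM; first exact: measurable_heatn1.
  exact: measurable_sqnorm.
- by move=> y; rewrite normrM ger0_norm ?heatn_ge0 // mulrCA ler_wpM2l ?heatn_ge0.
- under eq_integral do rewrite EFinM.
  rewrite ge0_integralZl_EFin ?integral_heatn_sqnorm // => [y _|].
  + by rewrite lee_fin mulr_ge0 ?heatn_ge0 ?sqnorm_ge0.
  + apply/measurable_EFinP; apply: measurable_funM; first exact: measurable_heatn1.
    exact: measurable_sqnorm.
Qed.

Lemma heatn_Rintegral_sq2 (F : tup -> R) t A : 0 < t -> 0 <= A ->
  measurable_fun setT F -> (forall y, `|F y| <= A * sqnorm y ^+ 2) ->
  `|\int[mun]_y (heatn t y * F y)| <= A * (12 * n%:R ^+ 2 * t ^+ 2).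
Proof.
move=> t0 A0 mF FM.
have mq : measurable_fun setT (fun y => heatn t y * sqnorm y ^+ 2).
  apply: measurable_funM; first exact: measurable_heatn1.
  by apply: measurable_funX; exact: measurable_sqnorm.
apply: (@Rintegral_dominated _ _ _ _ _ (fun y => A * (heatn t y * sqnorm y ^+ 2)) _ _ _ _ _).2.
- by apply: measurable_funM => //; exact: measurable_heatn1.
- exact: measurable_funM.
- by move=> y; rewrite normrM ger0_norm ?heatn_ge0 // mulrCA ler_wpM2l ?heatn_ge0.
- under eq_integral do rewrite EFinM.
  rewrite ge0_integralZl_EFin // => [|y _|].
  + by rewrite EFinM; apply: lee_wpmul2l; rewrite ?lee_fin //; exact: integral_heatn_sqnorm2.
  + by rewrite lee_fin mulr_ge0 ?heatn_ge0 ?sqr_ge0.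
  + exact/measurable_EFinP.
Qed.

Lemma heatn_Rintegral_cst t c : 0 < t -> \int[mun]_y (heatn t y * c) = c.
Proof.
move=> t0; rewrite RintegralZr //; last first.
  by apply: (integrable_EFin_ge0 (c := 1)); [exact: measurable_heatn1|exact: heatn_ge0|exact: integral_heatn].
by rewrite (Rintegral_EFin (integral_heatn n t0)) mul1r.
Qed.

Section Bounded.
Variables (f : 'rV[R]_n -> R) (M : R).
Hypotheses (mf : mrow f) (fM : forall x, `|f x| <= M).

Let M0 : 0 <= M. Proof. exact: le_trans (fM 0). Qed.

Lemma heat_integrable t x : 0 < t ->
  mun.-integrable setT (EFin \o (fun y => heatn t y * f (x + rt y))).
Proof.
move=> t0; apply: (heatn_Rintegral_le (M := M) _ _ _ _).1 => //.
exact: mrow_shift.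
Qed.

Lemma heat_integrableN t x : 0 < t ->
  mun.-integrable setT (EFin \o (fun y => heatn t y * f (x - rt y))).
Proof.
move=> t0; apply: (heatn_Rintegral_le (M := M) _ _ _ _).1 => //.
exact: mrow_shiftB.
Qed.

Lemma heat_le t x : 0 < t -> `|heat t f x| <= M.
Proof.
move=> t0; apply: (heatn_Rintegral_le (M := M) _ _ _ _).2 => //.
exact: mrow_shift.
Qed.

Lemma mrow_heat t : mrow (heat t f).
Proof.
rewrite /mrow /heat.
apply: (@measurable_Rintegral _ _ _ _ _ mun (fun z : tup * tup => heatn t z.2 * f (rt z.1 + rt z.2))).
apply: measurable_funM; first exact: measurable_heatn.
apply: mrow_comp => // i; under eq_fun do rewrite mxE.
by apply: measurable_funD; exact: measurable_row_of_tuple.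
Qed.

Lemma heat_reflect t x : 0 < t ->
  \int[mun]_y (heatn t y * f (x - rt y)) = heat t f x.
Proof.
move=> t0; rewrite /heat.
rewrite -(@Rintegral_affine_tuple R n (fun=> -1) (fun=> 0) (fun y => heatn t y * f (x + rt y))).
- apply: eq_Rintegral => y _; congr (_ * f _).
    by apply: eq_bigr => i _; rewrite tnth_mktuple mulN1r addr0 heat1N.
  by congr (_ + _); apply/rowP => i; rewrite !mxE tnth_mktuple mulN1r addr0.
- by move=> i; rewrite normrN1.
- apply: measurable_funM; first exact: measurable_heatn1.
  exact: mrow_shift.
- exact: heat_integrable.
Qed.

(** Averaging over y and - y replaces a first difference by a second one. The latter is of order
    |y|^2 for regular [f], which produces the factor t for small times. *)
Lemma heat_sdiff t x : 0 < t ->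
  f x - heat t f x = 2^-1 * \int[mun]_y (heatn t y * sdiff f (rt y) x).
Proof.
move=> t0.
have i1 := heat_integrable x t0; have i2 := heat_integrableN x t0.
have i0 : mun.-integrable setT (EFin \o (fun y => heatn t y * (2 * f x))).
  exact: (heatn_Rintegral_le (M := `|2 * f x|) _ _ _ _).1.
transitivity (2^-1 * (2 * f x - heat t f x - heat t f x)); first by field.
congr (_ * _); rewrite -{2}heat_reflect // /heat -[X in X - _ - _](heatn_Rintegral_cst _ t0).
rewrite -RintegralB // -RintegralB //.
- by apply: eq_Rintegral => y _; rewrite /sdiff; ring.
- rewrite (_ : _ \o _ = (fun y => (heatn t y * (2 * f x))%:E - (heatn t y * f (x + rt y))%:E)%E) //.
  exact: integrableB.
Qed.

Lemma heat_diff_le t x A : 0 < t -> 0 <= A ->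
  (forall y, `|sdiff f (rt y) x| <= A * Num.min 1 (sqnorm y)) ->
  `|f x - heat t f x| <= A * n.+1%:R * Num.min 1 t.
Proof.
move=> t0 A0 h; rewrite heat_sdiff // normrM gtr0_norm ?invr_gt0 //.
(* The constant [n.+1] serves both regimes: the bound is A / 2 for t >= 1 and A n t for t < 1. *)
have n1 : 1 <= n.+1%:R :> R by rewrite ler1n.
have msd : measurable_fun setT (fun y : tup => sdiff f (rt y) x) by exact: mrow_sdiff.
have [_ h1] := heatn_Rintegral_le t0 A0 msd (fun y => le_trans (h y)
  (ler_piMr A0 (ge_min_l 1 (sqnorm y)))).
have [_ h2] := heatn_Rintegral_sq t0 A0 msd (fun y => le_trans (h y)
  (ler_wpM2l A0 (ge_min_r 1 (sqnorm y)))).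
rewrite mulrC ler_pdivrMr //.
have [t1|t1] := leP 1 t.
  by apply: le_trans h1 _; rewrite mulr1 -mulrA ler_peMr // -natrM ler1n muln2.
apply: le_trans h2 _; rewrite -natr1.
have := mulr_ge0 A0 (ltW t0); nra.
Qed.

(* The inner integral is recentred by [z = w - y], so that the Gaussian
   convolution identity applies after exchanging the integrals. *)
Lemma heat_semigroup t r x : 0 < t -> 0 < r ->
  heat t (heat r f) x = heat (t + r) f x.
Proof.
move=> t0 r0.
have mh y : measurable_fun setT (fun w => heatn r (subt w y)).
  by apply: measurable_heatn => //; exact: measurable_subt.
have hE y : heat r f (x + rt y) = \int[mun]_w (heatn r (subt w y) * f (x + rt w)).
  rewrite /heat -(@Rintegral_affine_tuple R n (fun=> 1) (fun i => - tnth y i)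
    (fun z => heatn r z * f (x + rt y + rt z))).
  - apply: eq_Rintegral => w _; congr (_ * f _).
      by apply: eq_bigr => i _; rewrite tnth_mktuple tnth_subt mul1r.
    apply/rowP => i; rewrite !mxE tnth_mktuple; ring.
  - by move=> i; rewrite normr1.
  - apply: measurable_funM; first exact: measurable_heatn1.
    exact: mrow_shift.
  - exact: heat_integrable.
have e1 y : (\int[mun]_w (heatn r (subt w y))%:E = 1)%E.
  rewrite -(integral_heatn n r0) -[RHS](@ge0_integral_affine_tuple R n (fun=> 1) (fun i => - tnth y i)).
  - apply: eq_integral => w _; congr EFin; apply: eq_bigr => i _.
    by rewrite tnth_subt tnth_mktuple mul1r.
  - by move=> i; rewrite normr1.
  - by apply/measurable_EFinP; exact: measurable_heatn1.
  - by move=> w; rewrite lee_fin heatn_ge0.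
have e2 y : (\int[mun]_w (M * heatn r (subt w y))%:E = M%:E)%E.
  under eq_integral do rewrite EFinM.
  rewrite ge0_integralZl_EFin ?e1 ?mule1 //.
  - by move=> w _; rewrite lee_fin heatn_ge0.
  - exact/measurable_EFinP.
pose F (z : tup * tup) : R := heatn t z.1 * (heatn r (subt z.2 z.1) * f (x + rt z.2)).
have mk : measurable_fun setT (fun z : tup * tup => heatn r (subt z.2 z.1)).
  by apply: measurable_heatn => //; exact: measurable_subt.
have mF : measurable_fun setT F.
  apply: measurable_funM; first exact: measurable_heatn.
  by apply: measurable_funM => //; exact: mrow_shift.
have Fi : (mun \x mun)%E.-integrable setT (EFin \o F).
  apply: (@integrable_prod_dominated _ _ _ _ _ mun mun F
    (fun z => M * (heatn t z.1 * heatn r (subt z.2 z.1))) (fun y => M * heatn t y)) => //.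
  - apply: measurable_funM => //; apply: measurable_funM => //; exact: measurable_heatn.
  - move=> z; rewrite /F mulrA normrM ger0_norm ?mulr_ge0 ?heatn_ge0 // mulrC.
    by rewrite ler_wpM2r // mulr_ge0 ?heatn_ge0.
  - move=> y /=.
    under eq_integral do rewrite mulrCA EFinM.
    rewrite ge0_integralZl_EFin ?heatn_ge0 ?e2 -?EFinM ?(mulrC M) //.
    + by move=> w _; rewrite lee_fin mulr_ge0 ?heatn_ge0.
    + by apply/measurable_EFinP; exact: measurable_funM.
  - have := integrable_EFin_ge0 (measurable_heatn1 t) (heatn_ge0 t) (integral_heatn n t0).
    move=> h; rewrite (_ : _ \o _ = (fun y => M%:E * (heatn t y)%:E)%E) //.
    exact: integrableZl.
transitivity (\int[mun]_y \int[mun]_w F (y, w)).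
  apply: eq_Rintegral => y _; rewrite hE /F /= RintegralZl //.
  apply: (Rintegral_dominated (g := fun w => M * heatn r (subt w y)) (c := M) _ _ _ _).1.
  - by apply: measurable_funM => //; exact: mrow_shift.
  - exact: measurable_funM.
  - by move=> w; rewrite normrM ger0_norm ?heatn_ge0 // mulrC ler_wpM2r ?heatn_ge0.
  - by rewrite e2.
rewrite (Rfubini Fi); apply: eq_Rintegral => w _.
rewrite -(Rintegral_EFin (heatn_conv w t0 r0)) -RintegralZr //.
  by apply: eq_Rintegral => y _; rewrite /F /= mulrA.
apply: (integrable_EFin_ge0 _ _ (heatn_conv w t0 r0)).
- apply: measurable_funM; first exact: measurable_heatn1.
  by apply: measurable_heatn => //; exact: measurable_subt.
- by move=> y; rewrite mulr_ge0 ?heatn_ge0.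
Qed.

End Bounded.
End HeatOperator.

(** * Integrals against t^(-1-s) *)

Section SubordinationIntegral.
Context (R : realType).
Notation mu := (@lebesgue_measure R).
Implicit Types (s t : R) (g : R -> R).

Definition subord s g : R := s / Gamma (1 - s) * \int[mu]_t (ppow (- s - 1) t * g t).

(** The value on the model majorant; a function of size [A * Num.min 1 t] is sent to a number of
    size at most A times this. *)
Definition subord_min s : R := subord s (Num.min 1).

Lemma measurable_minl : measurable_fun setT (Num.min (1 : R)).
Proof. exact: measurable_minr. Qed.

Lemma measurable_ppowM a g : measurable_fun setT g ->
  measurable_fun setT (fun t => ppow a t * g t).
Proof. by move=> mg; apply: measurable_funM => //; exact: measurable_ppow. Qed.

Lemma integral_ppow_min_lty s : 0 < s < 1 ->
  (\int[mu]_t (ppow (- s - 1) t * Num.min 1 t)%:E < +oo)%E.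
Proof.
move=> /andP[s0 s1]; have s1' : 0 < 1 - s by rewrite subr_gt0.
have m1 : measurable_fun setT (fun t : R => (ppow (1 - s - 1) t * (t < 2)%R%:R)%:E).
  by apply/measurable_EFinP; apply: measurable_ppowM; exact: measurable_fun_ltb.
have m2 : measurable_fun setT (fun t : R => (ppow (- s - 1) t * (1 < t)%R%:R)%:E).
  by apply/measurable_EFinP; apply: measurable_ppowM; exact: measurable_fun_ltb.
have p1 a t (b : bool) : (0 <= (ppow a t * b%:R)%:E)%E.
  by rewrite lee_fin mulr_ge0 ?ppow_ge0.
(* For small t the minimum improves the power to t^(-s), integrable at 0; for large t the power
   alone is integrable. The pieces t < 2 and t > 1 overlap because both inequalities are strict. *)
apply: (@le_lt_trans _ _ (\int[mu]_t ((ppow (1 - s - 1) t * (t < 2)%R%:R)%:E +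
    (ppow (- s - 1) t * (1 < t)%R%:R)%:E))%E).
  apply: ge0_le_integral => //.
  - move=> t _; rewrite lee_fin; have [t0|t0] := leP t 0; first by rewrite ppow_le0 // mul0r.
    by rewrite mulr_ge0 ?ppow_ge0 // le_min ler01 ltW.
  - by apply/measurable_EFinP; apply: measurable_ppowM; exact: measurable_minl.
  - exact: emeasurable_funD.
  - move=> t _; rewrite -EFinD lee_fin.
    have [t0|t0] := leP t 0; first by rewrite !ppow_le0 // !mul0r addr0.
    have [t2|t2] := ltP t 2.
      rewrite mulr1 ler_wpDr ?mulr_ge0 ?ppow_ge0 ?powR_ge0 //.
      apply: (@le_trans _ _ (ppow (- s - 1) t * t)).
        by rewrite ler_wpM2l ?ppow_ge0 // ge_min_r.
      rewrite !ppowE // -[X in _ * X](powRr1 (ltW t0)) -powRD ?(gt_eqF t0) ?implybT //.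
      by have -> : - s - 1 + 1 = 1 - s - 1 by ring.
    have t1 : 1 < t by rewrite (lt_le_trans _ t2) // ltr1n.
    by rewrite t1 mulr0 add0r mulr1 ler_piMr ?ppow_ge0 // ge_min_l.
rewrite ge0_integralD //.
by rewrite integral_ppow_lt // integral_ppow_gt // -EFinD ltry.
Qed.

Lemma subord_cst_ge0 s : 0 < s < 1 -> 0 <= s / Gamma (1 - s).
Proof. by move=> /andP[s0 s1]; rewrite divr_ge0 ?ltW // Gamma_gt0 // subr_gt0. Qed.

Lemma ppow_min_integrable s : 0 < s < 1 ->
  mu.-integrable setT (EFin \o (fun t => ppow (- s - 1) t * Num.min 1 t)).
Proof.
move=> hs; apply/integrableP; split.
  by apply/measurable_EFinP; apply: measurable_ppowM; exact: measurable_minl.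
apply: le_lt_trans (integral_ppow_min_lty hs); rewrite le_eqVlt; apply/orP; left.
apply/eqP; apply: eq_integral => t _ /=; rewrite ger0_norm //.
have [t0|t0] := leP t 0; first by rewrite ppow_le0 // mul0r.
by rewrite mulr_ge0 ?ppow_ge0 // le_min ler01 ltW.
Qed.

Lemma subord_dominated s g A : 0 < s < 1 -> measurable_fun setT g ->
  (forall t, 0 < t -> `|g t| <= A * Num.min 1 t) ->
  mu.-integrable setT (EFin \o (fun t => ppow (- s - 1) t * g t)) /\
  `|subord s g| <= A * subord_min s.
Proof.
move=> hs mg gA.
have key := @Rintegral_dominated _ _ R mu (fun t => ppow (- s - 1) t * g t)
  (fun t => A * (ppow (- s - 1) t * Num.min 1 t))
  (A * \int[mu]_t (ppow (- s - 1) t * Num.min 1 t)).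
have [] := key.
- exact: measurable_ppowM.
- by apply: measurable_funM => //; apply: measurable_ppowM; exact: measurable_minl.
- move=> t; have [t0|t0] := leP t 0; first by rewrite ppow_le0 // !mul0r mulr0 normr0.
  by rewrite normrM ger0_norm ?ppow_ge0 // mulrCA ler_wpM2l ?ppow_ge0 // gA.
- rewrite -RintegralZl //; last exact: ppow_min_integrable.
  rewrite /Rintegral fineK //.
  apply: integrable_fin_num => //.
  rewrite (_ : (fun _ => _) = (fun t => A%:E * (ppow (- s - 1) t * Num.min 1 t)%:E)%E) //.
  by apply: integrableZl => //; exact: ppow_min_integrable.
move=> gi gb; split => //.
rewrite /subord_min /subord normrM (ger0_norm (subord_cst_ge0 hs)) mulrCA.
by rewrite ler_wpM2l ?subord_cst_ge0.
Qed.

Lemma subord_min_ge0 s : 0 < s < 1 -> 0 <= subord_min s.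
Proof.
move=> hs; rewrite mulr_ge0 ?subord_cst_ge0 // Rintegral_ge0 // => t _.
have [t0|t0] := leP t 0; first by rewrite ppow_le0 // mul0r.
by rewrite mulr_ge0 ?ppow_ge0 // le_min ler01 ltW.
Qed.

Lemma eq_subord s g1 g2 : (forall t, 0 < t -> g1 t = g2 t) ->
  subord s g1 = subord s g2.
Proof.
move=> h; congr (_ * _); apply: eq_Rintegral => t _.
by have [t0|t0] := leP t 0; [rewrite !ppow_le0 ?mul0r|rewrite h].
Qed.

Lemma subordB s g1 g2 A1 A2 : 0 < s < 1 ->
  measurable_fun setT g1 -> measurable_fun setT g2 ->
  (forall t, 0 < t -> `|g1 t| <= A1 * Num.min 1 t) ->
  (forall t, 0 < t -> `|g2 t| <= A2 * Num.min 1 t) ->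
  subord s (fun t => g1 t - g2 t) = subord s g1 - subord s g2.
Proof.
move=> hs m1 m2 h1 h2; rewrite /subord -mulrBr; congr (_ * _).
rewrite -RintegralB //; [|exact: (subord_dominated hs m1 h1).1|exact: (subord_dominated hs m2 h2).1].
by apply: eq_Rintegral => t _; rewrite mulrBr.
Qed.

Lemma subordZ s g c A : 0 < s < 1 -> measurable_fun setT g ->
  (forall t, 0 < t -> `|g t| <= A * Num.min 1 t) ->
  subord s (fun t => c * g t) = c * subord s g.
Proof.
move=> hs mg h; rewrite /subord mulrCA; congr (_ * _).
rewrite -RintegralZl //; last exact: (subord_dominated hs mg h).1.
by apply: eq_Rintegral => t _; rewrite mulrCA.
Qed.

End SubordinationIntegral.

Section Subordination.
Context (R : realType) (n : nat).
Notation mu := (@lebesgue_measure R).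
Notation tup := (n.-tuple (measurableTypeR R)).
Notation mun := (lebn R n).
Notation rt := (@row_of_tuple R n).
Implicit Types (s t r : R) (y w : tup) (f : 'rV[R]_n -> R) (x : 'rV[R]_n).

(** The singular integral of an arbitrary [H] in place of a second difference; the factor one half
    of the fractional Laplacian is left to [flap]. *)
Definition riesz s (H : tup -> R) : R :=
  gamma_cst n s * \int[mun]_y (H y / (enorm (rt y)) `^ (n%:R + 2 * s)).

Lemma enormE y : enorm (rt y) = Num.sqrt (sqnorm y).
Proof. by rewrite /enorm sqnormE. Qed.

Lemma integral_heatn_min t : 0 < t ->
  (\int[mun]_y (heatn t y * Num.min 1 (sqnorm y))%:E <= (2 * n.+1%:R * Num.min 1 t)%:E)%E.
Proof.
move=> t0.
have mQ : measurable_fun setT (fun y : tup => Num.min 1 (sqnorm y)).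
  exact: measurableT_comp (@measurable_minl R) (@measurable_sqnorm R n).
have m1 : measurable_fun setT (fun y : tup => (heatn t y * Num.min 1 (sqnorm y))%:E).
  by apply/measurable_EFinP; apply: measurable_funM => //; exact: measurable_heatn1.
have p1 y : (0 <= (heatn t y * Num.min 1 (sqnorm y))%:E)%E.
  by rewrite lee_fin mulr_ge0 ?heatn_ge0 // le_min ler01 sqnorm_ge0.
have [t1|t1] := leP 1 t.
  apply: (@le_trans _ _ (\int[mun]_y (heatn t y)%:E)%E).
    apply: ge0_le_integral => //.
    - by apply/measurable_EFinP; exact: measurable_heatn1.
    - by move=> y _; rewrite lee_fin ler_piMr ?heatn_ge0 // ge_min_l.
  by rewrite integral_heatn // mulr1 lee_fin -natrM ler1n.
apply: (@le_trans _ _ (\int[mun]_y (heatn t y * sqnorm y)%:E)%E).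
  apply: ge0_le_integral => //.
  - apply/measurable_EFinP; apply: measurable_funM; first exact: measurable_heatn1.
    exact: measurable_sqnorm.
  - by move=> y _; rewrite lee_fin ler_wpM2l ?heatn_ge0 // ge_min_r.
by rewrite integral_heatn_sqnorm // lee_fin ler_wpM2r ?(ltW t0) // ler_wpM2l // ler_nat.
Qed.

(** Fubini for t^(-s-1) times the heat kernel times [H]. The heat average of a function of size
    min(1, |y|^2) is of order min(1, t), which makes the double integral absolutely convergent for 0
    < s < 1. *)
Lemma riesz_subord s (H : tup -> R) A : 0 < s < 1 -> 0 <= A -> measurable_fun setT H ->
  (forall y, `|H y| <= A * Num.min 1 (sqnorm y)) ->
  riesz s H = subord s (fun t => \int[mun]_y (heatn t y * H y)).
Proof.
move=> hs A0 mH HA; have /andP[s0 s1] := hs.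
pose F (z : R * tup) : R := ppow (- s - 1) z.1 * (heatn z.1 z.2 * H z.2).
have mF : measurable_fun setT F.
  apply: measurable_funM; first exact: measurableT_comp (measurable_ppow _) measurable_fst.
  apply: measurable_funM; first exact: measurable_heatn.
  exact: measurableT_comp mH measurable_snd.
have mQ : measurable_fun setT (fun y : tup => Num.min 1 (sqnorm y)).
  exact: measurableT_comp (@measurable_minl R) (@measurable_sqnorm R n).
pose g (z : R * tup) : R := ppow (- s - 1) z.1 * (A * (heatn z.1 z.2 * Num.min 1 (sqnorm z.2))).
have Fi : (mu \x mun)%E.-integrable setT (EFin \o F).
  apply: (@integrable_prod_dominated _ _ _ _ _ mu mun F g
    (fun t => A * (2 * n.+1%:R) * (ppow (- s - 1) t * Num.min 1 t))) => //.
  - apply: measurable_funM; first exact: measurableT_comp (measurable_ppow _) measurable_fst.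
    apply: measurable_funM => //; apply: measurable_funM; first exact: measurable_heatn.
    exact: measurableT_comp mQ measurable_snd.
  - move=> z; rewrite /F /g normrM ger0_norm ?ppow_ge0 // ler_wpM2l ?ppow_ge0 //.
    by rewrite normrM ger0_norm ?heatn_ge0 // mulrCA ler_wpM2l ?heatn_ge0.
  - move=> t; rewrite /g /=; have [t0|t0] := leP t 0.
      by rewrite integral0_eq ?ppow_le0 // => [|y _]; rewrite !mul0r ?mulr0.
    under eq_integral do rewrite mulrA EFinM.
    rewrite ge0_integralZl_EFin ?mulr_ge0 ?ppow_ge0 ?powR_ge0 //.
    + rewrite [leRHS](_ : _ = (ppow (- s - 1) t * A)%:E * (2 * n.+1%:R * Num.min 1 t)%:E)%E.
        apply: lee_wpmul2l; last exact: integral_heatn_min.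
        by rewrite lee_fin mulr_ge0 ?ppow_ge0.
      by rewrite -EFinM; congr EFin; ring.
    + by move=> y _; rewrite lee_fin mulr_ge0 ?heatn_ge0 // le_min ler01 sqnorm_ge0.
    + by apply/measurable_EFinP; apply: measurable_funM => //; exact: measurable_heatn1.
  - by apply: integrable_EFinZl; exact: ppow_min_integrable.
(* The constant of [integral_time_heatn]; multiplied by s / Gamma(1 - s) it is [gamma_cst n s]. *)
pose C := 2 `^ (2 * s) * Gamma ((n%:R + 2 * s) / 2) / pi `^ (n%:R / 2) : R.
have G1 : 0 < Gamma ((n%:R + 2 * s) / 2) :> R.
  by apply: Gamma_gt0; rewrite divr_gt0 // ltr_wpDl // mulr_gt0.
have G2 : 0 < Gamma (1 - s) :> R by rewrite Gamma_gt0 // subr_gt0.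
have p1 : 0 < 2 `^ (2 * s) :> R by rewrite powR_gt0.
have p2 : 0 < pi `^ (n%:R / 2) :> R by rewrite powR_gt0 // pi_gt0.
have C0 : 0 < C by rewrite /C divr_gt0 // mulr_gt0.
have FE y : \int[mu]_t F (t, y) = C * (H y / (enorm (rt y)) `^ (n%:R + 2 * s)).
  (* [integral_time_heatn] asks for y nonzero; at the origin the bound on [H] forces [H y = 0] and
     both sides vanish. *)
  have := sqnorm_ge0 y; rewrite le_eqVlt => /predU1P[q0|q0].
    have -> : H y = 0.
      by apply/eqP; rewrite -normr_le0; apply: le_trans (HA y) _; rewrite -q0 minEle ler10 mulr0.
    rewrite mul0r mulr0 /Rintegral integral0_eq // => t _.
    by rewrite /F /= (_ : H y = 0) ?mulr0 //; apply/eqP; rewrite -normr_le0;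
      apply: le_trans (HA y) _; rewrite -q0 minEle ler10 mulr0.
  have hI := integral_time_heatn s0 q0.
  under eq_Rintegral do rewrite /F /= mulrA.
  rewrite RintegralZr //; last first.
    apply: (integrable_EFin_ge0 _ _ hI).
    - by apply: measurable_ppowM; exact: measurable_heatn.
    - by move=> t; rewrite mulr_ge0 ?ppow_ge0 ?heatn_ge0.
  by rewrite (Rintegral_EFin hI) enormE /C; ring.
(* Integrability of the singular integrand is read off Fubini, which avoids polar coordinates. *)
have [Hi _] := Rfubini_1 (integrable_swap Fi).
have {}Hi : mun.-integrable setT (EFin \o (fun y => H y / (enorm (rt y)) `^ (n%:R + 2 * s))).
  have := integrable_EFinZl C^-1 Hi; congr (mun.-integrable setT (EFin \o _)).
  by apply/funext => y /=; rewrite FE mulrA mulVf ?mul1r // gt_eqF.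
have -> : riesz s H = s / Gamma (1 - s) * \int[mun]_y \int[mu]_t F (t, y).
  under eq_Rintegral do rewrite FE.
  rewrite RintegralZl // /riesz mulrA; congr (_ * _).
  by rewrite /gamma_cst /C; field; rewrite !gt_eqF.
rewrite -(Rfubini Fi) /subord; congr (_ * _).
apply: eq_Rintegral => t _; rewrite /F /=; have [t0|t0] := leP t 0.
  by rewrite ppow_le0 // mul0r; under eq_Rintegral do rewrite mul0r; rewrite Rintegral_cst // mul0r.
rewrite RintegralZl //.
apply: (heatn_Rintegral_le t0 A0 mH _).1 => y.
by apply: le_trans (HA y) _; rewrite ler_piMr // ge_min_l.
Qed.

End Subordination.

Section FlapReal.
Context (R : realType) (n : nat).
Notation mu := (@lebesgue_measure R).
Notation tup := (n.-tuple (measurableTypeR R)).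
Notation mun := (lebn R n).
Notation rt := (@row_of_tuple R n).
Implicit Types (s t r : R) (f : 'rV[R]_n -> R) (x y : 'rV[R]_n).

Definition flap s f x : R := riesz s (fun y : tup => sdiff f (rt y) x) / 2.

(** What subordination asks of a function. Smoothness of [flap s f] would have to be proved by
    differentiating a singular integral, whereas these bounds pass to it through second differences
    alone. *)
Record tame f (M A : R) : Prop := Tame {
  tame_mrow : mrow f;
  tame_ub : forall x, `|f x| <= M;
  tame_sdiff : forall x y, `|sdiff f y x| <= A * Num.min 1 (sqn y) }.

Lemma sqn_ge0 y : 0 <= sqn y.
Proof. by apply: sumr_ge0 => i _; exact: sqr_ge0. Qed.

Lemma measurable_heat d (T : measurableType d) f (a : T -> R) (h : T -> 'rV[R]_n) :
  mrow f -> measurable_fun setT a -> (forall i, measurable_fun setT (fun z => h z 0 i)) ->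
  measurable_fun setT (fun z => heat (a z) f (h z)).
Proof.
move=> mf ma mh.
apply: (@measurable_Rintegral _ _ _ _ _ mun
  (fun z : T * tup => heatn (a z.1) z.2 * f (h z.1 + rt z.2))).
apply: measurable_funM.
  by apply: measurable_heatn => //; exact: measurableT_comp ma measurable_fst.
apply: mrow_comp => // i; under eq_fun do rewrite mxE.
apply: measurable_funD; last exact: measurable_row_of_tuple.
exact: measurableT_comp (mh i) measurable_fst.
Qed.

Lemma measurable_heat_time f x : mrow f -> measurable_fun setT (fun t => heat t f x).
Proof. by move=> mf; apply: measurable_heat. Qed.

Section Tame.
Variables (f : 'rV[R]_n -> R) (M A : R).
Hypothesis hf : tame f M A.

Let mf := tame_mrow hf.
Let fM := tame_ub hf.

Lemma tame_sdiff_tuple x (y : tup) : `|sdiff f (rt y) x| <= A * Num.min 1 (sqnorm y).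
Proof. by rewrite sqnormE; exact: (tame_sdiff hf). Qed.

Hypothesis A0 : 0 <= A.

Lemma tame_heat_diff t x : 0 < t -> `|f x - heat t f x| <= A * n.+1%:R * Num.min 1 t.
Proof. by move=> t0; apply: (heat_diff_le mf fM) => // y; exact: tame_sdiff_tuple. Qed.

Lemma measurable_heat_diff x : measurable_fun setT (fun t => f x - heat t f x).
Proof. by apply: measurable_funB => //; exact: measurable_heat_time. Qed.

Lemma flap_subord s x : 0 < s < 1 ->
  flap s f x = subord s (fun t => f x - heat t f x).
Proof.
move=> hs; rewrite /flap (riesz_subord hs A0) //; last 2 first.
- exact: mrow_sdiff.
- by move=> y; exact: tame_sdiff_tuple.
rewrite (@eq_subord _ _ (fun t => \int[mun]_y (heatn t y * sdiff f (rt y) x))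
   (fun t => 2 * (f x - heat t f x))); last first.
  by move=> t t0; rewrite (heat_sdiff mf fM) // mulrA divff ?mul1r.
rewrite (subordZ _ (A := A * n.+1%:R)) //.
- by field.
- exact: measurable_heat_diff.
- by move=> t t0; exact: tame_heat_diff.
Qed.

Lemma flap_le s x : 0 < s < 1 -> `|flap s f x| <= A * n.+1%:R * subord_min s.
Proof.
move=> hs; rewrite flap_subord //.
apply: (subord_dominated hs _ _).2; first exact: measurable_heat_diff.
by move=> t t0; exact: tame_heat_diff.
Qed.

Lemma mrow_flap s : mrow (flap s f).
Proof.
rewrite /mrow /flap /riesz; apply: measurable_funM => //; apply: measurable_funM => //.
apply: (@measurable_Rintegral _ _ _ _ _ mun (fun z : tup * tup =>
  sdiff f (rt z.2) (rt z.1) / enorm (rt z.2) `^ (n%:R + 2 * s))).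
apply: measurable_funM.
  apply: measurable_funB.
    apply: measurable_funB.
      apply: measurable_funM => //; apply: mrow_comp => // i; exact: measurable_row_of_tuple.
    apply: mrow_comp => // i; under eq_fun do rewrite mxE.
    by apply: measurable_funD; exact: measurable_row_of_tuple.
  apply: mrow_comp => // i; under eq_fun do rewrite !mxE.
  by apply: measurable_funB; exact: measurable_tnth_comp.
apply: (measurableT_comp (@measurable_invr R)).
apply: (measurableT_comp (measurable_powR _)).
under eq_fun do rewrite enormE -powR12_sqrt ?sqnorm_ge0 //.
apply: (measurableT_comp (measurable_powR _)).
exact: measurableT_comp (@measurable_sqnorm R n) measurable_snd.
Qed.

Lemma heat_sdiff_comm t x y : 0 < t ->
  heat t (sdiff f y) x = sdiff (heat t f) y x.
Proof.
move=> t0; rewrite /heat {2}/sdiff.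
have i1 := heat_integrable mf fM x t0.
have i2 := heat_integrable mf fM (x + y) t0.
have i3 := heat_integrable mf fM (x - y) t0.
rewrite -RintegralZl // -!RintegralB //.
- apply: eq_Rintegral => z _; rewrite /sdiff ![x + _ + rt z]addrAC; ring.
- rewrite (_ : _ \o _ = (fun z => (2 * (heatn t z * f (x + rt z)))%:E - (heatn t z * f (x + y + rt z))%:E)%E) //.
  by apply: integrableB => //; exact: integrable_EFinZl.
- exact: integrable_EFinZl.
Qed.

End Tame.

Section Tame2.
Variables (f : 'rV[R]_n -> R) (M A : R).
Hypothesis hf : tame f M A.
Hypothesis A0 : 0 <= A.
Hypothesis hf2 : forall y, tame (sdiff f y) (4 * M) (A * Num.min 1 (sqn y)).

Let mf := tame_mrow hf.
Let fM := tame_ub hf.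

Let min_ge0 y : 0 <= A * Num.min 1 (sqn y).
Proof. by rewrite mulr_ge0 // le_min ler01 sqn_ge0. Qed.

(** Both operators are translation invariant; in subordinated form the claim reduces to linearity
    and [heat_sdiff_comm]. *)
Lemma flap_sdiff s x y : 0 < s < 1 ->
  sdiff (flap s f) y x = flap s (sdiff f y) x.
Proof.
move=> hs; rewrite (flap_subord (hf2 y)) // {1}/sdiff !(flap_subord hf) //.
pose d z t := f z - heat t f z.
have md z : measurable_fun setT (d z) by exact: (measurable_heat_diff hf).
have bd z t : 0 < t -> `|d z t| <= A * n.+1%:R * Num.min 1 t by move=> t0; exact: (tame_heat_diff hf).
have b2 t : 0 < t -> `|2 * d x t| <= 2 * (A * n.+1%:R) * Num.min 1 t.
  by move=> t0; rewrite normrM gtr0_norm // -mulrA ler_wpM2l // bd.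
have m2 : measurable_fun setT (fun t => 2 * d x t) by apply: measurable_funM => //; exact: md.
have b3 t : 0 < t -> `|2 * d x t - d (x + y) t| <= 3 * (A * n.+1%:R) * Num.min 1 t.
  move=> t0; apply: le_trans (ler_normB _ _) _.
  apply: le_trans (lerD (b2 t t0) (bd _ t t0)) _.
  by rewrite le_eqVlt; apply/orP; left; apply/eqP; ring.
have m3 : measurable_fun setT (fun t => 2 * d x t - d (x + y) t).
  by apply: measurable_funB => //; exact: md.
rewrite -(subordZ 2 hs (md x) (bd x)) -(subordB hs m2 (md (x + y)) b2 (bd _)).
rewrite -(subordB hs m3 (md (x - y)) b3 (bd _)).
apply: eq_subord => t t0; rewrite (heat_sdiff_comm hf) // /d /sdiff; ring.
Qed.

(** The second difference of [flap s f] is [flap s] of [sdiff f y], and [flap_le] is linear in the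
    constant A * min(1, |y|^2) that [hf2] grants to [sdiff f y]. *)
Lemma tame_flap s : 0 < s < 1 ->
  tame (flap s f) (A * n.+1%:R * subord_min s) (A * n.+1%:R * subord_min s).
Proof.
move=> hs; split.
- exact: mrow_flap hf _.
- by move=> x; exact: (flap_le hf).
- move=> x y; rewrite flap_sdiff //.
  apply: le_trans (flap_le (hf2 y) (min_ge0 y) _ hs) _.
  by rewrite le_eqVlt; apply/orP; left; apply/eqP; ring.
Qed.

(** P_t passes under the subordination integral by Fubini, and the semigroup law merges P_t P_r into
    P_(t+r). The result is the Marchaud derivative of r -> P_r f(x) at time t. *)
Lemma heat_flap s t x : 0 < s < 1 -> 0 < t ->
  heat t (flap s f) x = subord s (fun r => heat t f x - heat (t + r) f x).
Proof.
move=> hs t0.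
pose C := s / Gamma (1 - s).
pose F (z : tup * R) : R := heatn t z.1 * (ppow (- s - 1) z.2 *
   (f (x + rt z.1) - heat z.2 f (x + rt z.1))).
have mS i : measurable_fun setT (fun z : tup * R => (x + rt z.1) 0 i).
  under eq_fun do rewrite mxE; apply: measurable_funD => //.
  exact: measurable_row_of_tuple.
have mk : measurable_fun setT (fun z : tup * R => ppow (- s - 1) z.2).
  exact: measurableT_comp (measurable_ppow _) measurable_snd.
have mF : measurable_fun setT F.
  apply: measurable_funM; first exact: measurable_heatn.
  apply: measurable_funM => //.
  by apply: measurable_funB; [exact: mrow_comp|exact: measurable_heat].
pose B := A * n.+1%:R.
have B0 : 0 <= B by rewrite mulr_ge0.
have Imin := ppow_min_integrable hs.
pose K := \int[mu]_r (ppow (- s - 1) r * Num.min 1 r).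
have EK : (\int[mu]_r (ppow (- s - 1) r * Num.min 1 r)%:E = K%:E)%E.
  by rewrite /K /Rintegral fineK //; exact: integrable_fin_num.
have Fi : (mun \x mu)%E.-integrable setT (EFin \o F).
  apply: (@integrable_prod_dominated _ _ _ _ _ mun mu F
    (fun z => heatn t z.1 * (B * (ppow (- s - 1) z.2 * Num.min 1 z.2)))
    (fun v => B * K * heatn t v)) => //.
  - apply: measurable_funM; first exact: measurable_heatn.
    apply: measurable_funM => //; apply: measurable_funM => //.
    exact: measurableT_comp (@measurable_minl R) measurable_snd.
  - move=> [y r]; rewrite /F /= normrM ger0_norm ?heatn_ge0 // ler_wpM2l ?heatn_ge0 //.
    have [r0|r0] := leP r 0; first by rewrite ppow_le0 // !mul0r mulr0 normr0.
    rewrite normrM ger0_norm ?ppow_ge0 // mulrCA ler_wpM2l ?ppow_ge0 //.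
    exact: (tame_heat_diff hf).
  - move=> y /=; under eq_integral do rewrite mulrA EFinM.
    rewrite ge0_integralZl_EFin ?mulr_ge0 ?heatn_ge0 //.
    + by rewrite EK -EFinM lee_fin le_eqVlt; apply/orP; left; apply/eqP; ring.
    + move=> r _; have [r0|r0] := leP r 0; first by rewrite ppow_le0 // mul0r.
      by rewrite lee_fin mulr_ge0 ?ppow_ge0 // le_min ler01 ltW.
    + by apply/measurable_EFinP; apply: measurable_ppowM; exact: measurable_minl.
  - apply: integrable_EFinZl.
    by apply: (integrable_EFin_ge0 (c := 1)); [exact: measurable_heatn1|exact: heatn_ge0|exact: integral_heatn].
transitivity (C * \int[mun]_y \int[mu]_r F (y, r)).
  rewrite -RintegralZl //; last exact: (Rfubini_1 Fi).1.
  apply: eq_Rintegral => y _; rewrite (flap_subord hf) // /subord -/C mulrCA.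
  congr (_ * _); rewrite /F /= RintegralZl //.
  apply: (subord_dominated hs _ _).1; first exact: (measurable_heat_diff hf).
  by move=> r r0; exact: (tame_heat_diff hf).
rewrite (Rfubini Fi) /subord -/C; congr (_ * _); apply: eq_Rintegral => r _.
rewrite /F /=; have [r0|r0] := leP r 0.
  rewrite ppow_le0 // mul0r; under eq_Rintegral do rewrite mul0r mulr0.
  by rewrite Rintegral_cst // mul0r.
under eq_Rintegral do rewrite mulrCA.
have i1 := heat_integrable mf fM x t0.
have i2 := heat_integrable (mrow_heat mf r) (fun z => heat_le mf fM z r0) x t0.
rewrite RintegralZl //; last first.
  rewrite (_ : _ \o _ = (fun v => (heatn t v * f (x + rt v))%:E -
      (heatn t v * heat r f (x + rt v))%:E)%E); first exact: integrableB.
  by apply/funext => v /=; rewrite mulrBr EFinB.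
congr (_ * _); rewrite -(heat_semigroup mf fM) // /heat -RintegralB //.
by apply: eq_Rintegral => y _; rewrite mulrBr.
Qed.

(* [heat 0] is a junk value, the kernel being degenerate. *)
Definition traj (g : 'rV[R]_n -> R) x t : R := if 0 < t then heat t g x else g x.

End Tame2.

(** The forward form: only times from [tau] onwards enter, as befits a semigroup. *)
Definition marchaud s (phi : R -> R) (tau : R) : R :=
  subord s (fun t => phi tau - phi (tau + t)).

Lemma flap_marchaud f M A s x : tame f M A -> 0 <= A -> 0 < s < 1 ->
  flap s f x = marchaud s (traj f x) 0.
Proof.
move=> hf A0 hs; rewrite (flap_subord hf) //; apply: eq_subord => t t0.
by rewrite add0r /traj ltxx t0.
Qed.

Lemma flap_flap_marchaud f M A s s' x : tame f M A -> 0 <= A ->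
  (forall y, tame (sdiff f y) (4 * M) (A * Num.min 1 (sqn y))) ->
  0 < s < 1 -> 0 < s' < 1 ->
  flap s (flap s' f) x = marchaud s (marchaud s' (traj f x)) 0.
Proof.
move=> hf A0 hf2 hs hs'.
rewrite (flap_subord (tame_flap hf A0 hf2 hs')) //; last first.
  by apply: mulr_ge0; rewrite ?subord_min_ge0 // mulr_ge0.
apply: eq_subord => t t0; rewrite add0r; congr (_ - _).
  by rewrite (flap_marchaud _ hf).
rewrite (heat_flap hf) //; apply: eq_subord => r r0.
by rewrite /traj t0 addr_gt0.
Qed.

End FlapReal.

(** * Composition of Marchaud derivatives on the half line *)

Section Beta.
Context (R : realType).
Notation mu := (@lebesgue_measure R).
Implicit Types (a b p q t : R).

Let Be p q t : \bar R := (\int[mu]_b (ppow (q - 1) b * ppow (p - 1) (t - b))%:E)%E.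

Let mB p q t : measurable_fun setT (fun b : R => (ppow (q - 1) b * ppow (p - 1) (t - b))%:E).
Proof.
apply/measurable_EFinP; apply: measurable_ppowM.
by apply: (measurableT_comp (measurable_ppow _)) => //; exact: measurable_funB.
Qed.

(** Homogeneity, by the substitution b = t x; it leaves a single constant to identify. *)
Let Be_scale p q t : (Be p q t = (ppow (p + q - 1) t)%:E * Be p q 1)%E.
Proof.
have [t0|t0] := leP t 0.
  rewrite ppow_le0 // mul0e; apply: integral0_eq => b _.
  have [b0|b0] := leP b 0; first by rewrite ppow_le0 // mul0r.
  by rewrite [X in _ * X]ppow_le0 ?mulr0 // subr_le0 (le_trans t0) // ltW.
have := @ge0_integral_affine R t 0 (fun b => (ppow (q - 1) b * ppow (p - 1) (t - b))%:E)
  (lt0r_neq0 t0) (@mB p q t) _.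
rewrite -/(Be p q t) (gtr0_norm t0) => h.
have {h}-> : (Be p q t = t%:E * \int[mu]_x (ppow (q - 1) (t * x + 0) *
    ppow (p - 1) (t - (t * x + 0)))%:E)%E.
  rewrite h => [|x]; last by rewrite lee_fin mulr_ge0 ?ppow_ge0.
  by rewrite muleA -EFinM mulfV ?gt_eqF // mul1e.
have sc a x : ppow a (t * x) = t `^ a * ppow a x.
  have [x0|x0] := leP x 0; first by rewrite !ppow_le0 ?mulr0 // pmulr_rle0.
  by rewrite !ppowE ?mulr_gt0 // powRM // ltW.
rewrite ppowE // /Be -!ge0_integralZl_EFin ?powR_ge0 ?(ltW t0) //.
- apply: eq_integral => x _; rewrite addr0 -!EFinM; congr EFin.
  rewrite -[X in X - t * x]mulr1 -mulrBr !sc.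
  have -> : t `^ (p + q - 1) = t * t `^ (q - 1) * t `^ (p - 1).
    rewrite -{2}(powRr1 (ltW t0)) -!powRD ?(gt_eqF t0) ?implybT //.
    by congr (_ `^ _); ring.
  ring.
- by move=> x _; rewrite lee_fin mulr_ge0 ?ppow_ge0.
- exact: mB.
- by move=> x _; rewrite lee_fin mulr_ge0 ?ppow_ge0.
- apply/measurable_EFinP; apply: measurable_funM.
    apply: (measurableT_comp (measurable_ppow _)).
    by apply: measurable_funD => //; exact: measurable_funM.
  apply: (measurableT_comp (measurable_ppow _)).
  by apply: measurable_funB => //; apply: measurable_funD => //; exact: measurable_funM.
Qed.

(* The constant is identified by testing the convolution against [exp (- t)],
   whose double integral factors. *)
Lemma beta_conv p q t : 0 < p -> 0 < q ->
  (\int[mu]_b (ppow (q - 1) b * ppow (p - 1) (t - b))%:E =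
   (ppow (p + q - 1) t * (Gamma p * Gamma q / Gamma (p + q)))%:E)%E.
Proof.
move=> p0 q0; rewrite -/(Be p q t) Be_scale.
suff -> : Be p q 1 = (Gamma p * Gamma q / Gamma (p + q))%:E by rewrite EFinM.
have pq0 : 0 < p + q by rewrite addr_gt0.
have Gpq : 0 < Gamma (p + q) by exact: Gamma_gt0.
suff h : (Be p q 1 * (Gamma (p + q))%:E = (Gamma p * Gamma q)%:E)%E.
  rewrite -[LHS]mule1 (_ : 1%E = (Gamma (p + q) * (Gamma (p + q))^-1)%:E).
    by rewrite EFinM muleA h -EFinM.
  by rewrite divff // gt_eqF.
pose F (z : R * R) : R := expR (- (1 * z.1)) * (ppow (q - 1) z.2 * ppow (p - 1) (z.1 - z.2)).
have F0 z : 0 <= F z by rewrite /F mulr_ge0 ?expR_ge0 // mulr_ge0 ?ppow_ge0.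
have mF : measurable_fun setT F.
  apply: measurable_funM.
    apply: (measurableT_comp (@measurable_expR R)).
    by apply: (measurableT_comp (@oppr_measurable R setT)) => //; exact: measurable_funM.
  apply: measurable_funM; first exact: measurableT_comp (measurable_ppow _) measurable_snd.
  by apply: (measurableT_comp (measurable_ppow _)); exact: measurable_funB.
have Be0 u : (0 <= Be p q u)%E.
  by apply: integral_ge0 => b _; rewrite lee_fin mulr_ge0 ?ppow_ge0.
transitivity (\int[mu]_t \int[mu]_b (F (t, b))%:E)%E.
  rewrite -integral_Gamma // muleC -ge0_integralZr //.
  - apply: eq_integral => u _; rewrite /F /=.
    under [RHS]eq_integral do rewrite EFinM.
    rewrite ge0_integralZl_EFin ?expR_ge0 // -/(Be p q u).
    + by rewrite [Be p q u]Be_scale EFinM muleA (muleC (expR _)%:E).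
    + by move=> b _; rewrite lee_fin mulr_ge0 ?ppow_ge0.
    + exact: mB.
  - by apply/measurable_EFinP; exact: measurable_ppow_exp.
  - by move=> u _; rewrite lee_fin mulr_ge0 ?ppow_ge0 ?expR_ge0.
rewrite (@tonelli_EFin _ _ _ _ R mu mu F mF F0).
transitivity (\int[mu]_b ((Gamma p)%:E * (ppow (q - 1) b * expR (- (1 * b)))%:E))%E; last first.
  rewrite ge0_integralZl_EFin ?ltW ?Gamma_gt0 ?integral_Gamma -?EFinM //.
  - by move=> b _; rewrite lee_fin mulr_ge0 ?ppow_ge0 ?expR_ge0.
  - by apply/measurable_EFinP; exact: measurable_ppow_exp.
apply: eq_integral => b _.
have := @ge0_integral_affine R 1 (- b) (fun u => (ppow (p - 1) u * expR (- (1 * u)))%:E) _ _ _.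
rewrite normr1 invr1 mul1e integral_Gamma // => h.
rewrite -h ?oner_neq0 //; last 2 first.
- by apply/measurable_EFinP; exact: measurable_ppow_exp.
- by move=> u; rewrite lee_fin mulr_ge0 ?ppow_ge0 ?expR_ge0.
rewrite muleC -ge0_integralZl_EFin ?mulr_ge0 ?expR_ge0 ?ppow_ge0 ?powR_ge0 //.
- apply: eq_integral => u _; rewrite -EFinM /F /= !mul1r; congr EFin.
  have -> : expR (- u) = expR (- b) * expR (- (u - b)).
    by rewrite -expRD; congr expR; ring.
  ring.
- by move=> u _; rewrite lee_fin mulr_ge0 ?ppow_ge0 ?expR_ge0.
- apply/measurable_EFinP; apply: measurable_funM.
    by apply: (measurableT_comp (measurable_ppow _)); apply: measurable_funD => //; exact: measurable_funM.
  apply: (measurableT_comp (@measurable_expR R)).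
  apply: (measurableT_comp (@oppr_measurable R setT)) => //; apply: measurable_funM => //.
  by apply: measurable_funD => //; exact: measurable_funM.
Qed.

End Beta.

(** * Derivatives on the half line and exponential decay *)

Section HalfLine.
Context (R : realType).
Notation mu := (@lebesgue_measure R).
Implicit Types (a b s t K eps : R) (h psi : R -> R).

(* Only [t > 0] matters for the derivative: in the application the functions are
   constant on [t <= 0]. *)
Definition half_derive (psi psi1 : R -> R) :=
  [/\ continuous psi, continuous psi1 & forall t, 0 < t -> is_derive t 1 psi (psi1 t)].

Lemma half_derive_shift psi psi1 a : 0 <= a -> half_derive psi psi1 ->
  half_derive (fun t => psi (a + t)) (fun t => psi1 (a + t)).
Proof.
move=> a0 [cpsi cpsi1 d]; split.
- move=> t; apply: (@continuous_comp _ _ _ (fun t => a + t) psi); last exact: cpsi.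
  by apply: cvgD; [exact: cvg_cst|exact: cvg_id].
- move=> t; apply: (@continuous_comp _ _ _ (fun t => a + t) psi1); last exact: cpsi1.
  by apply: cvgD; [exact: cvg_cst|exact: cvg_id].
- move=> t t0; have at0 : 0 < a + t by rewrite ltr_wpDl.
  have d1 := d _ at0.
  have := @is_derive1_comp R psi (fun t => a + t) t (psi1 (a + t)) 1 d1 _.
  rewrite mulr1; apply.
  by apply: is_derive_eq; rewrite add0r mulr1.
Qed.

Lemma half_FTC psi psi1 t : half_derive psi psi1 -> 0 <= t ->
  (\int[mu]_(x in `[0%R, t]) (psi1 x)%:E = (psi t - psi 0)%:E)%E.
Proof.
move=> [cpsi cpsi1 d]; rewrite le_eqVlt => /predU1P[<-|t0].
  by rewrite set_itv1 integral_set1 subrr.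
rewrite EFinB; apply: continuous_FTC2 => //.
- exact: continuous_subspaceT.
- split.
  + by move=> x; rewrite in_itv /= => /andP[x0 _]; have [] := d x x0.
  + by apply: cvg_at_right_filter; exact: cpsi.
  + by apply: cvg_at_left_filter; exact: cpsi.
- by move=> x; rewrite in_itv /= => /andP[x0 _]; rewrite derive1E; have [_ ->] := d x x0.
Qed.

Lemma half_FTC_ind psi psi1 t : half_derive psi psi1 -> 0 <= t ->
  \int[mu]_x (psi1 x * ((0 < x) && (x < t))%:R) = psi t - psi 0.
Proof.
move=> hd t0; apply: Rintegral_EFin; rewrite -(half_FTC hd) // integral_indicb.
have mp D : measurable_fun D (fun x => (psi1 x)%:E).
  by apply/measurable_EFinP; apply: measurable_funTS; apply: continuous_measurable_fun; case: hd.
by rewrite -integral_itv_obnd_cbnd // -integral_itv_bndo_bndc // set_itvE.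
Qed.

Lemma half_lipschitz psi psi1 K : half_derive psi psi1 ->
  (forall t, 0 <= t -> `|psi1 t| <= K) ->
  forall a b, 0 <= a -> 0 <= b -> `|psi a - psi b| <= K * `|a - b|.
Proof.
move=> [cpsi cpsi1 d] hK.
suff h a b : 0 <= a -> a < b -> `|psi b - psi a| <= K * `|b - a|.
  move=> a b a0 b0; have [ab|ab|->] := ltgtP a b; last by rewrite !subrr normr0 mulr0.
  - by rewrite distrC (distrC a); exact: h.
  - exact: h.
move=> a0 ab.
have [|c cab ->] := @MVT R psi psi1 a b ab _ (continuous_subspaceT cpsi).
  by move=> x; rewrite in_itv /= => /andP[ax _]; apply: d; exact: le_lt_trans ax.
rewrite normrM ler_wpM2r // hK //.
by move: cab; rewrite in_itv /= => /andP[/ltW ac _]; exact: le_trans ac.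
Qed.

Definition expdec eps K h := forall t, 0 <= t -> `|h t| <= K * expR (- (eps * t)).

Lemma expdec_ub eps K h t : 0 < eps -> 0 <= K -> expdec eps K h -> 0 <= t -> `|h t| <= K.
Proof.
move=> e0 K0 hK t0; apply: le_trans (hK t t0) _.
by rewrite ler_piMr // -expR0 ler_expR oppr_le0 mulr_ge0 // ltW.
Qed.

Lemma expdec_shift eps K h a : 0 < eps -> 0 <= a -> 0 <= K -> expdec eps K h ->
  expdec eps K (fun t => h (a + t)).
Proof.
move=> e0 a0 K0 hK t t0; apply: le_trans (hK _ (addr_ge0 a0 t0)) _.
by rewrite ler_wpM2l // ler_expR lerN2 ler_pM2l // lerDr.
Qed.

Lemma ppow_exp_integrable p c : 0 < p -> 0 < c ->
  mu.-integrable setT (EFin \o (fun t => ppow (p - 1) t * expR (- (c * t)))).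
Proof.
move=> p0 c0; apply: (@integrable_EFin_ge0 _ _ R mu _ _ _ _ (integral_ppow_exp p0 c0)).
  exact: measurable_ppow_exp.
by move=> t; rewrite mulr_ge0 ?ppow_ge0 ?expR_ge0.
Qed.

Lemma ppow_expdec_dominated eps K h p : 0 < p -> 0 < eps ->
  measurable_fun setT h -> expdec eps K h ->
  mu.-integrable setT (EFin \o (fun t => ppow (p - 1) t * h t)).
Proof.
move=> p0 e0 mh hK.
have mg : measurable_fun setT (fun t : R => ppow (p - 1) t * expR (- (eps * t))) by exact: measurable_ppow_exp.
apply: (@Rintegral_dominated _ _ R mu _ (fun t => K * (ppow (p - 1) t * expR (- (eps * t))))
  (K * \int[mu]_t (ppow (p - 1) t * expR (- (eps * t)))) _ _ _ _).1.
- exact: measurable_ppowM.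
- exact: measurable_funM.
- move=> t; have [t0|t0] := leP t 0; first by rewrite ppow_le0 // !mul0r mulr0 normr0.
  by rewrite normrM ger0_norm ?ppow_ge0 // mulrCA ler_wpM2l ?ppow_ge0 // hK // ltW.
- have iI := ppow_exp_integrable p0 e0.
  rewrite -RintegralZl // /Rintegral fineK //; apply: integrable_fin_num => //.
  exact: (integrable_EFinZl K iI).
Qed.

Lemma measurable_and_lt d (T : measurableType d) (f g : T -> R) :
  measurable_fun setT f -> measurable_fun setT g ->
  measurable_fun setT (fun z => ((0 < f z) && (f z < g z))%:R : R).
Proof.
move=> mf mg; apply: measurable_boolr; apply: measurable_and; exact: measurable_fun_ltr.
Qed.

(* Integration by parts against the power weight, written as an exchange of
   integrals. *)
Lemma subord_derive s psi psi1 eps K : 0 < s < 1 -> 0 < eps ->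
  half_derive psi psi1 -> expdec eps K psi1 ->
  subord s (fun t => psi 0 - psi t) =
  - (Gamma (1 - s))^-1 * \int[mu]_a (ppow (1 - s - 1) a * psi1 a).
Proof.
move=> hs e0 hd hK; have /andP[s0 s1] := hs.
have s1' : 0 < 1 - s by rewrite subr_gt0.
have G0 : 0 < Gamma (1 - s) by exact: Gamma_gt0.
have mpsi1 : measurable_fun setT psi1 by apply: continuous_measurable_fun; case: hd.
pose F (z : R * R) : R := psi1 z.1 * (ppow (- s - 1) z.2 * ((0 < z.1) && (z.1 < z.2))%:R).
have mi : measurable_fun setT (fun z : R * R => ppow (- s - 1) z.2 * ((0 < z.1) && (z.1 < z.2))%:R).
  apply: measurable_funM; first exact: measurableT_comp (measurable_ppow _) measurable_snd.
  exact: measurable_and_lt.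
have mF : measurable_fun setT F.
  by apply: measurable_funM => //; exact: measurableT_comp mpsi1 measurable_fst.
have It a : (\int[mu]_t (ppow (- s - 1) t * ((0 < a) && (a < t))%:R)%:E = (ppow (1 - s - 1) a / s)%:E)%E.
  have [a0|a0] := leP a 0.
    by rewrite ppow_le0 // mul0r; apply: integral0_eq => t _; rewrite mulr0.
  rewrite /= integral_ppow_gt // ppowE //; congr ((_ `^ _ / _)%:E); ring.
have K0 : 0 <= K by have := hK 0 (lexx 0); rewrite mulr0 oppr0 expR0 mulr1; exact: le_trans.
have Fi : (mu \x mu)%E.-integrable setT (EFin \o F).
  apply: (@integrable_prod_dominated _ _ _ _ _ mu mu F
    (fun z => K * expR (- (eps * z.1)) * (ppow (- s - 1) z.2 * ((0 < z.1) && (z.1 < z.2))%:R))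
    (fun a => K / s * (ppow (1 - s - 1) a * expR (- (eps * a))))) => //.
  - apply: measurable_funM => //; apply: measurable_funM => //.
    apply: (measurableT_comp (@measurable_expR R)).
    by apply: (measurableT_comp (@oppr_measurable R setT)) => //; exact: measurable_funM.
  - move=> [a t]; rewrite /F /=; have [a0|a0] := leP a 0; first by rewrite !mulr0 normr0.
    have w0 : 0 <= ppow (- s - 1) t * (true && (a < t))%:R.
      exact: mulr_ge0 (ppow_ge0 _ _) (ler0n _ _).
    rewrite normrM (ger0_norm w0); apply: (ler_wpM2r w0).
    by apply: hK; exact: ltW.
  - move=> a /=; under eq_integral do rewrite EFinM.
    rewrite ge0_integralZl_EFin ?mulr_ge0 ?expR_ge0 //.
    + by rewrite It -EFinM lee_fin le_eqVlt; apply/orP; left; apply/eqP; ring.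
    + by move=> t _; rewrite lee_fin mulr_ge0 ?ppow_ge0.
    + by apply/measurable_EFinP; exact: measurableT_comp mi (pair1_measurable a).
  - by apply: integrable_EFinZl; exact: ppow_exp_integrable.
have iP := ppow_expdec_dominated s1' e0 mpsi1 hK.
transitivity (- (s / Gamma (1 - s)) * \int[mu]_t \int[mu]_a F (a, t)).
  rewrite mulNr -mulrN /subord; congr (_ * _).
  rewrite -[RHS]mulN1r -RintegralZl //; last first.
    exact: (Rfubini_1 (integrable_swap Fi)).1.
  apply: eq_Rintegral => t _; have [t0|t0] := leP t 0.
    rewrite ppow_le0 // mul0r /F /=; under eq_Rintegral do rewrite ppow_le0 // mul0r mulr0.
    by rewrite Rintegral_cst // mul0r mulr0.
  under eq_Rintegral do rewrite /F /= mulrCA.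
  rewrite RintegralZl //; first by rewrite (half_FTC_ind hd) ?ltW //; ring.
  apply: (@Rintegral_dominated _ _ R mu _ (fun a => K * ((0 < a) && (a < t))%:R) (K * t) _ _ _ _).1.
  - by apply: measurable_funM => //; exact: measurable_and_lt.
  - by apply: measurable_funM => //; exact: measurable_and_lt.
  - move=> a; have [a0|a0] := leP a 0; first by rewrite !mulr0 normr0.
    rewrite normrM [X in _ * X]ger0_norm // ler_wpM2r //.
    by apply: (expdec_ub e0 K0 hK); exact: ltW.
  - rewrite (@integral_indicb _ _ _ mu (fun a => (0 < a) && (a < t)) (fun=> K)).
    have -> : [set a | (0 < a) && (a < t)] = `]0, t[%classic.
      by apply/seteqP; split => a /=; rewrite in_itv.
    have muI : mu `]0, t[%classic = t%:E by rewrite lebesgue_measure_itv /= lte_fin t0 sube0.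
    by rewrite integral_cst // [X in (_ * X)%E]muI -EFinM.
have e : \int[mu]_a \int[mu]_t F (a, t) = s^-1 * \int[mu]_a (ppow (1 - s - 1) a * psi1 a).
  rewrite -RintegralZl //; apply: eq_Rintegral => a _.
  rewrite /F /= RintegralZl //.
    by rewrite (Rintegral_EFin (It a)); ring.
  apply: (@integrable_EFin_ge0 _ _ R mu _ _ _ _ (It a)).
    exact: measurableT_comp mi (pair1_measurable a).
  by move=> t; rewrite mulr_ge0 ?ppow_ge0.
rewrite -(Rfubini Fi) e mulrA; congr (_ * _); field.
by rewrite !gt_eqF.
Qed.

End HalfLine.

Section ExpDecay.
Context (R : realType).
Notation mu := (@lebesgue_measure R).
Implicit Types (a b s t p q K eps : R) (h : R -> R).

Lemma Rintegral_shift b h : measurable_fun setT h ->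
  mu.-integrable setT (EFin \o h) -> \int[mu]_x h (x + b) = \int[mu]_x h x.
Proof.
move=> /measurable_EFinP mh hi; congr fine.
rewrite [RHS](@integral_image _ _ _ _ _ (fun x : measurableTypeR R => (x + b : measurableTypeR R)) mu mu) //.
  exact: measurable_funD.
move=> A mA; have := @lebesgue_measure_affine R 1 b A (oner_neq0 _) mA.
rewrite normr1 mul1e => e; etransitivity; first exact: e.
by congr (mu _); apply/seteqP; split => x /=; rewrite mul1r.
Qed.

(** The semigroup law of fractional integrals of orders p and q. With t = b + a as variable, Fubini
    leaves the convolution of the two powers, which is [beta_conv]. *)
Lemma riemann_liouville p q h eps K : 0 < p -> 0 < q -> 0 < eps ->
  measurable_fun setT h -> expdec eps K h ->
  \int[mu]_b (ppow (q - 1) b * \int[mu]_a (ppow (p - 1) a * h (b + a))) =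
  Gamma p * Gamma q / Gamma (p + q) * \int[mu]_t (ppow (p + q - 1) t * h t).
Proof.
move=> p0 q0 e0 mh hK.
have pq0 : 0 < p + q by rewrite addr_gt0.
have K0 : 0 <= K by have := hK 0 (lexx 0); rewrite mulr0 oppr0 expR0 mulr1; exact: le_trans.
set c := Gamma p * Gamma q / Gamma (p + q).
pose w (z : R * R) : R := ppow (q - 1) z.2 * ppow (p - 1) (z.1 - z.2).
pose F (z : R * R) : R := h z.1 * w z.
have mw : measurable_fun setT w.
  apply: measurable_funM; first exact: measurableT_comp (measurable_ppow _) measurable_snd.
  by apply: (measurableT_comp (measurable_ppow _)); exact: measurable_funB.
have w0 z : 0 <= w z by exact: mulr_ge0 (ppow_ge0 _ _) (ppow_ge0 _ _).
have wneg t b : t <= 0 -> w (t, b) = 0.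
  move=> t0; rewrite /w /=; have [b0|b0] := leP b 0; first by rewrite ppow_le0 // mul0r.
  by rewrite [X in _ * X]ppow_le0 ?mulr0 // subr_le0 (le_trans t0) // ltW.
have mF : measurable_fun setT F.
  by apply: measurable_funM => //; exact: measurableT_comp mh measurable_fst.
have mwt t : measurable_fun setT (fun b => w (t, b)) by exact: measurableT_comp mw (pair1_measurable t).
have Iw t : (\int[mu]_b (w (t, b))%:E = (ppow (p + q - 1) t * c)%:E)%E by exact: beta_conv.
have Fi : (mu \x mu)%E.-integrable setT (EFin \o F).
  apply: (@integrable_prod_dominated _ _ _ _ _ mu mu F
    (fun z => K * expR (- (eps * z.1)) * w z)
    (fun t => K * c * (ppow (p + q - 1) t * expR (- (eps * t))))) => //.
  - apply: measurable_funM => //; apply: measurable_funM => //.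
    apply: (measurableT_comp (@measurable_expR R)).
    by apply: (measurableT_comp (@oppr_measurable R setT)) => //; exact: measurable_funM.
  - move=> [t b]; rewrite /F; have [t0|t0] := leP t 0; first by rewrite wneg // !mulr0 normr0.
    rewrite normrM (ger0_norm (w0 _)); apply: (ler_wpM2r (w0 _)).
    by apply: hK; exact: ltW.
  - move=> t /=; under eq_integral do rewrite EFinM.
    rewrite ge0_integralZl_EFin ?mulr_ge0 ?expR_ge0 //.
    + by rewrite Iw -EFinM lee_fin le_eqVlt; apply/orP; left; apply/eqP; ring.
    + by move=> b _; rewrite lee_fin w0.
    + by apply/measurable_EFinP; exact: mwt.
  - by apply: integrable_EFinZl; exact: ppow_exp_integrable.
transitivity (\int[mu]_b \int[mu]_t F (t, b)).
  apply: eq_Rintegral => b _; have [b0|b0] := leP b 0.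
    rewrite ppow_le0 // mul0r /F /w /=; under eq_Rintegral do rewrite ppow_le0 // mul0r mulr0.
    by rewrite Rintegral_cst // mul0r.
  have ih : mu.-integrable setT (EFin \o (fun a => ppow (p - 1) a * h (b + a))).
    apply: (ppow_expdec_dominated p0 e0 _ (expdec_shift e0 (ltW b0) K0 hK)).
    exact: measurableT_comp mh (measurable_funD _ _).
  rewrite -RintegralZl // -(Rintegral_shift (- b)); last 2 first.
  - apply: measurable_funM => //; apply: measurable_ppowM.
    exact: measurableT_comp mh (measurable_funD _ _).
  - exact: integrable_EFinZl.
  by apply: eq_Rintegral => t _; rewrite /F /w /= subrKC; ring.
rewrite -(Rfubini Fi) -RintegralZl //; last exact: (ppow_expdec_dominated pq0 e0 mh hK).
apply: eq_Rintegral => t _; rewrite /F /= RintegralZl //.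
  by rewrite (Rintegral_EFin (Iw t)); ring.
apply: (@integrable_EFin_ge0 _ _ R mu _ _ _ _ (Iw t)); [exact: mwt|by move=> b; exact: w0].
Qed.

Variables (phi phi1 phi2 : R -> R) (eps K : R).
Hypotheses (e0 : 0 < eps) (d1 : half_derive phi phi1) (d2 : half_derive phi1 phi2).
Hypotheses (k1 : expdec eps K phi1) (k2 : expdec eps K phi2).

Let K0 : 0 <= K.
Proof. by have := k1 (lexx 0); rewrite mulr0 oppr0 expR0 mulr1; exact: le_trans. Qed.

Let mphi1 : measurable_fun setT phi1.
Proof. by apply: continuous_measurable_fun; case: d2. Qed.

Let mphi2 : measurable_fun setT phi2.
Proof. by apply: continuous_measurable_fun; case: d2. Qed.

Lemma marchaud_derive s tau : 0 < s < 1 -> 0 <= tau ->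
  marchaud s phi tau =
  - (Gamma (1 - s))^-1 * \int[mu]_a (ppow (1 - s - 1) a * phi1 (tau + a)).
Proof.
move=> hs tau0.
rewrite -(subord_derive hs e0 (half_derive_shift tau0 d1) (expdec_shift e0 tau0 K0 k1)).
by rewrite addr0.
Qed.

(** Decay in b and the factor min(1, t) are kept together: the double integral of
    [marchaud_marchaud] converges in b by the one and in t by the other. *)
Let lip b t : 0 <= b -> 0 < t ->
  `|phi1 b - phi1 (b + t)| <= 2 * K * expR (- (eps * b)) * Num.min 1 t.
Proof.
move=> b0 t0; have Ke : 0 <= K * expR (- (eps * b)) by rewrite mulr_ge0 ?expR_ge0.
have ub u : 0 <= u -> `|phi1 (b + u)| <= K * expR (- (eps * b)).
  move=> u0; apply: le_trans (k1 (addr_ge0 b0 u0)) _.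
  by rewrite ler_wpM2l // ler_expR lerN2 ler_pM2l // lerDl.
have ub2 u : 0 <= u -> `|phi2 (b + u)| <= K * expR (- (eps * b)).
  move=> u0; apply: le_trans (k2 (addr_ge0 b0 u0)) _.
  by rewrite ler_wpM2l // ler_expR lerN2 ler_pM2l // lerDl.
rewrite -(mulrA 2 K); set E := K * _ in Ke ub ub2 *.
have [t1|t1] := leP 1 t.
  rewrite mulr1 (le_trans (ler_normB _ _)) // mulr_natl mulr2n.
  apply: lerD; last exact: ub (ltW t0).
  by have := ub 0 (lexx 0); rewrite addr0.
have := half_lipschitz (half_derive_shift b0 d2) ub2 (lexx 0) (ltW t0).
rewrite addr0 sub0r normrN (gtr0_norm t0) => /le_trans; apply.
by have := mulr_ge0 Ke (ltW t0); nra.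
Qed.

(** By [marchaud_derive] the inner derivative is a fractional integral of [phi1]. The outer one is
    moved inside it and acts on [phi1], giving a fractional integral of [phi2], and
    [riemann_liouville] merges the two. *)
Lemma marchaud_marchaud s s' : 0 < s < 1 -> 0 < s' < 1 ->
  marchaud s (marchaud s' phi) 0 =
  (Gamma (1 - s + (1 - s')))^-1 * \int[mu]_t (ppow (1 - s + (1 - s') - 1) t * phi2 t).
Proof.
move=> hs hs'; have /andP[s0 s1] := hs; have /andP[s'0 s'1] := hs'.
have p0 : 0 < 1 - s by rewrite subr_gt0.
have q0 : 0 < 1 - s' by rewrite subr_gt0.
have Gp : 0 < Gamma (1 - s) by exact: Gamma_gt0.
have Gq : 0 < Gamma (1 - s') by exact: Gamma_gt0.
pose F (z : R * R) : R := ppow (1 - s' - 1) z.1 * (ppow (- s - 1) z.2 * (phi1 z.1 - phi1 (z.1 + z.2))).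
have mk : measurable_fun setT (fun z : R * R => ppow (1 - s' - 1) z.1).
  exact: measurableT_comp (measurable_ppow _) measurable_fst.
have mk2 : measurable_fun setT (fun z : R * R => ppow (- s - 1) z.2).
  exact: measurableT_comp (measurable_ppow _) measurable_snd.
have mF : measurable_fun setT F.
  apply: measurable_funM => //; apply: measurable_funM => //.
  apply: measurable_funB; first exact: measurableT_comp mphi1 measurable_fst.
  by apply: (measurableT_comp mphi1); exact: measurable_funD.
pose Km := \int[mu]_r (ppow (- s - 1) r * Num.min 1 r).
have EK : (\int[mu]_r (ppow (- s - 1) r * Num.min 1 r)%:E = Km%:E)%E.
  rewrite /Km /Rintegral fineK //; apply: integrable_fin_num => //.
  exact: ppow_min_integrable.
have Fi : (mu \x mu)%E.-integrable setT (EFin \o F).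
  apply: (@integrable_prod_dominated _ _ _ _ _ mu mu F
    (fun z => 2 * K * (ppow (1 - s' - 1) z.1 * expR (- (eps * z.1))) *
        (ppow (- s - 1) z.2 * Num.min 1 z.2))
    (fun b => 2 * K * Km * (ppow (1 - s' - 1) b * expR (- (eps * b))))) => //.
  - apply: measurable_funM.
      apply: measurable_funM => //; apply: measurable_funM => //.
      apply: (measurableT_comp (@measurable_expR R)).
      by apply: (measurableT_comp (@oppr_measurable R setT)) => //; exact: measurable_funM.
    apply: measurable_funM => //; exact: measurableT_comp (@measurable_minl R) measurable_snd.
  - move=> [b t]; rewrite /F /=.
    have [b0|b0] := leP b 0; first by rewrite ppow_le0 // !mul0r mulr0 mul0r normr0.
    have [t0|t0] := leP t 0; first by rewrite (ppow_le0 _ t0) // !(mul0r, mulr0) normr0.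
    rewrite normrM (ger0_norm (ppow_ge0 _ _)) normrM (ger0_norm (ppow_ge0 _ _)).
    have h := lip (ltW b0) t0.
    have h2 := ler_wpM2l (mulr_ge0 (ppow_ge0 (1 - s' - 1) b) (ppow_ge0 (- s - 1) t)) h.
    rewrite mulrA; apply: le_trans h2 _.
    by rewrite le_eqVlt; apply/orP; left; apply/eqP; ring.
  - move=> b /=; under eq_integral do rewrite EFinM.
    rewrite ge0_integralZl_EFin //.
    + by rewrite EK -EFinM lee_fin le_eqVlt; apply/orP; left; apply/eqP; ring.
    + move=> r _; have [r0|r0] := leP r 0; first by rewrite ppow_le0 // mul0r.
      by rewrite lee_fin mulr_ge0 ?ppow_ge0 // le_min ler01 ltW.
    + by apply/measurable_EFinP; apply: measurable_ppowM; exact: measurable_minl.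
    + apply: mulr_ge0; first by rewrite mulr_ge0.
      exact: mulr_ge0 (ppow_ge0 _ _) (expR_ge0 _).
  - by apply: integrable_EFinZl; exact: ppow_exp_integrable.
have iph b : 0 <= b -> mu.-integrable setT (EFin \o (fun a => ppow (1 - s' - 1) a * phi1 (b + a))).
  move=> b0; apply: (ppow_expdec_dominated q0 e0 _ (expdec_shift e0 b0 K0 k1)).
  exact: measurableT_comp mphi1 (measurable_funD _ _).
transitivity (- (Gamma (1 - s'))^-1 * (s / Gamma (1 - s)) * \int[mu]_t \int[mu]_b F (b, t)).
  rewrite /marchaud [LHS](@eq_subord _ _ _ (fun t => - (Gamma (1 - s'))^-1 *
     \int[mu]_b (ppow (1 - s' - 1) b * (phi1 b - phi1 (b + t))))); last first.
    move=> t t0; rewrite -/(marchaud s' phi 0) -/(marchaud s' phi (0 + t)) add0r.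
    rewrite !marchaud_derive ?(ltW t0) // -mulrBr -RintegralB; [|by []|exact: iph|exact: iph (ltW t0)].
    by congr (_ * _); apply: eq_Rintegral => b _; rewrite add0r (addrC t) mulrBr.
  set J := fun t => \int[mu]_b (ppow (1 - s' - 1) b * (phi1 b - phi1 (b + t))).
  rewrite /subord.
  have -> : \int[mu]_t (ppow (- s - 1) t * (- (Gamma (1 - s'))^-1 * J t)) =
      - (Gamma (1 - s'))^-1 * \int[mu]_t \int[mu]_b F (b, t).
    rewrite -RintegralZl //; last exact: (Rfubini_1 (integrable_swap Fi)).1.
    apply: eq_Rintegral => t _; rewrite mulrCA; congr (_ * _).
    have [t0|t0] := leP t 0.
      rewrite ppow_le0 // mul0r /F /=; under eq_Rintegral do rewrite (ppow_le0 _ t0) mul0r mulr0.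
      by rewrite Rintegral_cst // mul0r.
    rewrite -RintegralZl //; first by apply: eq_Rintegral => b _; rewrite mulrCA.
    have i1 := iph 0 (lexx 0); have i2 := iph t (ltW t0).
    rewrite (_ : _ \o _ = (fun b => (ppow (1 - s' - 1) b * phi1 (0 + b))%:E -
      (ppow (1 - s' - 1) b * phi1 (t + b))%:E)%E); first exact: integrableB.
    by apply/funext => b /=; rewrite mulrBr EFinB add0r (addrC b).
  ring.
pose X b := ppow (1 - s' - 1) b * \int[mu]_a (ppow (1 - s - 1) a * phi2 (b + a)).
(* [subord_derive] for [phi1] shifted by b; dividing by the normalisation s / Gamma(1 - s) of
   [subord] leaves the factor - 1 / s. *)
have eX b : \int[mu]_t F (b, t) = - s^-1 * X b.
  rewrite /X.
  have [b0|b0] := leP b 0.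
    rewrite ppow_le0 // mul0r mulr0 /F /=; under eq_Rintegral do rewrite (ppow_le0 _ b0) mul0r.
    by rewrite Rintegral_cst // mul0r.
  rewrite /F /= RintegralZl //; last first.
    apply: (subord_dominated hs _ (fun t => lip (ltW b0))).1.
    apply: measurable_funB => //; apply: (measurableT_comp mphi1).
    exact: measurable_funD.
  rewrite mulrCA; congr (_ * _).
  have := subord_derive hs e0 (half_derive_shift (ltW b0) d2) (expdec_shift e0 (ltW b0) K0 k2).
  rewrite /subord addr0 => h.
  have s0' : s / Gamma (1 - s) != 0 by rewrite mulf_neq0 ?invr_eq0 ?gt_eqF.
  apply: (mulfI s0'); rewrite h; field.
  by rewrite !gt_eqF.
have iX : mu.-integrable setT (EFin \o X).
  have := integrable_EFinZl (- s) (Rfubini_1 Fi).1.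
  congr (mu.-integrable setT (EFin \o _)); apply/funext => b.
  by rewrite eX mulrA mulrNN mulfV ?mul1r // gt_eqF.
have e : \int[mu]_b \int[mu]_t F (b, t) = - s^-1 * \int[mu]_b X b.
  by rewrite -RintegralZl //; apply: eq_Rintegral => b _; rewrite eX.
rewrite -(Rfubini Fi) e /X (riemann_liouville p0 q0 e0 mphi2 k2).
have Gpq : 0 < Gamma (1 - s + (1 - s')) by rewrite Gamma_gt0 // addr_gt0.
have [g g'] : 0 < Gamma (1 - s) /\ 0 < Gamma (1 - s') by rewrite !Gamma_gt0.
move: (\int[mu]_t (_ * phi2 t)) (Gamma (1 - s)) (Gamma (1 - s')) (Gamma _) g g' Gpq => I x y z.
by move=> x0 y0 z0; field; rewrite !gt_eqF.
Qed.

End ExpDecay.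

Section Dct.
Context d (T : measurableType d) (R : realType) (m : {measure set T -> \bar R}).

Lemma Rintegral_dct (f_ : nat -> T -> R) (f g : T -> R) :
  (forall k, measurable_fun setT (f_ k)) ->
  (forall x, f_ ^~ x @ \oo --> f x) ->
  m.-integrable setT (EFin \o g) -> (forall k x, `|f_ k x| <= g x) ->
  \int[m]_x f_ k x @[k --> \oo] --> \int[m]_x f x.
Proof.
move=> mf fc gi fg.
have mef k : measurable_fun setT (fun x => (f_ k x)%:E) by apply/measurable_EFinP.
have mf' : measurable_fun setT (fun x => (f x)%:E).
  apply/measurable_EFinP; exact: (@measurable_fun_cvg _ _ R setT f_ f).
have [|||fi _ h] := @dominated_convergence _ T R m setT measurableT
  (fun k x => (f_ k x)%:E) (fun x => (f x)%:E) (EFin \o g) mef mf'.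
- by apply: aeW => x _; apply: cvg_EFin; [exact: nearW|exact: fc].
- exact: gi.
- by apply: aeW => x k _; rewrite lee_fin.
apply: fine_cvg; rewrite fineK //.
exact: (integrable_fin_num _ fi).
Qed.

End Dct.

Section MarchaudComp.
Context (R : realType).
Notation mu := (@lebesgue_measure R).
Implicit Types (a b s t p q K M eps : R) (h psi : R -> R).

Lemma subord_cvg s (g_ : nat -> R -> R) (g : R -> R) A : 0 < s < 1 ->
  (forall k, measurable_fun setT (g_ k)) ->
  (forall k t, 0 < t -> `|g_ k t| <= A * Num.min 1 t) ->
  (forall t, 0 < t -> g_ k t @[k --> \oo] --> g t) ->
  subord s (g_ k) @[k --> \oo] --> subord s g.
Proof.
move=> hs mg gA gc; apply: cvgMl_tmp.
apply: (@Rintegral_dct _ _ R mu (fun k t => ppow (- s - 1) t * g_ k t)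
  (fun t => ppow (- s - 1) t * g t) (fun t => A * (ppow (- s - 1) t * Num.min 1 t))).
- by move=> k; exact: measurable_ppowM.
- move=> t; have [t0|t0] := leP t 0.
    by under eq_fun do rewrite ppow_le0 // mul0r; rewrite ppow_le0 // mul0r; exact: cvg_cst.
  by apply: cvgMl_tmp; exact: gc.
- by apply: integrable_EFinZl; exact: ppow_min_integrable.
- move=> k t; have [t0|t0] := leP t 0; first by rewrite ppow_le0 // !mul0r mulr0 normr0.
  by rewrite normrM ger0_norm ?ppow_ge0 // mulrCA ler_wpM2l ?ppow_ge0 // gA.
Qed.

Lemma cvg_expR_natN eps : 0 < eps -> expR (- (eps * k%:R)) @[k --> \oo] --> (0 : R).
Proof.
move=> e0; apply: (cvg_comp (fun k : nat => k%:R) (fun t => expR (- (eps * t))) (@cvgr_idn R)).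
apply: (cvg_comp (fun t => eps * t) (fun t => expR (- t))); last exact: cvgr_expR.
by apply: gt0_cvgMry => //; exact: cvg_id.
Qed.

(** The fundamental theorem of calculus up to infinity. The weight [ppow (1 - 1)] is the indicator
    of the positive half line, written as the kernel of a fractional integral of order one. *)
Lemma half_tail psi psi1 eps K : 0 < eps -> half_derive psi psi1 ->
  expdec eps K psi -> expdec eps K psi1 ->
  \int[mu]_x (ppow (1 - 1) x * psi1 x) = - psi 0.
Proof.
move=> e0 hd k0 k1.
have K0 : 0 <= K by have := k1 0 (lexx 0); rewrite mulr0 oppr0 expR0 mulr1; exact: le_trans.
have mpsi1 : measurable_fun setT psi1 by apply: continuous_measurable_fun; case: hd.
have h1 : \int[mu]_x (psi1 x * ((0 < x) && (x < k%:R))%:R) @[k --> \oo] -->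
    \int[mu]_x (ppow (1 - 1) x * psi1 x).
  apply: (@Rintegral_dct _ _ R mu _ _ (fun t => K * (ppow (1 - 1) t * expR (- (eps * t))))).
  - by move=> k; apply: measurable_funM => //; exact: measurable_and_lt.
  - move=> x; have [x0|x0] := leP x 0.
      by under eq_fun do rewrite mulr0; rewrite ppow_le0 // mul0r; exact: cvg_cst.
    rewrite ppowE // subrr powRr0 mul1r; apply: cvg_near_cst; near=> k.
    rewrite /= (_ : x < k%:R) ?mulr1 //.
    by near: k; exact: nbhs_infty_gtr.
  - by apply: integrable_EFinZl; apply: ppow_exp_integrable.
  - move=> k x; have [x0|x0] := leP x 0; first by rewrite ppow_le0 // !(mulr0, mul0r) normr0.
    rewrite ppowE // subrr powRr0 mul1r normrM [X in _ * X]ger0_norm //=.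
    apply: (@le_trans _ _ (`|psi1 x| * 1)); last by rewrite mulr1 k1 // ltW.
    by rewrite ler_wpM2l // lern1 leq_b1.
have h2 : \int[mu]_x (psi1 x * ((0 < x) && (x < k%:R))%:R) @[k --> \oo] --> - psi 0.
  have -> : (fun k : nat => \int[mu]_x (psi1 x * ((0 < x) && (x < k%:R))%:R)) =
      (fun k => psi k%:R - psi 0) by apply/funext => k; rewrite (half_FTC_ind hd).
  suff : (fun k : nat => psi k%:R - psi 0) @ \oo --> 0 - psi 0 by rewrite sub0r.
  apply: cvgB; last exact: cvg_cst.
  apply/norm_cvg0P.
  apply: (squeeze_cvgr _ (cvg_cst 0)).
  - by near=> k; rewrite normr_ge0 /=; exact: (k0 k%:R (ler0n _ k)).
  - rewrite -[X in _ --> X](mulr0 K); apply: cvgMl_tmp; exact: cvg_expR_natN.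
exact: (cvg_unique _ h1 h2).
Unshelve. all: by end_near. Qed.

Lemma Gamma1 : Gamma (1 : R) = 1.
Proof.
apply: EFin_inj; rewrite -integral_Gamma //.
have := @integral_exp_gt R 1 0 ltr01; rewrite mulr0 oppr0 expR0 => <-.
apply: eq_integral => t _.
by rewrite /ppow subrr powRr0 !mul1r mulrC.
Qed.

Section Regular.
Variables (phi phi1 phi2 : R -> R) (eps K : R).
Hypotheses (e0 : 0 < eps) (d1 : half_derive phi phi1) (d2 : half_derive phi1 phi2).
Hypotheses (k1 : expdec eps K phi1) (k2 : expdec eps K phi2).

Let K0 : 0 <= K.
Proof. by have := k1 (lexx 0); rewrite mulr0 oppr0 expR0 mulr1; exact: le_trans. Qed.

(** The weight in [marchaud_marchaud] has exponent 1 - s - s' = 0, so what remains is the integral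
    of [phi2] over the half line. *)
Lemma marchaud_comp_exp1 s s' : 0 < s < 1 -> 0 < s' < 1 -> s + s' = 1 ->
  marchaud s (marchaud s' phi) 0 = - phi1 0.
Proof.
move=> hs hs' ss'; rewrite (marchaud_marchaud e0 d1 d2 k1 k2) //.
have -> : 1 - s + (1 - s') = 1 by rewrite -ss'; ring.
by rewrite (half_tail e0 d2 k1 k2) Gamma1 invr1 mul1r.
Qed.

(** On the right-hand side [phi1] is minus the tail integral of [phi2], a fractional integral of
    order one. [riemann_liouville] then brings both sides to the integral of [phi2] against
    t^(1-s-s'). *)
Lemma marchaud_comp_exp s s' : 0 < s < 1 -> 0 < s' < 1 -> s + s' < 1 ->
  marchaud s (marchaud s' phi) 0 = marchaud (s + s') phi 0.
Proof.
move=> hs hs' ss'; have /andP[s0 s1] := hs; have /andP[s'0 s'1] := hs'.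
have hss : 0 < s + s' < 1 by rewrite addr_gt0.
have p0 : 0 < 1 - (s + s') by rewrite subr_gt0.
have G0 : 0 < Gamma (1 - (s + s')) by exact: Gamma_gt0.
have mphi2 : measurable_fun setT phi2 by apply: continuous_measurable_fun; case: d2.
rewrite (marchaud_marchaud e0 d1 d2 k1 k2) // (marchaud_derive e0 d1 k1) //.
have -> : \int[mu]_a (ppow (1 - (s + s') - 1) a * phi1 (0 + a)) =
   - \int[mu]_a (ppow (1 - (s + s') - 1) a * \int[mu]_x (ppow (1 - 1) x * phi2 (a + x))).
  have mphi1 : measurable_fun setT phi1 by apply: continuous_measurable_fun; case: d2.
  have iph := ppow_expdec_dominated p0 e0 mphi1 k1.
  have h a : 0 < a -> \int[mu]_x (ppow (1 - 1) x * phi2 (a + x)) = - phi1 a.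
    move=> a0; rewrite (half_tail e0 (half_derive_shift (ltW a0) d2)
      (expdec_shift e0 (ltW a0) K0 k1) (expdec_shift e0 (ltW a0) K0 k2)).
    by rewrite addr0.
  rewrite (_ : \int[mu]_a (_ * \int[mu]_x _) =
      -1 * \int[mu]_a (ppow (1 - (s + s') - 1) a * phi1 a)).
    by rewrite mulN1r opprK; apply: eq_Rintegral => a _; rewrite add0r.
  rewrite -RintegralZl //; apply: eq_Rintegral => a _.
  have [a0|a0] := leP a 0; first by rewrite ppow_le0 // !mul0r mulr0.
  by rewrite h // mulN1r mulrN.
rewrite (riemann_liouville ltr01 p0 e0 mphi2 k2) Gamma1.
have -> : 1 - s + (1 - s') = 1 + (1 - (s + s')) by ring.
have G2 : 0 < Gamma (1 + (1 - (s + s'))) by rewrite Gamma_gt0 // addr_gt0.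
by set I := \int[mu]_t _; field; rewrite !gt_eqF.
Qed.

End Regular.
End MarchaudComp.

(** * From exponential decay to bounded functions *)

Section Regularisation.
Context (R : realType).
Notation mu := (@lebesgue_measure R).
Implicit Types (a b r s t K M eps : R) (psi : R -> R).

Definition damp eps psi t : R := expR (- (eps * t)) * psi t.

Lemma half_derive_damp eps psi (psi1 : R -> R) : half_derive psi psi1 ->
  half_derive (damp eps psi) (damp eps (fun t => psi1 t - eps * psi t)).
Proof.
move=> [c c1 d].
have cE : continuous (fun t : R => expR (- (eps * t))).
  move=> t; apply: (@continuous_comp _ _ _ (fun t : R => - (eps * t)) expR); last exact: continuous_expR.
  by apply: cvgN; apply: cvgMl_tmp; exact: cvg_id.
split.
- by move=> t; apply: cvgM; [exact: cE|exact: c].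
- move=> t; apply: cvgM; first exact: cE.
  by apply: cvgB; [exact: c1|apply: cvgMl_tmp; exact: c].
- move=> t t0; rewrite /damp; have := d t t0 => ?.
  apply: is_derive_eq; rewrite /GRing.scale /=; ring.
Qed.

Lemma half_derive_linear psi (psi1 phi phi1 : R -> R) c : half_derive psi psi1 ->
  half_derive phi phi1 ->
  half_derive (fun t => psi t - c * phi t) (fun t => psi1 t - c * phi1 t).
Proof.
move=> [a1 a2 a3] [b1 b2 b3]; split.
- by move=> t; apply: cvgB; [exact: a1|apply: cvgMl_tmp; exact: b1].
- by move=> t; apply: cvgB; [exact: a2|apply: cvgMl_tmp; exact: b2].
- move=> t t0; have := a3 t t0 => ?; have := b3 t t0 => ?.
  apply: is_derive_eq; rewrite /GRing.scale /=; ring.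
Qed.

Lemma damp_expdec eps psi M : (forall t, 0 <= t -> `|psi t| <= M) ->
  expdec eps M (damp eps psi).
Proof.
move=> h t t0; rewrite /damp normrM ger0_norm ?expR_ge0 // mulrC.
by rewrite ler_wpM2r ?expR_ge0 // h.
Qed.

Lemma damp_cvg psi t : damp k.+1%:R^-1 psi t @[k --> \oo] --> psi t.
Proof.
rewrite /damp -[X in _ --> X]mul1r; apply: cvgMr_tmp.
have h0 : - (k.+1%:R^-1 * t) @[k --> \oo] --> - (0 * t).
  by apply: cvgN; apply: cvgMr_tmp; exact: cvg_harmonic.
rewrite mul0r oppr0 in h0.
have h1 := cvg_comp _ _ h0 (@continuous_expR R 0).
by rewrite expR0 in h1.
Qed.

Section DoubleDifference.
Variables (phi phi1 phi2 : R -> R) (K : R).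
Hypotheses (d1 : half_derive phi phi1) (d2 : half_derive phi1 phi2).
Hypotheses (b0 : forall t, 0 <= t -> `|phi t| <= K)
  (b1 : forall t, 0 <= t -> `|phi1 t| <= K) (b2 : forall t, 0 <= t -> `|phi2 t| <= K).

Let K0 : 0 <= K. Proof. exact: le_trans (b0 (lexx 0)). Qed.

Lemma diff_le_min a t : 0 <= a -> 0 < t -> `|phi a - phi (a + t)| <= 2 * K * Num.min 1 t.
Proof.
move=> a0 t0; have at0 : 0 <= a + t by rewrite addr_ge0 // ltW.
have [t1|t1] := leP 1 t.
  rewrite mulr1 (le_trans (ler_normB _ _)) // mulr_natl mulr2n.
  by apply: lerD; exact: b0.
have := half_lipschitz d1 b1 a0 at0.
rewrite opprD addNKr normrN (gtr0_norm t0) => /le_trans; apply.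
by have := mulr_ge0 K0 (ltW t0); nra.
Qed.

(** One factor for each time step. If one of the steps is at least 1, two simple differences in the
    other suffice. If both are small, r -> phi(r) - phi(t + r) has derivative at most K t by the
    bound on [phi2]. The factor in t bounds increments of the inner Marchaud derivative. *)
Lemma ddiff_le_min t r : 0 < t -> 0 < r ->
  `|(phi 0 - phi (0 + r)) - (phi t - phi (t + r))| <= 4 * K * Num.min 1 t * Num.min 1 r.
Proof.
move=> t0 r0; have t0' := ltW t0; have r0' := ltW r0.
have h1 := diff_le_min (lexx 0) r0; have h2 := diff_le_min t0' r0.
have h3 := diff_le_min (lexx 0) t0; have h4 := diff_le_min r0' t0.
rewrite add0r in h1; rewrite add0r in h3; rewrite add0r.
have [t1|t1] := leP 1 t.
  rewrite mulr1; apply: le_trans (ler_normB _ _) _.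
  apply: le_trans (lerD h1 h2) _.
  by rewrite le_eqVlt; apply/orP; left; apply/eqP; ring.
have [r1|r1] := leP 1 r.
  rewrite mulr1; have -> : phi 0 - phi r - (phi t - phi (t + r)) =
    (phi 0 - phi t) - (phi r - phi (r + t)) by rewrite (addrC t); ring.
  rewrite (min_r (ltW t1)) in h3 h4.
  apply: le_trans (ler_normB _ _) _; apply: le_trans (lerD h3 h4) _.
  by rewrite le_eqVlt; apply/orP; left; apply/eqP; ring.
have hd : half_derive (fun x => phi x - 1 * phi (t + x)) (fun x => phi1 x - 1 * phi1 (t + x)).
  by apply: half_derive_linear => //; exact: half_derive_shift.
have hK x : 0 <= x -> `|phi1 x - 1 * phi1 (t + x)| <= K * t.
  move=> x0; rewrite mul1r.
  have := half_lipschitz d2 b2 x0 (addr_ge0 t0' x0).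
  by rewrite opprD addrCA subrr addr0 normrN (gtr0_norm t0).
have := half_lipschitz hd hK (lexx 0) r0'.
rewrite !mul1r addr0 sub0r normrN (gtr0_norm r0) => h.
have -> : phi 0 - phi r - (phi t - phi (t + r)) = phi 0 - phi t - (phi r - phi (t + r)) by ring.
apply: le_trans h _.
by have := mulr_ge0 (mulr_ge0 K0 t0') r0'; nra.
Qed.

Lemma marchaudB s t : 0 < s < 1 -> 0 < t ->
  marchaud s phi 0 - marchaud s phi t =
    subord s (fun r => (phi 0 - phi (0 + r)) - (phi t - phi (t + r))) /\
  `|marchaud s phi 0 - marchaud s phi t| <= 4 * K * subord_min s * Num.min 1 t.
Proof.
move=> hs t0.
have mphi : measurable_fun setT phi by apply: continuous_measurable_fun; case: d1.
have md a : measurable_fun setT (fun r => phi a - phi (a + r)).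
  by apply: measurable_funB => //; apply: (measurableT_comp mphi); exact: measurable_funD.
have e : marchaud s phi 0 - marchaud s phi t =
    subord s (fun r => (phi 0 - phi (0 + r)) - (phi t - phi (t + r))).
  rewrite (subordB hs (md 0) (md t) (A1 := 2 * K) (A2 := 2 * K)) // => r r0.
    exact: diff_le_min.
  by apply: diff_le_min => //; exact: ltW.
split => //; rewrite e.
have [|r r0|_ h] := @subord_dominated R s (fun r => (phi 0 - phi (0 + r)) - (phi t - phi (t + r)))
  (4 * K * Num.min 1 t) hs.
- exact: measurable_funB.
- exact: ddiff_le_min.
- apply: le_trans h _.
  by rewrite le_eqVlt; apply/orP; left; apply/eqP; ring.
Qed.

Lemma measurable_marchaud s : measurable_fun setT (marchaud s phi).
Proof.
have mphi : measurable_fun setT phi by apply: continuous_measurable_fun; case: d1.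
apply: measurable_funM => //.
apply: (@measurable_Rintegral _ _ _ _ R mu (fun z : R * R =>
  ppow (- s - 1) z.2 * (phi z.1 - phi (z.1 + z.2)))).
apply: measurable_funM; first exact: measurableT_comp (measurable_ppow _) measurable_snd.
apply: measurable_funB; first exact: measurableT_comp mphi measurable_fst.
by apply: (measurableT_comp mphi); exact: measurable_funD.
Qed.

End DoubleDifference.

Section Limit.
Variables (phi phi1 phi2 : R -> R) (M : R).
Hypotheses (d1 : half_derive phi phi1) (d2 : half_derive phi1 phi2).
Hypotheses (b0 : forall t, 0 <= t -> `|phi t| <= M)
  (b1 : forall t, 0 <= t -> `|phi1 t| <= M) (b2 : forall t, 0 <= t -> `|phi2 t| <= M).

Let M0 : 0 <= M. Proof. exact: le_trans (b0 (lexx 0)). Qed.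

Let e_ (k : nat) : R := k.+1%:R^-1.
Let p_ k := damp (e_ k) phi.
Let p1 k := damp (e_ k) (fun t => phi1 t - e_ k * phi t).
Let p2 k := damp (e_ k) (fun t => (phi2 t - e_ k * phi1 t) - e_ k * (phi1 t - e_ k * phi t)).

Let e0 k : 0 < e_ k. Proof. by rewrite invr_gt0. Qed.
Let e1 k : e_ k <= 1. Proof. by rewrite invf_le1 // ler1n. Qed.

Let dp k : half_derive (p_ k) (p1 k).
Proof. exact: half_derive_damp. Qed.

Let dp1 k : half_derive (p1 k) (p2 k).
Proof. by apply: half_derive_damp; exact: half_derive_linear. Qed.

Let eM k (x y A : R) : `|x| <= M -> `|y| <= A -> 0 <= A -> `|x - e_ k * y| <= M + A.
Proof.
move=> hx hy A0; apply: le_trans (ler_normB _ _) _; apply: lerD => //.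
rewrite normrM (gtr0_norm (e0 k)); apply: le_trans hy.
by rewrite ler_piMl.
Qed.

(** The constant is dictated by [p2 k], a sum of four terms each at most M since [e_ k <= 1]. Only
    the rate of decay depends on k, so the limit can be dominated uniformly. *)
Let kp k : expdec (e_ k) (4 * M) (p_ k).
Proof. by apply: damp_expdec => t t0; apply: le_trans (b0 t0) _; have := M0; lra. Qed.

Let kp1 k : expdec (e_ k) (4 * M) (p1 k).
Proof.
apply: damp_expdec => t t0; apply: le_trans (eM k (b1 t0) (b0 t0) M0) _; have := M0; lra.
Qed.

Let kp2 k : expdec (e_ k) (4 * M) (p2 k).
Proof.
apply: damp_expdec => t t0; apply: le_trans (ler_normB _ _) _.
apply: (@le_trans _ _ ((M + M) + (M + M))); last by have := M0; lra.
apply: lerD; first exact: eM (b2 t0) (b1 t0) M0.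
rewrite normrM (gtr0_norm (e0 k)); apply: le_trans (eM k (b1 t0) (b0 t0) M0).
by rewrite ler_piMl.
Qed.

Let ub k (psi : R -> R) : expdec (e_ k) (4 * M) psi -> forall t, 0 <= t -> `|psi t| <= 4 * M.
Proof. by move=> h t t0; apply: (expdec_ub (e0 k) _ h t0); rewrite mulr_ge0. Qed.

Let marchaud_cvg s tau : 0 < s < 1 -> 0 <= tau ->
  marchaud s (p_ k) tau @[k --> \oo] --> marchaud s phi tau.
Proof.
move=> hs tau0; apply: (@subord_cvg R s (fun k t => p_ k tau - p_ k (tau + t)) _ (2 * (4 * M))) => //.
- move=> k; have mp : measurable_fun setT (p_ k) by apply: continuous_measurable_fun; case: (dp k).
  by apply: measurable_funB => //; apply: (measurableT_comp mp); exact: measurable_funD.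
- by move=> k t t0; apply: (diff_le_min (dp k) (ub (kp k)) (ub (kp1 k))).
- by move=> t t0; apply: cvgB; exact: damp_cvg.
Qed.

(** The inner derivative converges at each time by [marchaud_cvg]; the outer integral is dominated
    by [marchaudB], whose bound involves 4 M and no decay rate. *)
Let marchaud2_cvg s s' : 0 < s < 1 -> 0 < s' < 1 ->
  marchaud s (marchaud s' (p_ k)) 0 @[k --> \oo] --> marchaud s (marchaud s' phi) 0.
Proof.
move=> hs hs'; apply: (@subord_cvg R s (fun k t => marchaud s' (p_ k) 0 - marchaud s' (p_ k) (0 + t)) _
  (4 * (4 * M) * subord_min s')) => //.
- move=> k; apply: measurable_funB => //.
  apply: (measurableT_comp (measurable_marchaud (dp k) s')); exact: measurable_funD.
- move=> k t t0; rewrite add0r.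
  exact: (marchaudB (dp k) (dp1 k) (ub (kp k)) (ub (kp1 k)) (ub (kp2 k)) hs' t0).2.
- by move=> t t0; apply: cvgB; apply: marchaud_cvg => //; rewrite add0r ltW.
Qed.

Lemma marchaud_comp s s' : 0 < s < 1 -> 0 < s' < 1 -> s + s' < 1 ->
  marchaud s (marchaud s' phi) 0 = marchaud (s + s') phi 0.
Proof.
move=> hs hs' ss'; apply: (cvg_unique _ (marchaud2_cvg hs hs')) => //.
have -> : (fun k => marchaud s (marchaud s' (p_ k)) 0) = (fun k => marchaud (s + s') (p_ k) 0).
  by apply/funext => k; exact: (marchaud_comp_exp (e0 k) (dp k) (dp1 k) (kp1 k) (kp2 k)).
apply: marchaud_cvg => //; move: hs hs' => /andP[s0 _] /andP[s'0 _].
by rewrite addr_gt0.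
Qed.

Lemma marchaud_comp1 s s' : 0 < s < 1 -> 0 < s' < 1 -> s + s' = 1 ->
  marchaud s (marchaud s' phi) 0 = - phi1 0.
Proof.
move=> hs hs' ss'; apply: (cvg_unique _ (marchaud2_cvg hs hs')) => //.
have -> : (fun k => marchaud s (marchaud s' (p_ k)) 0) = (fun k => - p1 k 0).
  by apply/funext => k; exact: (marchaud_comp_exp1 (e0 k) (dp k) (dp1 k) (kp1 k) (kp2 k)).
apply: cvgN; rewrite /p1 /damp.
under eq_fun do rewrite mulr0 oppr0 expR0 mul1r.
suff : (fun k : nat => phi1 0 - k.+1%:R^-1 * phi 0) @ \oo --> phi1 0 - 0 * phi 0.
  by rewrite mul0r subr0.
apply: cvgB; first exact: cvg_cst.
apply: cvgMr_tmp; exact: cvg_harmonic.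
Qed.

End Limit.
End Regularisation.

(** * Smooth functions with bounded derivatives *)

Section OneDim.
Context (R : realType).

Lemma is_derive_quadratic (h : R -> R) (t d C delta : R) : 0 < delta ->
  (forall e, `|e| < delta -> `|h (t + e) - h t - e * d| <= C * e ^+ 2) ->
  is_derive t 1 h d.
Proof.
move=> d0 hC.
have C0 : 0 <= C.
  have /hC : `|delta / 2| < delta.
    by rewrite gtr0_norm ?divr_gt0 // ltr_pdivrMr // ltr_pMr // ltr1n.
  move/(le_trans (normr_ge0 _)); rewrite pmulr_lge0 // exprn_gt0 // divr_gt0 //.
have hc : (fun e => e^-1 *: ((h \o shift t) (e *: 1) - h t)) @ 0^' --> d.
  apply/cvgrPdist_le => eps eps0; near=> e.
  have e0 : e != 0 by near: e; exact: nbhs_dnbhs_neq.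
  have e1 : `|e| < delta.
    near: e; apply: dnbhs0_lt => //.
  have e2 : `|e| < eps / (C + 1).
    near: e; apply: dnbhs0_lt; rewrite divr_gt0 // ltr_wpDl //.
  rewrite /= (_ : e *: 1 = e); last exact: mulr1.
  rewrite /GRing.scale /=.
  have -> : d - e^-1 * (h (e + t) - h t) = - e^-1 * (h (t + e) - h t - e * d).
    by rewrite (addrC e); field.
  rewrite normrM normrN normfV mulrC ler_pdivrMr ?normr_gt0 //.
  apply: le_trans (hC e e1) _; rewrite -real_normK ?num_real // expr2 mulrA.
  rewrite ler_wpM2r // ltW //.
  rewrite ltr_pdivlMr in e2; last by rewrite ltr_wpDl.
  by apply: le_lt_trans e2; have := normr_ge0 e; nra.
have hd : derivable h t 1 by apply/cvg_ex; exists d.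
by split => //; exact: cvg_lim hc.
Unshelve. all: by end_near. Qed.

(** The mean value theorem is applied twice, hence the constant B rather than B / 2. *)
Lemma taylor2_le (k k1 k2 : R -> R) (B : R) :
  (forall t : R, is_derive t 1 k (k1 t)) -> (forall t : R, is_derive t 1 k1 (k2 t)) ->
  k 0 = 0 -> k1 0 = 0 -> (forall t, 0 <= t <= 1 -> `|k2 t| <= B) -> `|k 1| <= B.
Proof.
move=> d1 d2 k00 k10 k2B.
have c1 : continuous k.
  by move=> t; apply: differentiable_continuous; apply/derivable1_diffP; have [] := d1 t.
have c2 : continuous k1.
  by move=> t; apply: differentiable_continuous; apply/derivable1_diffP; have [] := d2 t.
have [c + kE] := @MVT R k k1 0 1 ltr01 (fun x _ => d1 x) (continuous_subspaceT c1).
rewrite in_itv /= => /andP[c0 c1'].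
rewrite k00 !subr0 mulr1 in kE; rewrite kE.
have [b + k1E] := @MVT R k1 k2 0 c c0 (fun x _ => d2 x) (continuous_subspaceT c2).
rewrite in_itv /= => /andP[b0 bc].
rewrite k10 !subr0 in k1E; rewrite k1E normrM (gtr0_norm c0).
apply: (@le_trans _ _ `|k2 b|); first by rewrite ler_piMr // ltW.
by apply: k2B; rewrite (ltW b0) /= ltW // (lt_trans bc).
Qed.

Lemma is_derive_sub_linear (a b : R -> R) (da db c r : R) :
  is_derive r 1 a da -> is_derive r 1 b db ->
  is_derive r 1 (fun t => a t - b t - 2 * t * c) (da - db - 2 * c).
Proof.
by move=> ha hb; apply: is_derive_eq; rewrite /GRing.scale /=; ring.
Qed.

End OneDim.

Section Csmooth.
Context (R : realType) (n : nat).
Notation rV := ('rV[R]_n).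
Notation e_ i := (@delta_mx R 1 n 0 i).
Implicit Types (f g : rV -> R) (x y z a : rV) (i j k : 'I_n) (l : seq 'I_n).

Definition pd k f x : R := 'D_(e_ k) f x.

Definition pds l f := foldr pd f l.

(** All derivatives exist, are continuous and bounded. The class is stable under [pd], translations
    and linear combinations, hence under the Laplacian and [sdiff]. *)
Definition csmooth f := forall l,
  [/\ continuous (pds l f), forall x k, derivable (pds l f) x (e_ k) &
      exists M : R, forall x, `|pds l f x| <= M].

Lemma csmooth_continuous f : csmooth f -> continuous f.
Proof. by move=> /(_ [::]) []. Qed.

Lemma csmooth_bounded f : csmooth f -> exists M, forall x, `|f x| <= M.
Proof. by move=> /(_ [::]) []. Qed.

Lemma csmooth_pd k f : csmooth f -> csmooth (pd k f).
Proof.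
move=> h l; have := h (rcons l k).
by rewrite /pds -cats1 foldr_cat.
Qed.

Lemma pds_lin l f g c : csmooth f -> csmooth g ->
  pds l (fun x => f x + c * g x) = fun x => pds l f x + c * pds l g x.
Proof.
move=> hf hg; elim: l => //= k l ->; apply/funext => x.
have [_ df _] := hf l; have [_ dg _] := hg l.
rewrite /pd (_ : (fun _ => _) = pds l f + c \*: pds l g) //.
rewrite deriveD //; last exact: derivableZ.
by rewrite deriveZ.
Qed.

Lemma csmooth_lin f g c : csmooth f -> csmooth g -> csmooth (fun x => f x + c * g x).
Proof.
move=> hf hg l; rewrite pds_lin //.
have [cf df [Mf bf]] := hf l; have [cg dg [Mg bg]] := hg l; split.
- move=> x; rewrite (_ : (fun _ => _) = pds l f + (cst c : _ -> R) * pds l g) //.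
  apply: continuousD; first exact: cf.
  by apply: continuousM; [exact: cst_continuous|exact: cg].
- move=> x k; rewrite (_ : (fun _ => _) = pds l f + c \*: pds l g) //.
  by apply: derivableD => //; exact: derivableZ.
- exists (Mf + `|c| * Mg) => x; apply: le_trans (ler_normD _ _) _.
  by apply: lerD => //; rewrite normrM ler_wpM2l.
Qed.

Lemma pd_lin k f g c : csmooth f -> csmooth g ->
  pd k (fun x => f x + c * g x) = fun x => pd k f x + c * pd k g x.
Proof. by move=> hf hg; exact: (pds_lin [:: k]). Qed.

Lemma csmooth0 : csmooth (fun=> 0).
Proof.
have e l : pds l (fun=> 0) = fun=> 0.
  by elim: l => //= k l ->; apply/funext => x; rewrite /pd derive_cst.
move=> l; rewrite e; split.
- exact: cst_continuous.
- by move=> x k; exact: derivable_cst.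
- by exists 0 => x; rewrite normr0.
Qed.

Lemma csmooth_sum (I : Type) (r : seq I) (c : I -> R) (F : I -> rV -> R) :
  (forall u, csmooth (F u)) -> csmooth (fun x => \sum_(u <- r) c u * F u x).
Proof.
move=> hF; elim: r => [|u r IH].
  by under eq_fun do rewrite big_nil; exact: csmooth0.
under eq_fun do rewrite big_cons addrC.
exact: csmooth_lin.
Qed.

Lemma pd_sum (I : Type) (r : seq I) (c : I -> R) (F : I -> rV -> R) k :
  (forall u, csmooth (F u)) ->
  pd k (fun x => \sum_(u <- r) c u * F u x) = fun x => \sum_(u <- r) c u * pd k (F u) x.
Proof.
move=> hF; elim: r => [|u r IH].
  under eq_fun do rewrite big_nil; under [RHS]eq_fun do rewrite big_nil.
  by apply/funext => x; rewrite /pd derive_cst.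
under eq_fun do rewrite big_cons addrC; under [RHS]eq_fun do rewrite big_cons addrC.
by rewrite pd_lin ?IH //; exact: csmooth_sum.
Qed.

Lemma pd_shift k f a : pd k (fun x => f (x + a)) = fun x => pd k f (x + a).
Proof.
apply/funext => x; rewrite /pd /derive /=.
by under eq_fun do rewrite /= -addrA.
Qed.

Lemma csmooth_shift f a : csmooth f -> csmooth (fun x => f (x + a)).
Proof.
have e l : pds l (fun x => f (x + a)) = fun x => pds l f (x + a).
  by elim: l => //= k l ->; rewrite pd_shift.
move=> hf l; rewrite e; have [cf df [M bf]] := hf l; split.
- move=> x; apply: (@continuous_comp _ _ _ (fun x => x + a) (pds l f)); last exact: cf.
  by apply: (@continuousD _ _ _ id (cst a)); [exact: cvg_id|exact: cst_continuous].
- move=> x k; have := df (x + a) k; rewrite /derivable /=.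
  by under [in X in _ -> X]eq_fun do rewrite -addrA.
- by exists M.
Qed.

Lemma axis_derive f a k (th : R) : csmooth f ->
  is_derive th 1 (fun r : R => f (a + r *: e_ k)) (pd k f (a + th *: e_ k)).
Proof.
move=> hf.
have e : (fun h : R => h^-1 *: (((fun r : R => f (a + r *: e_ k)) \o shift th) (h *: 1) - f (a + th *: e_ k)))
  = (fun h : R => h^-1 *: ((f \o shift (a + th *: e_ k)) (h *: e_ k) - f (a + th *: e_ k))).
  apply/funext => h; rewrite /= [h *: 1]mulr1 scalerDl; congr (_ *: (f _ - _)).
  by rewrite /shift /= addrCA.
have [_ dd _] := hf [::]; have d := dd (a + th *: e_ k) k; rewrite /= in d.
split; first by rewrite /derivable e.
by rewrite /derive e.
Qed.

Lemma axis_mvt f a k (c : R) : csmooth f -> exists2 b : R, `|b| <= `|c| &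
  f (a + c *: e_ k) - f a = c * pd k f (a + b *: e_ k).
Proof.
move=> hf; set g := fun r : R => f (a + r *: e_ k).
have d (r : R) : is_derive r 1 g (pd k f (a + r *: e_ k)) by exact: axis_derive.
have cg : continuous g.
  by move=> t; apply: differentiable_continuous; apply/derivable1_diffP; have [] := d t.
have g0 : g 0 = f a by rewrite /g scale0r addr0.
have [c0|c0|->] := ltgtP c 0.
- have [b + bE] := @MVT R g _ c 0 c0 (fun r _ => d r) (continuous_subspaceT cg).
  rewrite in_itv /= => /andP[b1 b2]; exists b; first by rewrite !ltr0_norm // lerN2 ltW.
  by rewrite -g0 -opprB -/(g c) bE; ring.
- have [b + bE] := @MVT R g _ 0 c c0 (fun r _ => d r) (continuous_subspaceT cg).
  rewrite in_itv /= => /andP[b1 b2]; exists b; first by rewrite !gtr0_norm // ltW.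
  by rewrite -g0 -/(g c) bE; ring.
- by exists 0 => //; rewrite scale0r addr0 subrr mul0r.
Qed.

(** [csmooth] speaks of derivatives along the axes, so x and x + z are joined by a path along the
    axes with one mean value on each segment; [trunc m] is the displacement after m segments. *)
Lemma path_mvt f x z : csmooth f -> exists xi : 'I_n -> rV,
  (forall i j, `|xi i 0 j| <= `|z 0 j|) /\
  f (x + z) - f x = \sum_(i < n) z 0 i * pd i f (x + xi i).
Proof.
move=> hf; pose trunc m : rV := \row_i (if (i < m)%N then z 0 i else 0).
have truncS i : trunc i.+1 = trunc i + z 0 i *: e_ i.
  apply/rowP => j; rewrite !mxE eqxx /= ltnS leq_eqVlt (inj_eq (@ord_inj n)).
  have [->|ij] := eqVneq j i; first by rewrite ltnn mulr1 add0r.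
  by rewrite /= mulr0 addr0.
have hex (i : 'I_n) : exists b : R, `|b| <= `|z 0 i| /\
    f (x + trunc i + z 0 i *: e_ i) - f (x + trunc i) =
    z 0 i * pd i f (x + trunc i + b *: e_ i).
  by have [b b1 b2] := axis_mvt (x + trunc i) i (z 0 i) hf; exists b.
have {hex}[b hb] := choice hex.
exists (fun i => trunc i + b i *: e_ i); split.
  move=> i j; rewrite !mxE eqxx /=; have [->|ij] := eqVneq j i.
    by rewrite ltnn add0r mulr1; case: (hb i).
  by rewrite mulr0 addr0; case: ifP => // _; rewrite normr0.
have -> : f (x + z) - f x = f (x + trunc n) - f (x + trunc 0%N).
  congr (f _ - f _); first by congr (_ + _); apply/rowP => i; rewrite mxE ltn_ord.
  by rewrite -[LHS]addr0; congr (_ + _); apply/rowP => i; rewrite !mxE.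
rewrite -(telescope_sumr (fun m => f (x + trunc m))) // big_mkord.
by apply: eq_bigr => i _; rewrite truncS addrA (hb i).2 -addrA.
Qed.

Definition l1n z : R := \sum_(i < n) `|z 0 i|.

Lemma l1n_sqr z : l1n z ^+ 2 <= n%:R * sqn z.
Proof.
have h (p q : R) : `|p| * `|q| <= (p ^+ 2 + q ^+ 2) / 2.
  rewrite -(real_normK (num_real p)) -(real_normK (num_real q)).
  by have := sqr_ge0 (`|p| - `|q|); nra.
rewrite expr2 /l1n mulr_suml.
apply: (@le_trans _ _ (\sum_(i < n) \sum_(j < n) (z 0 i ^+ 2 + z 0 j ^+ 2) / 2)).
  by apply: ler_sum => i _; rewrite mulr_sumr; apply: ler_sum => j _; exact: h.
rewrite le_eqVlt; apply/orP; left; apply/eqP.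
transitivity (\sum_(i < n) (z 0 i ^+ 2 / 2 * n%:R + sqn z / 2)).
  apply: eq_bigr => i _; rewrite -mulr_suml big_split /= mulrDl; congr (_ + _).
  by rewrite sumr_const card_ord -mulr_natr; ring.
by rewrite big_split /= sumr_const card_ord -!mulr_suml -mulr_natr /sqn; field.
Qed.

Lemma csmooth_lip f x z M : csmooth f -> (forall i w, `|pd i f w| <= M) ->
  `|f (x + z) - f x| <= M * l1n z.
Proof.
move=> hf hM; have [xi [_ ->]] := path_mvt x z hf.
apply: le_trans (ler_norm_sum _ _ _) _; rewrite /l1n mulr_sumr.
by apply: ler_sum => i _; rewrite normrM mulrC ler_wpM2r.
Qed.

Definition dir y f x : R := \sum_(i < n) y 0 i * pd i f x.

Lemma csmooth_dir y f : csmooth f -> csmooth (dir y f).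
Proof. by move=> hf; apply: csmooth_sum => u; exact: csmooth_pd. Qed.

Lemma csmooth_quad f x z M : csmooth f -> (forall i j w, `|pd j (pd i f) w| <= M) ->
  `|f (x + z) - f x - dir z f x| <= M * l1n z ^+ 2.
Proof.
move=> hf hM; have [xi [hxi ->]] := path_mvt x z hf.
(* In dimension 0 no index is available from which to read [0 <= M]. *)
have [n0|n0] := posnP n.
  have e0 (F : 'I_n -> R) : \sum_(i < n) F i = 0.
    by rewrite big1 // => i _; have := ltn_ord i; rewrite {2}n0.
  by rewrite /dir /l1n !e0 subrr normr0 expr0n mulr0.
have M0 : 0 <= M by have := hM (Ordinal n0) (Ordinal n0) 0; exact: le_trans.
rewrite /dir -sumrB; apply: le_trans (ler_norm_sum _ _ _) _.
rewrite expr2 mulrA mulrC {1}/l1n mulr_suml; apply: ler_sum => i _.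
rewrite -mulrBr normrM ler_wpM2l //.
apply: le_trans (csmooth_lip (M := M) _ _ _ _) _; [exact: csmooth_pd|by []|].
by rewrite ler_wpM2l // ler_sum.
Qed.

Lemma csmooth_bounded_fam (I : finType) (F : I -> rV -> R) : (forall u, csmooth (F u)) ->
  exists2 M : R, 0 <= M & forall u x, `|F u x| <= M.
Proof.
move=> hF; have [B hB] := choice (fun u => csmooth_bounded (hF u)).
exists (\sum_u `|B u|); first exact: sumr_ge0.
move=> u x; apply: le_trans (hB u x) _; apply: le_trans (ler_norm _) _.
by rewrite (bigD1 u) //= lerDl sumr_ge0.
Qed.

Lemma l1nZ (c : R) z : l1n (c *: z) = `|c| * l1n z.
Proof. by rewrite /l1n mulr_sumr; apply: eq_bigr => i _; rewrite mxE normrM. Qed.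

Lemma dirZ (c : R) z f x : dir (c *: z) f x = c * dir z f x.
Proof. by rewrite /dir mulr_sumr; apply: eq_bigr => i _; rewrite mxE mulrA. Qed.

(** The quadratic estimate [csmooth_quad] takes the place of a chain rule in several variables. *)
Lemma line_derive f x y (th : R) : csmooth f ->
  is_derive th 1 (fun r : R => f (x + r *: y)) (dir y f (x + th *: y)).
Proof.
move=> hf.
have [M _ hM] := csmooth_bounded_fam (fun u : 'I_n * 'I_n => csmooth_pd u.2 (csmooth_pd u.1 hf)).
apply: (@is_derive_quadratic _ _ _ _ (M * l1n y ^+ 2) 1) => // e _.
have := csmooth_quad (x + th *: y) (e *: y) hf (fun i j => hM (i, j)).
rewrite scalerDl addrA l1nZ dirZ exprMn real_normK ?num_real //.
by rewrite -mulrA [_ ^+ 2 * l1n _ ^+ 2]mulrC.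
Qed.

Lemma line_deriveN f x y (th : R) : csmooth f ->
  is_derive th 1 (fun r : R => f (x - r *: y)) (- dir y f (x - th *: y)).
Proof.
move=> hf; have := line_derive x (- y) th hf; rewrite scalerN.
have -> : dir (- y) f (x - th *: y) = - dir y f (x - th *: y).
  by rewrite -scaleN1r dirZ mulN1r.
by under eq_fun do rewrite scalerN.
Qed.

Lemma csmooth_sdiff f y : csmooth f -> csmooth (sdiff f y).
Proof.
move=> hf; have -> : sdiff f y =
    (fun x => (0 + 2 * f x) + (-1) * f (x + y) + (-1) * f (x + - y)).
  by apply/funext => x; rewrite /sdiff add0r !mulN1r.
apply: csmooth_lin; last exact: csmooth_shift.
apply: csmooth_lin; last exact: csmooth_shift.
by apply: csmooth_lin => //; exact: csmooth0.
Qed.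

Lemma pd_sdiff k f y : csmooth f -> pd k (sdiff f y) = sdiff (pd k f) y.
Proof.
move=> hf; have -> : sdiff f y =
    (fun x => (0 + 2 * f x) + (-1) * f (x + y) + (-1) * f (x + - y)).
  by apply/funext => x; rewrite /sdiff add0r !mulN1r.
have h0 := csmooth0; have h1 := csmooth_lin 2 h0 hf.
have h2 := csmooth_shift y hf; have h3 := csmooth_shift (- y) hf.
rewrite pd_lin //; last exact: csmooth_lin.
rewrite pd_lin // pd_lin // !pd_shift.
by apply/funext => x; rewrite /sdiff /= {1}/pd derive_cst add0r !mulN1r.
Qed.

Lemma sdiff_quad f x y M : csmooth f -> (forall i j w, `|pd j (pd i f) w| <= M) ->
  `|sdiff f y x| <= 2 * M * l1n y ^+ 2.
Proof.
move=> hf hM; have h1 := csmooth_quad x y hf hM; have h2 := csmooth_quad x (- y) hf hM.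
rewrite -scaleN1r dirZ l1nZ normrN1 mul1r mulN1r scaleN1r in h2.
have -> : sdiff f y x = - (f (x + y) - f x - dir y f x) + - (f (x - y) - f x - - dir y f x).
  by rewrite /sdiff; ring.
apply: le_trans (ler_normD _ _) _; rewrite !normrN -mulrA mulr_natl mulr2n.
exact: lerD.
Qed.

(** The 4 comes from the four values of f, the 2 n from [sdiff_quad] and the comparison of the l1
    norm with the Euclidean one. *)
Lemma sdiff_bound f x y B : 0 <= B -> csmooth f -> (forall w, `|f w| <= B) ->
  (forall i j w, `|pd j (pd i f) w| <= B) ->
  `|sdiff f y x| <= (4 + 2 * n%:R) * B * Num.min 1 (sqn y).
Proof.
move=> B0 hf h0 h2.
have n0 : 0 <= n%:R :> R by [].
have q0 : 0 <= sqn y by exact: sqn_ge0.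
have b1 : `|sdiff f y x| <= 4 * B.
  apply: le_trans (ler_normB _ _) _; apply: le_trans (lerD (ler_normB _ _) (lexx _)) _.
  rewrite normrM (ger0_norm (_ : 0 <= 2)) //.
  by have := h0 x; have := h0 (x + y); have := h0 (x - y); lra.
have b2 : `|sdiff f y x| <= 2 * n%:R * B * sqn y.
  apply: le_trans (sdiff_quad x y hf h2) _; have := l1n_sqr y.
  by move=> h; have := ler_wpM2l (mulr_ge0 (ler0n R 2) B0) h; lra.
have nB := mulr_ge0 n0 B0; have Bq := mulr_ge0 B0 q0.
by rewrite minEle; case: ifP => _; nra.
Qed.

Lemma csmooth_bound2_fam (I : finType) (F : I -> rV -> R) : (forall u, csmooth (F u)) ->
  exists2 B : R, 0 <= B & forall u, (forall w, `|F u w| <= B) /\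
    forall i j w, `|pd j (pd i (F u)) w| <= B.
Proof.
move=> hF; have [B1 B10 h1] := csmooth_bounded_fam hF.
have [B2 B20 h2] := csmooth_bounded_fam
  (fun u : I * 'I_n * 'I_n => csmooth_pd u.2 (csmooth_pd u.1.2 (hF u.1.1))).
exists (B1 + B2); first exact: addr_ge0.
move=> u; split=> [w|i j w].
  by apply: le_trans (h1 u w) _; rewrite lerDl.
by apply: le_trans (h2 (u, i, j) w) _; rewrite lerDr.
Qed.

(** [sdiff_bound] is used twice. Applied to f and to its second derivatives it bounds [sdiff f z]
    and the second derivatives of [sdiff f z]; applied to [sdiff f z] it then gives the product of
    two minima. Each use costs a factor c, whence c (c B). *)
Lemma csmooth_tame f : csmooth f -> exists M A : R, [/\ 0 <= A, tame f M A &
  forall y, tame (sdiff f y) (4 * M) (A * Num.min 1 (sqn y))].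
Proof.
move=> hf; pose F (u : option ('I_n * 'I_n)) :=
  if u is Some (i, j) then pd j (pd i f) else f.
have hF u : csmooth (F u) by case: u => [[i j]|] //=; do 2 apply: csmooth_pd.
have [B B0 hB] := csmooth_bound2_fam hF.
pose c : R := 4 + 2 * n%:R.
have c1 : 1 <= c by rewrite /c; have := ler0n R n; lra.
have c0 : 0 <= c by lra.
have m0 y : 0 <= Num.min 1 (sqn y) by rewrite le_min ler01 sqn_ge0.
have b u x y : `|sdiff (F u) y x| <= c * B * Num.min 1 (sqn y).
  by apply: sdiff_bound => //; have [] := hB u.
exists B, (c * (c * B)); split; first by rewrite !mulr_ge0.
  split; first by apply: mrow_continuous; exact: csmooth_continuous.
    by have [] := hB None.
  move=> x y; apply: le_trans (b None x y) _.
  by rewrite ler_wpM2r // ler_peMl // mulr_ge0.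
move=> z; have hz := csmooth_sdiff z hf; split.
- by apply: mrow_continuous; exact: csmooth_continuous.
- move=> x; have [h0 _] := hB None; rewrite /sdiff.
  apply: le_trans (ler_normB _ _) _; apply: le_trans (lerD (ler_normB _ _) (lexx _)) _.
  rewrite normrM (ger0_norm (_ : 0 <= 2)) //.
  by have := h0 x; have := h0 (x + z); have := h0 (x - z); rewrite /=; lra.
- move=> x y; have := @sdiff_bound (sdiff f z) x y (c * B * Num.min 1 (sqn z)) _ hz.
  rewrite mulr_ge0 // ?mulr_ge0 // => /(_ isT (fun w => b None w z)) h.
  apply: le_trans (h _) _; last by rewrite -/c !mulrA.
  move=> i j w; rewrite !pd_sdiff //; first exact: (b (Some (i, j)) w z).
  exact: csmooth_pd.
Qed.

Lemma dir_dir_pd_bound f y i j w B : csmooth f ->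
  (forall u v, `|pd j (pd i (pd u (pd v f))) w| <= B) ->
  `|pd j (pd i (dir y (dir y f))) w| <= B * l1n y ^+ 2.
Proof.
move=> hf hB.
have h1 u : csmooth (pd u f) by exact: csmooth_pd.
have h2 u v : csmooth (pd v (pd u f)) by exact: csmooth_pd.
have h3 u v k : csmooth (pd k (pd v (pd u f))) by exact: csmooth_pd.
have -> : pd j (pd i (dir y (dir y f))) w =
    \sum_(u < n) y 0 u * \sum_(v < n) y 0 v * pd j (pd i (pd u (pd v f))) w.
  have -> : dir y (dir y f) = fun x => \sum_(u < n) y 0 u *
      (fun x => \sum_(v < n) y 0 v * pd u (pd v f) x) x.
    by apply/funext => x; apply: eq_bigr => u _; rewrite /dir pd_sum.
  have hs u : csmooth (fun x => \sum_(v < n) y 0 v * pd u (pd v f) x).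
    exact: csmooth_sum.
  rewrite pd_sum // pd_sum; last by move=> u; exact: csmooth_pd.
  by apply: eq_bigr => u _; rewrite pd_sum // pd_sum.
apply: le_trans (ler_norm_sum _ _ _) _.
rewrite expr2 mulrCA {1}/l1n mulr_suml; apply: ler_sum => u _.
rewrite normrM ler_wpM2l //; apply: le_trans (ler_norm_sum _ _ _) _.
rewrite /l1n mulr_sumr; apply: ler_sum => v _.
by rewrite normrM mulrC ler_wpM2r.
Qed.

(** Odd orders cancel by symmetry, so the remainder is of order |y|^4. Along the line, [k] vanishes
    to first order at 0, and its second derivative is minus the second difference of [DD] with step
    r y, which is again quadratic in y while [DD] is already so. *)
Lemma csmooth_taylor f : csmooth f -> exists2 C : R, 0 <= C & forall x y,
  `|- sdiff f y x - dir y (dir y f) x| <= C * sqn y ^+ 2.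
Proof.
move=> hf.
have [B B0 hB] := csmooth_bounded_fam (fun u : 'I_n * 'I_n * 'I_n * 'I_n =>
  csmooth_pd u.1.1.1 (csmooth_pd u.1.1.2 (csmooth_pd u.1.2 (csmooth_pd u.2 hf)))).
exists (2 * B * n%:R ^+ 2); first by rewrite !mulr_ge0 // exprn_ge0.
move=> x y; set DD := dir y (dir y f).
have hD : csmooth (dir y f) by exact: csmooth_dir.
have hDD : csmooth DD by exact: csmooth_dir.
pose k (r : R) := f (x + r *: y) + f (x - r *: y) - 2 * f x - r ^+ 2 * DD x.
pose k1 (r : R) := dir y f (x + r *: y) - dir y f (x - r *: y) - 2 * r * DD x.
have -> : - sdiff f y x - DD x = k 1.
  by rewrite /k /sdiff scale1r expr1n; ring.
apply: (@le_trans _ _ (2 * (B * l1n y ^+ 2) * l1n y ^+ 2)); last first.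
  have h := l1n_sqr y; have l0 : 0 <= l1n y ^+ 2 by exact: sqr_ge0.
  have := @ler_pM _ (l1n y ^+ 2) (n%:R * sqn y) (l1n y ^+ 2) (n%:R * sqn y) l0 l0 h h.
  by move=> h'; have := ler_wpM2l (mulr_ge0 (ler0n R 2) B0) h'; lra.
apply: (@taylor2_le _ k k1 (fun r => - sdiff DD (r *: y) x)).
- move=> r; rewrite /k.
  have d1 := line_derive x y r hf; have d2 := line_deriveN x y r hf.
  by apply: is_derive_eq; rewrite /k1 /GRing.scale /=; ring.
- move=> r; rewrite /k1.
  have := is_derive_sub_linear (DD x) (line_derive x y r hD) (line_deriveN x y r hD).
  congr is_derive; rewrite /sdiff -/DD.
  by move: (DD (x + r *: y)) (DD (x - r *: y)) (DD x) => p q w; ring.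
- by rewrite /k scale0r subr0 addr0; ring.
- by rewrite /k1 scale0r subr0 addr0; ring.
move=> r /andP[r0 r1]; rewrite normrN.
apply: le_trans (sdiff_quad x (r *: y) hDD (M := B * l1n y ^+ 2) _) _.
  move=> i j w; apply: dir_dir_pd_bound => // u v; exact: (hB (j, i, u, v)).
rewrite l1nZ exprMn real_normK ?num_real //.
apply: ler_wpM2l; first exact: mulr_ge0 (mulr_ge0 B0 (sqr_ge0 _)).
by apply: ler_piMl; rewrite ?sqr_ge0 // expr_le1.
Qed.

End Csmooth.

(** * Derivatives from forward estimates *)

Section HalfLine.
Context (R : realType).

Lemma half_lipschitz_continuous (phi : R -> R) L : 0 <= L ->
  (forall t, t <= 0 -> phi t = phi 0) ->
  (forall t h, 0 <= t -> 0 <= h -> `|phi (t + h) - phi t| <= L * h) -> continuous phi.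
Proof.
move=> L0 phi0 hL.
have lip a b : `|phi a - phi b| <= L * `|a - b|.
  wlog ab : a b / b <= a.
    move=> H; have [/H//|/ltW /H] := leP b a.
    by rewrite distrC (distrC b).
  have ab0 : 0 <= a - b by rewrite subr_ge0.
  rewrite (ger0_norm ab0); have [b0|b0] := leP b 0; last first.
    have := hL b (a - b) (ltW b0) ab0.
    by rewrite [b + _]addrC subrK.
  rewrite (phi0 b) //; have [a0|/ltW a0] := leP a 0.
    by rewrite (phi0 a) // subrr normr0 mulr_ge0.
  have := hL 0 a (lexx 0) a0; rewrite add0r => /le_trans; apply.
  by rewrite ler_wpM2l // lerDl oppr_ge0.
move=> t; apply/cvgrPdist_le => e e0.
near=> w; apply: le_trans (lip t w) _.
have : `|t - w| <= e / (L + 1).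
  near: w; apply: (cvgrPdist_le _ _).1; first exact: cvg_id.
  by rewrite divr_gt0 // ltr_wpDl.
rewrite ler_pdivlMr ?ltr_wpDl //.
by have := normr_ge0 (t - w); nra.
Unshelve. all: by end_near. Qed.

Lemma half_derive_quadratic (phi psi : R -> R) C L : 0 <= C -> 0 <= L ->
  (forall t, t <= 0 -> phi t = phi 0) -> (forall t, t <= 0 -> psi t = psi 0) ->
  (forall t h, 0 <= t -> 0 <= h -> `|phi (t + h) - phi t| <= L * h) ->
  (forall t h, 0 <= t -> 0 <= h -> `|psi (t + h) - psi t| <= L * h) ->
  (forall t h, 0 <= t -> 0 <= h -> `|phi (t + h) - phi t - h * psi t| <= C * h ^+ 2) ->
  half_derive phi psi.
Proof.
move=> C0 L0 phi0 psi0 lphi lpsi quad; split.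
- exact: half_lipschitz_continuous lphi.
- exact: half_lipschitz_continuous lpsi.
move=> t t0; apply: (@is_derive_quadratic _ _ _ _ (C + L) t) => // e et.
have [e0|/ltW e0] := leP 0 e.
  by apply: le_trans (quad t e (ltW t0) e0) _; rewrite ler_wpM2r ?sqr_ge0 // lerDl.
(* For a backward step the forward estimate starts from t + e, and the Lipschitz bound on psi moves
   the slope back to t; this is why the constant is C + L. The radius t keeps t + e nonnegative. *)
have te : 0 <= t + e by rewrite ler0_norm // in et; lra.
have ne : 0 <= - e by rewrite oppr_ge0.
have := quad (t + e) (- e) te ne; have := lpsi (t + e) (- e) te ne.
rewrite !addrK sqrrN => h1 h2.
have -> : phi (t + e) - phi t - e * psi t =
  - (phi t - phi (t + e) - - e * psi (t + e)) + (- e) * (psi t - psi (t + e)) by ring.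
apply: le_trans (ler_normD _ _) _; rewrite normrN normrM (ger0_norm ne) mulrDl.
apply: lerD => //; apply: le_trans (ler_wpM2l ne h1) _.
by rewrite le_eqVlt; apply/orP; left; apply/eqP; ring.
Qed.

End HalfLine.

(** * The generator of the heat semigroup *)

Section HeatGenerator.
Context (R : realType) (n : nat).
Notation rV := ('rV[R]_n).
Notation tup := (n.-tuple (measurableTypeR R)).
Notation mun := (lebn R n).
Notation rt := (@row_of_tuple R n).
Implicit Types (f g : rV -> R) (x : rV).

(* The factor [1] puts [lap f] in the form of [csmooth_sum]. *)
Definition lap f x : R := \sum_(i < n) 1 * pd i (pd i f) x.

Lemma csmooth_lap f : csmooth f -> csmooth (lap f).
Proof. by move=> hf; apply: csmooth_sum => i; do 2 apply: csmooth_pd. Qed.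

Lemma sqnorm_coord (y : tup) i : tnth y i ^+ 2 <= sqnorm y.
Proof. by rewrite /sqnorm (bigD1 i) //= lerDl sumr_ge0 // => j _; rewrite sqr_ge0. Qed.

(** Off the diagonal, reflecting coordinate i preserves the kernel and reverses the sign of the
    integrand, so the moment equals its opposite. *)
Lemma heatn_moment_pair h (i j : 'I_n) : 0 < h ->
  mun.-integrable setT (EFin \o (fun y => heatn h y * (tnth y i * tnth y j))) /\
  \int[mun]_y (heatn h y * (tnth y i * tnth y j)) = (i == j)%:R * (2 * h).
Proof.
move=> h0.
have mt k : measurable_fun setT (fun y : tup => tnth y k) by exact: measurable_tnth.
have mij : measurable_fun setT (fun y : tup => tnth y i * tnth y j).
  by apply: measurable_funM; exact: mt.
have [int _] : mun.-integrable setT (EFin \o (fun y => heatn h y * (tnth y i * tnth y j))) /\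
  `|\int[mun]_y (heatn h y * (tnth y i * tnth y j))| <= 1 * (2 * n%:R * h).
  apply: heatn_Rintegral_sq => // y; rewrite mul1r normrM.
  have := sqnorm_coord y i; have := sqnorm_coord y j.
  rewrite -(real_normK (num_real (tnth y i))) -(real_normK (num_real (tnth y j))).
  by have := sqr_ge0 (`|tnth y i| - `|tnth y j|); nra.
split=> //; have [ij|ij] := eqVneq i j.
  rewrite -ij mul1r; apply: Rintegral_EFin.
  by rewrite -(@heatn_moment R n 1 h (2 * h) i) // heat1_moment2.
rewrite mul0r; set I := LHS; suff : I = - I by lra.
rewrite {1}/I -(@Rintegral_affine_tuple R n (fun k => if k == i then -1 else 1) (fun=> 0)) //; last 2 first.
- by move=> k; case: ifP; rewrite ?normrN1 ?normr1.
- by apply: measurable_funM => //; exact: measurable_heatn1.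
transitivity (\int[mun]_y (-1 * (heatn h y * (tnth y i * tnth y j)))); last first.
  by rewrite RintegralZl // mulN1r.
apply: eq_Rintegral => y _; rewrite mulN1r -mulrN; congr (_ * _).
  apply: eq_bigr => k _; rewrite tnth_mktuple addr0.
  by case: ifP; rewrite ?mul1r ?mulN1r ?heat1N.
by rewrite !tnth_mktuple eqxx eq_sym (negPf ij) !addr0 mulN1r mul1r mulNr.
Qed.

Lemma Rintegral_sum d (T : measurableType d) (m : {measure set T -> \bar R})
    (I : Type) (r : seq I) (F : I -> T -> R) :
  (forall u, m.-integrable setT (EFin \o F u)) ->
  m.-integrable setT (EFin \o (fun y => \sum_(u <- r) F u y)) /\
  \int[m]_y (\sum_(u <- r) F u y) = \sum_(u <- r) \int[m]_y F u y.
Proof.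
move=> hF; have iS (q : seq I) : m.-integrable setT (EFin \o (fun y => \sum_(u <- q) F u y)).
  rewrite (_ : EFin \o _ = fun y => (\sum_(u <- q) (F u y)%:E)%E); last first.
    by apply/funext => y; rewrite /= sumEFin.
  by apply: integrable_sum => // u _; exact: hF.
split=> //; elim: r => [|u r IH].
  rewrite big_nil; under eq_Rintegral do rewrite big_nil.
  by rewrite /Rintegral integral0.
rewrite big_cons -IH -RintegralD //; apply: eq_Rintegral => y _; by rewrite big_cons.
Qed.

Lemma dir_dirE f (y : rV) x : csmooth f ->
  dir y (dir y f) x = \sum_(p : 'I_n * 'I_n) pd p.1 (pd p.2 f) x * (y 0 p.1 * y 0 p.2).
Proof.
move=> hf; rewrite -(pair_bigA _ (fun i j => pd i (pd j f) x * (y 0 i * y 0 j))) /=.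
apply: eq_bigr => i _; rewrite /dir pd_sum; last by move=> u; exact: csmooth_pd.
by rewrite mulr_sumr; apply: eq_bigr => j _; ring.
Qed.

(** The second moments form 2 h times the identity matrix, so only the trace of the Hessian is
    left. *)
Lemma heatn_dir_dir f x h : csmooth f -> 0 < h ->
  mun.-integrable setT (EFin \o (fun y => heatn h y * dir (rt y) (dir (rt y) f) x)) /\
  \int[mun]_y (heatn h y * dir (rt y) (dir (rt y) f) x) = 2 * h * lap f x.
Proof.
move=> hf h0.
pose F (p : 'I_n * 'I_n) (y : tup) := pd p.1 (pd p.2 f) x * (heatn h y * (tnth y p.1 * tnth y p.2)).
have -> : (fun y => heatn h y * dir (rt y) (dir (rt y) f) x) = fun y => \sum_p F p y.
  apply/funext => y; rewrite dir_dirE // mulr_sumr; apply: eq_bigr => p _.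
  by rewrite !mxE /F; ring.
have hF p : mun.-integrable setT (EFin \o F p).
  by apply: integrable_EFinZl; have [] := heatn_moment_pair p.1 p.2 h0.
have [iS eS] := Rintegral_sum (index_enum _) hF; split => //.
rewrite [LHS]eS; under eq_bigr => p _.
  rewrite /F RintegralZl //; last by have [] := heatn_moment_pair p.1 p.2 h0.
  rewrite (heatn_moment_pair p.1 p.2 h0).2; over.
rewrite -(pair_bigA _ (fun i j => pd i (pd j f) x * ((i == j)%:R * (2 * h)))) /=.
rewrite /lap mulr_sumr; apply: eq_bigr => i _.
rewrite (bigD1 i) //= big1 ?addr0; first by rewrite eqxx !mul1r; ring.
by move=> j; rewrite eq_sym => /negPf ->; rewrite mul0r mulr0.
Qed.

(** P_h f - f is half the heat average of - [sdiff]. Its Taylor term averages to 2 h times the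
    Laplacian and the remainder is governed by the fourth moment, of order h^2. That C does not
    depend on x matters in [traj_quadratic]. *)
Lemma heat_generator f : csmooth f -> exists2 C : R, 0 <= C & forall x (h : R), 0 < h ->
  `|heat h f x - f x - h * lap f x| <= C * h ^+ 2.
Proof.
move=> hf; have [C C0 hC] := csmooth_taylor hf; have [M hM] := csmooth_bounded hf.
have mf : mrow f by exact: mrow_continuous (csmooth_continuous hf).
exists (C * (12 * n%:R ^+ 2)); first by rewrite !mulr_ge0 // exprn_ge0.
move=> x h h0; have [iD eD] := heatn_dir_dir x hf h0.
have msd : measurable_fun setT (fun y : tup => sdiff f (rt y) x) by exact: mrow_sdiff.
have B0 x' y : `|sdiff f y x'| <= 4 * M.
  rewrite /sdiff; apply: le_trans (ler_normB _ _) _.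
  apply: le_trans (lerD (ler_normB _ _) (lexx _)) _.
  rewrite normrM (ger0_norm (_ : 0 <= 2)) //.
  by have := hM x'; have := hM (x' + y); have := hM (x' - y); lra.
have M0 : 0 <= 4 * M := le_trans (normr_ge0 _) (B0 x 0).
have [iS _] := heatn_Rintegral_le h0 M0 msd (fun y => B0 x (rt y)).
have mDD : measurable_fun setT (fun y : tup => dir (rt y) (dir (rt y) f) x).
  under eq_fun do rewrite dir_dirE //; apply: measurable_sum => p.
  apply: measurable_funM => //; apply: measurable_funM; exact: measurable_row_of_tuple.
have mF : measurable_fun setT (fun y : tup => - sdiff f (rt y) x - dir (rt y) (dir (rt y) f) x).
  by apply: measurable_funB => //; exact: measurableT_comp (@oppr_measurable R setT) msd.
have hCF (y : tup) : `|- sdiff f (rt y) x - dir (rt y) (dir (rt y) f) x| <= C * sqnorm y ^+ 2.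
  by rewrite sqnormE; exact: hC.
have := heatn_Rintegral_sq2 h0 C0 mF hCF.
have -> : \int[mun]_y (heatn h y * (- sdiff f (rt y) x - dir (rt y) (dir (rt y) f) x)) =
    2 * (heat h f x - f x - h * lap f x).
  transitivity (- (\int[mun]_y (heatn h y * sdiff f (rt y) x)) -
     \int[mun]_y (heatn h y * dir (rt y) (dir (rt y) f) x)); last first.
    rewrite eD; have := heat_sdiff mf hM x h0.
    move: (\int[mun]_y (heatn h y * sdiff f (rt y) x)) => I e.
    by rewrite (_ : I = 2 * (2^-1 * I)); [rewrite -e; ring|field].
  rewrite -mulN1r -RintegralZl // -RintegralB //; last exact: integrable_EFinZl.
  by apply: eq_Rintegral => y _; ring.
rewrite normrM (ger0_norm (_ : 0 <= 2)) // => h2.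
have : 0 <= `|heat h f x - f x - h * lap f x| by [].
by move: h2; set a := `|_|; lra.
Qed.

Variables (f : rV -> R).
Hypothesis hf : csmooth f.

Let mf : mrow f. Proof. exact: mrow_continuous (csmooth_continuous hf). Qed.
Let hl : csmooth (lap f). Proof. exact: csmooth_lap. Qed.
Let ml : mrow (lap f). Proof. exact: mrow_continuous (csmooth_continuous hl). Qed.

(** At a positive time the expression is P_t applied to P_h f - f - h Delta f, and P_t does not
    increase the supremum norm, so the estimate at time 0 is carried over with the same constant. *)
Lemma traj_quadratic : exists2 C : R, 0 <= C & forall x (t h : R), 0 <= t -> 0 <= h ->
  `|traj f x (t + h) - traj f x t - h * traj (lap f) x t| <= C * h ^+ 2.
Proof.
have [C C0 hC] := heat_generator hf; exists C => // x t h t0.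
rewrite le_eqVlt => /predU1P[<-|h0].
  by rewrite addr0 subrr mul0r subrr normr0 expr0n mulr0.
move: t0; rewrite le_eqVlt => /predU1P[<-|t0].
  by rewrite add0r /traj ltxx h0; exact: hC.
have [M hM] := csmooth_bounded hf; have [N hN] := csmooth_bounded hl.
rewrite /traj addr_gt0 // t0 -(heat_semigroup mf hM) //.
have bh z : `|heat h f z| <= M by exact: heat_le.
have mh := mrow_heat mf h.
have sh (g : rV -> R) : mrow g -> measurable_fun setT (fun y : tup => g (x + rt y)).
  by move=> mg; exact: mrow_shift.
have i1 := heat_integrable mh bh x t0.
have i2 := heat_integrable mf hM x t0.
have i3 := heat_integrable ml hN x t0.
rewrite /heat -/(heat h f) -RintegralZl // -!RintegralB //; last 2 first.
- exact: (integrableB measurableT i1 i2).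
- exact: integrable_EFinZl.
have -> : (fun y : tup => heatn t y * heat h f (x + rt y) - heatn t y * f (x + rt y) -
    h * (heatn t y * lap f (x + rt y))) = fun y : tup => heatn t y *
    (heat h f (x + rt y) - f (x + rt y) - h * lap f (x + rt y)).
  by apply/funext => y; ring.
apply: (heatn_Rintegral_le t0 _ _ _).2.
- by rewrite mulr_ge0 ?sqr_ge0.
- apply: measurable_funB; first by apply: measurable_funB; exact: sh.
  by apply: measurable_funM; [exact: measurable_cst|exact: sh].
- by move=> y; exact: hC.
Qed.

Lemma traj_le M : (forall x, `|f x| <= M) -> forall x t, `|traj f x t| <= M.
Proof. by move=> hM x t; rewrite /traj; case: ifP => [t0|_] //; exact: heat_le. Qed.

End HeatGenerator.

(** * Composition of fractional Laplacians *)

Section FlapComposition.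
Context (R : realType) (n : nat).
Notation rV := ('rV[R]_n).
Implicit Types (f : rV -> R) (x : rV).

Lemma traj_lipschitz f : csmooth f -> exists2 L : R, 0 <= L & forall x (t h : R),
  0 <= t -> 0 <= h -> `|traj f x (t + h) - traj f x t| <= L * h.
Proof.
move=> hf; have hl := csmooth_lap hf.
have [C C0 hC] := traj_quadratic hf.
have [M hM] := csmooth_bounded hf; have [N hN] := csmooth_bounded hl.
have M0 : 0 <= M := le_trans (normr_ge0 _) (hM 0).
have N0 : 0 <= N := le_trans (normr_ge0 _) (hN 0).
(* For h <= 1 the quadratic estimate gives (C + N) h; for h > 1 the trivial bound 2 M is at most 2 M
   h. *)
exists (C + N + 2 * M); first by rewrite !addr_ge0 // mulr_ge0.
move=> x t h t0 h0; have bf := traj_le hf hM x; have bl := traj_le hl hN x.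
have [h1|h1] := leP h 1.
  have := hC x t h t0 h0; set d := _ - traj f x t => hd.
  have -> : d = (d - h * traj (lap f) x t) + h * traj (lap f) x t by ring.
  apply: le_trans (ler_normD _ _) _; rewrite normrM (ger0_norm h0).
  have := bl t => hb; have := ler_wpM2l h0 hb => hb'.
  have hh : h ^+ 2 <= h by rewrite expr2 ler_piMl.
  have := ler_wpM2l C0 hh; have := mulr_ge0 M0 h0; lra.
apply: le_trans (ler_normB _ _) _; apply: le_trans (lerD (bf _) (bf _)) _.
have h1' := ltW h1; have := ler_wpM2l M0 h1'; have := mulr_ge0 C0 h0; have := mulr_ge0 N0 h0; lra.
Qed.

(** The heat equation at a fixed point. Used again for [lap f], it supplies the second derivative
    that the Marchaud calculus asks for. *)
Lemma half_derive_traj f x : csmooth f -> half_derive (traj f x) (traj (lap f) x).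
Proof.
move=> hf; have hl := csmooth_lap hf.
have [C C0 hC] := traj_quadratic hf.
have [L L0 hL] := traj_lipschitz hf; have [L' L'0 hL'] := traj_lipschitz hl.
have c0 g t : t <= 0 -> traj g x t = traj g x 0 by move=> t0; rewrite /traj ltxx ltNge t0.
apply: (@half_derive_quadratic _ _ _ C (L + L')).
- exact: C0.
- exact: addr_ge0.
- by move=> t; exact: c0.
- by move=> t; exact: c0.
- move=> t h t0 h0; apply: le_trans (hL x t h t0 h0) _.
  by rewrite ler_wpM2r // lerDl.
- move=> t h t0 h0; apply: le_trans (hL' x t h t0 h0) _.
  by rewrite ler_wpM2r // lerDr.
- by move=> t h; exact: hC.
Qed.

Section Comp.
Variables (f : rV -> R) (s s' : R).
Hypotheses (hf : csmooth f) (hs : 0 < s < 1) (hs' : 0 < s' < 1).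

Let traj_bounds : exists M : R, forall x t, [/\ `|traj f x t| <= M, `|traj (lap f) x t| <= M &
  `|traj (lap (lap f)) x t| <= M].
Proof.
have h1 := csmooth_lap hf; have h2 := csmooth_lap h1.
have [A hA] := csmooth_bounded hf; have [B hB] := csmooth_bounded h1.
have [C hC] := csmooth_bounded h2.
have A0 : 0 <= A := le_trans (normr_ge0 _) (hA 0).
have B0 : 0 <= B := le_trans (normr_ge0 _) (hB 0).
have C0 : 0 <= C := le_trans (normr_ge0 _) (hC 0).
exists (A + B + C) => x t.
have AM : A <= A + B + C by rewrite -addrA lerDl addr_ge0.
have BM : B <= A + B + C by rewrite [A + B]addrC -addrA lerDl addr_ge0.
have CM : C <= A + B + C by rewrite lerDr addr_ge0.
split.
- exact: le_trans (traj_le hf hA x t) AM.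
- exact: le_trans (traj_le h1 hB x t) BM.
- exact: le_trans (traj_le h2 hC x t) CM.
Qed.

Lemma flap_comp x : s + s' < 1 -> flap s (flap s' f) x = flap (s + s') f x.
Proof.
move=> ss; have [M hM] := traj_bounds.
have [A [B [B0 tf tsf]]] := csmooth_tame hf.
rewrite (flap_flap_marchaud x tf B0 tsf) //.
rewrite (marchaud_comp (M := M) (half_derive_traj x hf) (half_derive_traj x (csmooth_lap hf))) //.
- rewrite (flap_marchaud x tf B0) // ss andbT.
  by case/andP: hs => s0 _; case/andP: hs' => s0' _; exact: addr_gt0.
- by move=> t _; case: (hM x t).
- by move=> t _; case: (hM x t).
- by move=> t _; case: (hM x t).
Qed.

Lemma flap_comp1 x : s + s' = 1 -> flap s (flap s' f) x = - lap f x.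
Proof.
move=> ss; have [M hM] := traj_bounds.
have [A [B [B0 tf tsf]]] := csmooth_tame hf.
rewrite (flap_flap_marchaud x tf B0 tsf) //.
rewrite (marchaud_comp1 (M := M) (half_derive_traj x hf) (half_derive_traj x (csmooth_lap hf))) //.
- by rewrite /traj ltxx.
- by move=> t _; case: (hM x t).
- by move=> t _; case: (hM x t).
- by move=> t _; case: (hM x t).
Qed.

End Comp.
End FlapComposition.

(** * Complex-valued functions *)

Section ComplexValued.
Context (R : realType) (n : nat).
Local Open Scope complex_scope.
Notation Re := (@complex.Re R).
Notation Im := (@complex.Im R).
Implicit Types (u v : 'rV[R]_n -> R[i]) (x : 'rV[R]_n).

Lemma pderivsE l u x : pderivs l u x = pds l (Re \o u) x +i* pds l (Im \o u) x.
Proof.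
elim: l x => [|k l IH] x /=; first by case: (u x).
have eR : (fun y => Re (pderivs l u y)) = pds l (Re \o u).
  by apply/funext => y; rewrite IH.
have eI : (fun y => Im (pderivs l u y)) = pds l (Im \o u).
  by apply/funext => y; rewrite IH.
by rewrite /pderiv eR eI.
Qed.

Lemma schwartz_csmooth u : schwartz u -> csmooth (Re \o u) /\ csmooth (Im \o u).
Proof.
move=> [su bu].
have eR l : (fun y => Re (pderivs l u y)) = pds l (Re \o u).
  by apply/funext => y; rewrite pderivsE.
have eI l : (fun y => Im (pderivs l u y)) = pds l (Im \o u).
  by apply/funext => y; rewrite pderivsE.
have bnd l : exists M : R, forall x, `|pds l (Re \o u) x| <= M /\ `|pds l (Im \o u) x| <= M.
  (* The Schwartz seminorm with trivial polynomial weight bounds the derivative itself. *)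
  have [M hM] := bu (fun=> 0%N) l; exists M => x.
  have := hM x; rewrite big1 ?mul1r // pderivsE normc_def lecR /= => h.
  by split; apply: le_trans h; rewrite -sqrtr_sqr ler_wsqrtr // ?lerDl ?lerDr sqr_ge0.
split=> l; have [c1 c2 d1 d2] := su l; have [M hM] := bnd l.
- rewrite eR in c1; split; [exact: c1|by move=> x k; have := d1 x k; rewrite eR|by exists M => x; case: (hM x)].
- rewrite eI in c2; split; [exact: c2|by move=> x k; have := d2 x k; rewrite eI|by exists M => x; case: (hM x)].
Qed.

(** The kernel is real and [Cintegral] treats real and imaginary parts separately, so the identity
    holds for every [v] and can be applied to [frac_laplacian s' u]. *)
Lemma frac_laplacianE s v x : s != 1 ->
  frac_laplacian s v x = flap s (Re \o v) x +i* flap s (Im \o v) x.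
Proof.
move=> /negPf s1; rewrite /frac_laplacian s1.
have divE (z : R[i]) (c : R) : z / c%:C = (Re z / c) +i* (Im z / c).
  rewrite -fmorphV /=; case: z => a b; simpc; by [].
have -> : (fun y => (2 * v x - v (x + y) - v (x - y)) / (enorm y `^ (n%:R + 2 * s))%:C) =
   fun y => (sdiff (Re \o v) y x / enorm y `^ (n%:R + 2 * s)) +i*
            (sdiff (Im \o v) y x / enorm y `^ (n%:R + 2 * s)).
  apply/funext => y; rewrite divE /sdiff /=.
  by case: (v x) (v (x + y)) (v (x - y)) => a b [c d] [e g] /=; congr (_ / _ +i* (_ / _)); ring.
rewrite /flap /riesz /Cintegral /=.
have cM (c a b : R) : (c / 2)%:C * (a +i* b) = (c * a / 2) +i* (c * b / 2).
  by simpc; rewrite ![c / 2 * _]mulrAC.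
exact: cM.
Qed.

Lemma sum_complex (I : Type) (r : seq I) (F G : I -> R) :
  \sum_(i <- r) (F i +i* G i) = (\sum_(i <- r) F i) +i* (\sum_(i <- r) G i).
Proof. by elim/big_rec3: _ => // i a b c _ ->; simpc. Qed.

Lemma neg_laplacianE v x : neg_laplacian v x =
  (- lap (Re \o v) x) +i* (- lap (Im \o v) x).
Proof.
have e k : pderiv k (pderiv k v) x = pd k (pd k (Re \o v)) x +i* pd k (pd k (Im \o v)) x.
  exact: (pderivsE [:: k; k] v x).
have lapE (f : 'rV[R]_n -> R) : lap f x = \sum_(k < n) pd k (pd k f) x.
  by apply: eq_bigr => k _; exact: mul1r.
rewrite !lapE /neg_laplacian; under eq_bigr do rewrite e.
by rewrite sum_complex.
Qed.

Lemma frac_laplacian_comp (s s' : R) u : 0 < s < 1 -> 0 < s' < 1 -> s + s' <= 1 ->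
  schwartz u -> frac_laplacian (s + s') u = frac_laplacian s (frac_laplacian s' u).
Proof.
move=> hs hs' ss /schwartz_csmooth[hR hI]; apply/funext => x.
have ne1 (r : R) : 0 < r < 1 -> r != 1 by case/andP => _ /lt_eqF ->.
rewrite [RHS]frac_laplacianE ?ne1 //.
have eR : Re \o frac_laplacian s' u = flap s' (Re \o u).
  by apply/funext => y; rewrite /= frac_laplacianE ?ne1.
have eI : Im \o frac_laplacian s' u = flap s' (Im \o u).
  by apply/funext => y; rewrite /= frac_laplacianE ?ne1.
rewrite eR eI; move: ss; rewrite le_eqVlt => /predU1P[ss|ss].
  by rewrite /frac_laplacian ss eqxx neg_laplacianE (flap_comp1 hR hs hs' x ss) (flap_comp1 hI hs hs' x ss).
have ss1 : s + s' != 1 by rewrite lt_eqF.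
by rewrite (frac_laplacianE u x ss1) (flap_comp hR hs hs' x ss) (flap_comp hI hs hs' x ss).
Qed.

End ComplexValued.

Theorem corollary5p3 (R : realType) (n : nat) (hn : (1 <= n)%N) (s s' : R)
    (hs : 0 < s < 1) (hs' : 0 < s' < 1) (hss' : s + s' <= 1)
    (u : 'rV[R]_n -> complex R) (hu : schwartz u) :
  frac_laplacian (s + s') u = frac_laplacian s (frac_laplacian s' u) /\
  frac_laplacian s (frac_laplacian s' u) =
    frac_laplacian s' (frac_laplacian s u).
Proof.
have ss' : s' + s <= 1 by rewrite addrC.
have e := frac_laplacian_comp hs hs' hss' hu.
split; first exact: e.
(* The composition rule with the two orders exchanged, transported along s + s' = s' + s. *)
exact (etrans (esym e) (etrans (f_equal (fun r => frac_laplacian r u) (addrC s s'))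
  (frac_laplacian_comp hs' hs ss' hu))).
Qed.
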